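(* Fix $n$ and let $1\le i_1,i_2\le n-1$ and $i_3=i_1+i_2\le n$. (1) There is an isomorphism in $\mathrm{HMF}^{gr}_{\mathbb{Q}[\mathcal X_{i_3,1},\mathcal X_{i_3,2}],\ F_{i_3}(\mathcal X_{i_3,1})-F_{i_3}(\mathcal X_{i_3,2})}$ $$\mathcal M_{i_1,i_2}(\mathcal X_{i_1,3},\mathcal X_{i_2,4};\mathcal X_{i_3,1})\boxtimes\mathcal S_{i_1,i_2}(\mathcal X_{i_1,3},\mathcal X_{i_2,4};\mathcal X_{i_3,2})\simeq\bigoplus_{j=0}^{i_1i_3-i_1^2}\Big(\mathcal L_{i_3}(\mathcal X_{i_3,1};\mathcal X_{i_3,2})\{-i_1i_3+i_1^2+2j\}\Big)^{\oplus p(j,i_3;i_1)}.$$ (2) There is an isomorphism in $\mathrm{HMF}^{gr}_{\mathbb{Q}[\mathcal X_{i_1,1},\mathcal X_{i_1,2}],\ F_{i_1}(\mathcal X_{i_1,1})-F_{i_1}(\mathcal X_{i_1,2})}$ $$\mathcal S_{i_1,i_2}(\mathcal X_{i_1,1},\mathcal X_{i_2,4};\mathcal X_{i_3,3})\boxtimes\mathcal M_{i_1,i_2}(\mathcal X_{i_1,2},\mathcal X_{i_2,4};\mathcal X_{i_3,3})\simeq\bigoplus_{j=0}^{i_2(n-i_1)-i_2^2}\Big(\mathcal L_{i_1}(\mathcal X_{i_1,1};\mathcal X_{i_1,2})\{-i_2(n-i_1)+i_2^2+2j\}\Big)^{\oplus p(j,n-i_1;i_2)}\langle i_2\rangle.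$$
   Context: MATRIX FACTORIZATIONS. For a graded module $M$, $M\{m\}$ is $M$ with grading shifted up by $m$ (degree $i+m$ part of $M\{m\}$ is $M^i$). For a $\mathbb{Z}$-graded polynomial ring $R$ over $\mathbb{Q}$ and homogeneous $\omega\in R$, a matrix factorization with potential $\omega$ is $(M_0,M_1,d_0,d_1)$ with $M_0,M_1$ free graded $R$-modules (infinite rank allowed), $R$-linear $d_0:M_0\to M_1$, $d_1:M_1\to M_0$, $d_1d_0=\omega$, $d_0d_1=\omega$. Morphisms are pairs of grading-preserving $R$-linear maps commuting with differentials; $\mathrm{HMF}^{gr}_{R,\omega}$ is the category with morphisms modulo null-homotopic ones ($f_0=h_1d_{M_0}+d_{N_1}h_0$, $f_1=h_0d_{M_1}+d_{N_0}h_1$). Shift $\{m\}$ acts on both modules; $\overline M\langle1\rangle=(M_1,M_0,-d_1,-d_0)$, $\langle i\rangle=\langle1\rangle^i$. Tensor product: $$\overline M\boxtimes\overline N=\left(\begin{matrix}M_0\otimes N_0\\ \oplus\\ M_1\otimes N_1\end{matrix},\ \begin{matrix}M_1\otimes N_0\\ \oplus\\ M_0\otimes N_1\end{matrix},\ \begin{pmatrix}d_{M_0}&-d_{N_1}\\ d_{N_0}&d_{M_1}\end{pmatrix},\ \begin{pmatrix}d_{M_1}&d_{N_1}\\ -d_{N_0}&d_{M_0}\end{pmatrix}\right),$$ where for factorizations over polynomial rings in named variables the tensor product of modules is over the polynomial ring in the common variables; potentials add. $K(a;b)_A=(A,A\{\tfrac12(\deg b-\deg a)\},a,b)$ for homogeneous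 $a,b\in A$. A factorization over a larger ring whose potential lies in a polynomial subring $R$ is regarded as a factorization over $R$ (of possibly infinite rank); thus internal variables are not part of the base ring. DIAGRAM FACTORIZATIONS. $F_i$ is the polynomial with $F_i(e_1,\dots,e_i)=t_1^{n+1}+\cdots+t_i^{n+1}$, $e_j$ the elementary symmetric polynomials of $t_1,\dots,t_i$. $\mathcal X_{i,k}=(x_{1,k},\dots,x_{i,k})$ is a sequence of variables with $\deg x_{j,k}=2j$. All sequences below are of this kind. Line colored $i$ ($\mathbf x,\mathbf y$ of length $i$; $\mathbf x$ labels the outgoing and $\mathbf y$ the incoming end): $$\mathcal L_i(\mathbf x;\mathbf y)=\boxtimes_{j=1}^iK\Big(\tfrac{F_i(y_1,\dots,y_{j-1},x_j,x_{j+1},\dots,x_i)-F_i(y_1,\dots,y_{j-1},y_j,x_{j+1},\dots,x_i)}{x_j-y_j};\,x_j-y_j\Big)_{\mathbb{Q}[\mathbf x,\mathbf y]}.$$ For $1\le p,q\le n-1$, $r=p+q\le n$, and $\mathbf x,\mathbf y,\mathbf z$ of lengths $p,q,r$, let $e_j=e_j(\mathbf x,\mathbf y)$ be the degree $2j$ term of $(1+x_1+\dots+x_p)(1+y_1+\dots+y_q)$, $1\le j\le r$. Merging vertex ($p,q$ merge into $r$): $$\mathcal M_{p,q}(\mathbf x,\mathbf y;\mathbf z)=\boxtimes_{j=1}^rK\Big(\tfrac{F_r(e_1,\dots,e_{j-1},z_j,z_{j+1},\dots,z_r)-F_r(e_1,\dots,e_{j-1},e_j,z_{j+1},\dots,z_r)}{z_j-e_j};\,z_j-e_j\Big)_{\mathbb{Q}[\mathbf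 x,\mathbf y,\mathbf z]},$$ of potential $F_r(\mathbf z)-F_p(\mathbf x)-F_q(\mathbf y)$. Splitting vertex ($r$ splits into $p,q$): $$\mathcal S_{p,q}(\mathbf x,\mathbf y;\mathbf z)=\boxtimes_{j=1}^rK\Big(\tfrac{F_r(z_1,\dots,z_{j-1},e_j,e_{j+1},\dots,e_r)-F_r(z_1,\dots,z_{j-1},z_j,e_{j+1},\dots,e_r)}{e_j-z_j};\,e_j-z_j\Big)_{\mathbb{Q}[\mathbf x,\mathbf y,\mathbf z]}\{-pq\},$$ of potential $F_p(\mathbf x)+F_q(\mathbf y)-F_r(\mathbf z)$. The left side of (1) is the factorization of the diagram in which an edge colored $i_3$ splits into edges $i_1,i_2$ which merge back into $i_3$; the left side of (2) is that of the diagram in which an edge colored $i_1$ merges with an edge $i_2$ into $i_3$, which splits into $i_1$ and $i_2$, the outgoing $i_2$ edge being closed up to the incoming one. MULTIPLICITIES. For $0\le n_2\le n_1$ the integers $p(j,n_1;n_2)$ are defined by $\left[{n_1\atop n_2}\right]=\sum_{j=0}^{n_1n_2-n_2^2}p(j,n_1;n_2)\,q^{-n_1n_2+n_2^2+2j}$, where $\left[{n_1\atop n_2}\right]=\frac{[n_1]!}{[n_2]![n_1-n_2]!}$, $[m]=\frac{q^m-q^{-m}}{q-q^{-1}}$. *)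

(* Defs.v *)
From Stdlib Require ClassicalEpsilon.
From HB Require Import structures.
From mathcomp Require Import all_boot all_order all_algebra.
From mathcomp Require Import fraction.
From mathcomp.multinomials Require Import mpoly.

Set Implicit Arguments.
Unset Strict Implicit.
Unset Printing Implicit Defensive.

Import GRing.Theory.
Local Open Scope ring_scope.

(* A graded polynomial ring is {mpoly rat[N]} together with the degrees
   w : 'I_N -> nat of its variables.  Named variables are indices in 'I_N, so a
   sequence of variables of length i is a map 'I_i -> 'I_N.  Variables and
   sequences are numbered from 0: the informal x_j is x (j - 1). *)

Definition wdeg (N : nat) (w : 'I_N -> nat) (m : 'X_{1..N}) : nat :=
  (\sum_(i < N) m i * w i)%N.

Fact wdeg0 N (w : 'I_N -> nat) : wdeg w 0%MM = 0%N.
Proof. by rewrite /wdeg big1 // => i _; rewrite mnm0E. Qed.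

Fact wdegD N (w : 'I_N -> nat) :
  {morph wdeg w : m1 m2 / (m1 + m2)%MM >-> (m1 + m2)%N}.
Proof.
move=> m1 m2; rewrite /wdeg -big_split /=.
by apply: eq_bigr => i _; rewrite mnmDE mulnDl.
Qed.

HB.instance Definition _ N (w : 'I_N -> nat) :=
  isMeasure.Build N (wdeg w) (wdeg0 w) (wdegD w).

Definition pdeg N (w : 'I_N -> nat) (p : {mpoly rat[N]}) : nat :=
  (mmeasure (wdeg w) p).-1.

(* Homogeneity in an integral degree: only 0 is homogeneous of degree d < 0. *)
Definition zhomog N (w : 'I_N -> nat) (d : int) (p : {mpoly rat[N]}) : Prop :=
  forall m, m \in msupp p -> (wdeg w m)%:Z = d.

Definition stdw (i : nat) (j : 'I_i) : nat := (2 * j.+1)%N.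

Definition catw (a b : nat) (u : 'I_a -> nat) (v : 'I_b -> nat)
    (i : 'I_(a + b)) : nat :=
  match split i with inl j => u j | inr j => v j end.

Definition pvar N i (x : 'I_i -> 'I_N) (j : 'I_i) : {mpoly rat[N]} := 'X_(x j).

(* Inclusion of the polynomial ring in the variables named by x. *)
Definition pincl N k (x : 'I_k -> 'I_N) (p : {mpoly rat[k]}) : {mpoly rat[N]} :=
  p \mPo [tuple pvar x j | j < k].

(* The quotient p / q, for q nonzero dividing p. *)
Definition pquot N (p q : {mpoly rat[N]}) : {mpoly rat[N]} :=
  ClassicalEpsilon.epsilon (inhabits 0) (fun c => c * q = p).

(* Below, the base ring R is {mpoly rat[k]}, graded by w : 'I_k -> nat. *)

Record gmodule (k : nat) := GModule {
  gm_sort :> lmodType {mpoly rat[k]};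
  gm_homog : int -> gm_sort -> Prop
}.

(* M is the direct sum of the R{e i}, generated by the b i in degree e i. *)
Definition graded_free k (w : 'I_k -> nat) (M : gmodule k) : Prop :=
  exists (I : choiceType) (b : I -> M) (e : I -> int),
    [/\ forall v : M, exists (s : seq I) (c : I -> {mpoly rat[k]}),
          v = \sum_(i <- s) c i *: b i,
        forall (s : seq I) (c : I -> {mpoly rat[k]}), uniq s ->
          \sum_(i <- s) c i *: b i = 0 -> forall i, i \in s -> c i = 0
      & forall (d : int) (v : M), gm_homog d v <->
          exists (s : seq I) (c : I -> {mpoly rat[k]}),
            [/\ uniq s, v = \sum_(i <- s) c i *: b i
              & forall i, i \in s -> zhomog w (d - e i) (c i)]].

Record factorization (k : nat) := Factorization {
  fmod0 : gmodule k;
  fmod1 : gmodule k;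
  fd0 : {linear fmod0 -> fmod1};
  fd1 : {linear fmod1 -> fmod0}
}.

Definition is_factorization k (w : 'I_k -> nat) (omega : {mpoly rat[k]})
    (M : factorization k) : Prop :=
  [/\ exists d, zhomog w d omega,
      graded_free w (fmod0 M),
      graded_free w (fmod1 M),
      forall v : fmod0 M, fd1 M (fd0 M v) = omega *: v
    & forall v : fmod1 M, fd0 M (fd1 M v) = omega *: v].

Record fmor k (M N : factorization k) := FMor {
  fm0 : {linear fmod0 M -> fmod0 N};
  fm1 : {linear fmod1 M -> fmod1 N};
  fm0_homog : forall d v, gm_homog d v -> gm_homog d (fm0 v);
  fm1_homog : forall d v, gm_homog d v -> gm_homog d (fm1 v);
  fm_comm0 : forall v, fm1 (fd0 M v) = fd0 N (fm0 v);
  fm_comm1 : forall v, fm0 (fd1 M v) = fd1 N (fm1 v)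
}.

Section Category.
Variable k : nat.
Implicit Types L M N : factorization k.

Definition fmor_id M : fmor M M :=
  @FMor k M M idfun idfun (fun _ _ h => h) (fun _ _ h => h)
    (fun=> erefl) (fun=> erefl).

Section Composition.
Variables (L M N : factorization k) (g : fmor M N) (f : fmor L M).

Fact fmor_comp_homog0 d v : gm_homog d v -> gm_homog d (fm0 g (fm0 f v)).
Proof. by move=> h; apply/fm0_homog/fm0_homog. Qed.

Fact fmor_comp_homog1 d v : gm_homog d v -> gm_homog d (fm1 g (fm1 f v)).
Proof. by move=> h; apply/fm1_homog/fm1_homog. Qed.

Fact fmor_comp_comm0 v :
  fm1 g (fm1 f (fd0 L v)) = fd0 N (fm0 g (fm0 f v)).
Proof. by rewrite !fm_comm0. Qed.

Fact fmor_comp_comm1 v :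
  fm0 g (fm0 f (fd1 L v)) = fd1 N (fm1 g (fm1 f v)).
Proof. by rewrite !fm_comm1. Qed.

Definition fmor_comp : fmor L N :=
  @FMor k L N (fm0 g \o fm0 f) (fm1 g \o fm1 f)
    fmor_comp_homog0 fmor_comp_homog1 fmor_comp_comm0 fmor_comp_comm1.

End Composition.

(* The difference f - g is null-homotopic.  The homotopies are R-linear, with no
   condition on degrees: when the differentials are homogeneous of degree
   deg omega / 2 the components of h0, h1 of degree - deg omega / 2 are again a
   homotopy, so such a condition would define the same relation. *)
Definition homotopic M N (f g : fmor M N) : Prop :=
  exists (h0 : {linear fmod0 M -> fmod1 N}) (h1 : {linear fmod1 M -> fmod0 N}),
    (forall v, fm0 f v - fm0 g v = h1 (fd0 M v) + fd1 N (h0 v)) /\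
    (forall v, fm1 f v - fm1 g v = h0 (fd1 M v) + fd0 N (h1 v)).

Definition HMF_iso (w : 'I_k -> nat) (omega : {mpoly rat[k]}) M N : Prop :=
  [/\ is_factorization w omega M,
      is_factorization w omega N
    & exists (f : fmor M N) (g : fmor N M),
        homotopic (fmor_comp g f) (fmor_id M) /\
        homotopic (fmor_comp f g) (fmor_id N)].

End Category.

(* Factorizations of finite rank over A = {mpoly rat[N]}, presented on
   homogeneous bases: mgen0, mgen1 index the bases, mgrad0, mgrad1 are the degrees
   of the basis elements, and md0 t s is the coefficient on t of the image of
   s under d_0. *)
Record mfact (N : nat) := MFact {
  mgen0 : finType;
  mgen1 : finType;
  mgrad0 : mgen0 -> int;
  mgrad1 : mgen1 -> int;
  md0 : mgen1 -> mgen0 -> {mpoly rat[N]};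
  md1 : mgen0 -> mgen1 -> {mpoly rat[N]}
}.

Section MFactOperations.
Variable N : nat.
Implicit Types X Y : mfact N.

(* X{m} *)
Definition mshift X (m : int) : mfact N :=
  @MFact N (mgen0 X) (mgen1 X)
    (fun s => mgrad0 s + m) (fun s => mgrad1 s + m) (@md0 N X) (@md1 N X).

(* X<1> *)
Definition mflip X : mfact N :=
  @MFact N (mgen1 X) (mgen0 X) (@mgrad1 N X) (@mgrad0 N X)
    (fun t s => - md1 t s) (fun t s => - md0 t s).

Definition mzero : mfact N :=
  @MFact N void void (fun=> 0) (fun=> 0) (fun _ _ => 0) (fun _ _ => 0).

Definition msum X Y : mfact N :=
  @MFact N (mgen0 X + mgen0 Y)%type (mgen1 X + mgen1 Y)%type
    (fun s => match s with inl a => mgrad0 a | inr b => mgrad0 b end)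
    (fun s => match s with inl a => mgrad1 a | inr b => mgrad1 b end)
    (fun t s => match t, s with
       | inl a, inl a' => md0 a a'
       | inr b, inr b' => md0 b b'
       | _, _ => 0 end)
    (fun t s => match t, s with
       | inl a, inl a' => md1 a a'
       | inr b, inr b' => md1 b b'
       | _, _ => 0 end).

Definition mbigsum (J : nat) (X : nat -> mfact N) : mfact N :=
  \big[msum/mzero]_(j < J) X j.

Definition mpower X (m : nat) : mfact N := mbigsum m (fun=> X).

Definition munit : mfact N :=
  @MFact N unit void (fun=> 0) (fun=> 0) (fun _ _ => 0) (fun _ _ => 0).

(* Tensor product over A.  If M and N are free over the polynomial rings Q[U]
   and Q[V], on homogeneous bases I and J, their tensor product over
   Q[U :&: V] is free over Q[U :|: V] on I * J, with the matrices below; so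
   tensoring over the common variables is tensoring the extensions of M and N
   to one ring containing all the variables in play. *)
Definition mtens X Y : mfact N :=
  @MFact N
    (mgen0 X * mgen0 Y + mgen1 X * mgen1 Y)%type
    (mgen1 X * mgen0 Y + mgen0 X * mgen1 Y)%type
    (fun s => match s with
       | inl (a, b) => mgrad0 a + mgrad0 b
       | inr (a, b) => mgrad1 a + mgrad1 b end)
    (fun s => match s with
       | inl (a, b) => mgrad1 a + mgrad0 b
       | inr (a, b) => mgrad0 a + mgrad1 b end)
    (fun t s => match t, s with
       | inl (a, b), inl (a', b') => md0 a a' *+ (b == b')
       | inl (a, b), inr (a', b') => - md1 b b' *+ (a == a')
       | inr (a, b), inl (a', b') => md0 b b' *+ (a == a')
       | inr (a, b), inr (a', b') => md1 a a' *+ (b == b') end)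
    (fun t s => match t, s with
       | inl (a, b), inl (a', b') => md1 a a' *+ (b == b')
       | inl (a, b), inr (a', b') => md1 b b' *+ (a == a')
       | inr (a, b), inl (a', b') => - md0 b b' *+ (a == a')
       | inr (a, b), inr (a', b') => md0 a a' *+ (b == b') end).

(* K(a; b)_A *)
Definition koszul (w : 'I_N -> nat) (a b : {mpoly rat[N]}) : mfact N :=
  @MFact N unit unit
    (fun=> 0) (fun=> (((pdeg w b)%:Z - (pdeg w a)%:Z) %/ 2)%Z)
    (fun _ _ => a) (fun _ _ => b).

End MFactOperations.

(* The free A-module on I, as a module over the polynomial ring in the
   variables named by x. *)
Definition res_free N k (x : 'I_k -> 'I_N) (I : finType) : Type :=
  {ffun I -> {mpoly rat[N]}}.

Section Restriction.
Variables (N k : nat) (x : 'I_k -> 'I_N).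

HB.instance Definition _ (I : finType) :=
  GRing.Zmodule.copy (res_free x I) {ffun I -> {mpoly rat[N]}}.

Section Scaling.
Variable I : finType.

Definition res_scale (a : {mpoly rat[k]}) (v : res_free x I) : res_free x I :=
  [ffun i => pincl x a * v i].

Fact res_scaleA a b v : res_scale a (res_scale b v) = res_scale (a * b) v.
Proof. by apply/ffunP => i; rewrite !ffunE mulrA /pincl rmorphM. Qed.

Fact res_scale1 : left_id 1 res_scale.
Proof. by move=> v; apply/ffunP => i; rewrite !ffunE /pincl rmorph1 mul1r. Qed.

Fact res_scaleDr : right_distributive res_scale +%R.
Proof. by move=> a u v; apply/ffunP => i; rewrite !ffunE mulrDr. Qed.

Fact res_scaleDl v : {morph res_scale^~ v : a b / a + b}.
Proof.
by move=> a b; apply/ffunP => i; rewrite !ffunE /pincl rmorphD mulrDl.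
Qed.

HB.instance Definition _ :=
  GRing.Zmodule_isLmodule.Build {mpoly rat[k]} (res_free x I)
    res_scaleA res_scale1 res_scaleDr res_scaleDl.

End Scaling.

Definition res_gmodule (w : 'I_N -> nat) (I : finType) (e : I -> int) :
    gmodule k :=
  @GModule k (res_free x I) (fun d v => forall i, zhomog w (d - e i) (v i)).

Definition res_mx (I J : finType) (D : J -> I -> {mpoly rat[N]})
    (v : res_free x I) : res_free x J :=
  [ffun t => \sum_s D t s * v s].

Fact res_mx_linear I J D : linear (@res_mx I J D).
Proof.
move=> a u v; apply/ffunP => t; rewrite !ffunE mulr_sumr -big_split /=.
by apply: eq_bigr => s _; rewrite !ffunE mulrDr mulrCA.
Qed.

HB.instance Definition _ I J D :=
  GRing.isLinear.Build {mpoly rat[k]} (res_free x I) (res_free x J) _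
    (@res_mx I J D) (@res_mx_linear I J D).

(* X regarded as a factorization over the polynomial ring in the variables
   named by x. *)
Definition restrict_to (w : 'I_N -> nat) (X : mfact N) : factorization k :=
  @Factorization k (res_gmodule w (@mgrad0 N X)) (res_gmodule w (@mgrad1 N X))
    (res_mx (@md0 N X)) (res_mx (@md1 N X)).

End Restriction.

Definition Fpoly (n i : nat) : {mpoly rat[i]} :=
  symf (\sum_(k < i) 'X_k ^+ n.+1).

Definition Fat (n i N : nat) (u : 'I_i -> {mpoly rat[N]}) : {mpoly rat[N]} :=
  Fpoly n i \mPo [tuple u k | k < i].

(* The tensor product over j of
   K((F_r(v_1,..,v_(j-1),u_j,u_(j+1),..,u_r) -
      F_r(v_1,..,v_(j-1),v_j,u_(j+1),..,u_r)) / (u_j - v_j); u_j - v_j). *)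
Definition chain (n r N : nat) (w : 'I_N -> nat) (u v : 'I_r -> {mpoly rat[N]}) :
    mfact N :=
  \big[@mtens N/munit N]_(j < r)
    koszul w
      (pquot (Fat n (fun k => if (k < j)%N then v k else u k)
              - Fat n (fun k => if (k <= j)%N then v k else u k))
             (u j - v j))
      (u j - v j).

Definition line (n i N : nat) (w : 'I_N -> nat) (x y : 'I_i -> 'I_N) : mfact N :=
  chain n w (pvar x) (pvar y).

(* e_(j+1)(x, y) *)
Definition esum (p q N : nat) (w : 'I_N -> nat) (x : 'I_p -> 'I_N)
    (y : 'I_q -> 'I_N) (j : 'I_(p + q)) : {mpoly rat[N]} :=
  pihomog (wdeg w) (2 * j.+1)
    ((1 + \sum_(k < p) pvar x k) * (1 + \sum_(k < q) pvar y k)).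

Definition merge_vertex (n p q N : nat) (w : 'I_N -> nat) (x : 'I_p -> 'I_N)
    (y : 'I_q -> 'I_N) (z : 'I_(p + q) -> 'I_N) : mfact N :=
  chain n w (pvar z) (esum w x y).

Definition split_vertex (n p q N : nat) (w : 'I_N -> nat) (x : 'I_p -> 'I_N)
    (y : 'I_q -> 'I_N) (z : 'I_(p + q) -> 'I_N) : mfact N :=
  mshift (chain n w (esum w x y) (pvar z)) (- (p * q)%:Z).

(* Four sequences of variables X_1, .., X_4 of lengths a, b, c, d. *)
Section FourSequences.
Variables a b c d : nat.

Definition weights4 : 'I_((a + b) + (c + d)) -> nat :=
  catw (catw (@stdw a) (@stdw b)) (catw (@stdw c) (@stdw d)).

Definition seq1 (j : 'I_a) : 'I_((a + b) + (c + d)) := lshift _ (lshift b j).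
Definition seq2 (j : 'I_b) : 'I_((a + b) + (c + d)) := lshift _ (rshift a j).
Definition seq3 (j : 'I_c) : 'I_((a + b) + (c + d)) := rshift _ (lshift d j).
Definition seq4 (j : 'I_d) : 'I_((a + b) + (c + d)) := rshift _ (rshift c j).

Definition seq12 (j : 'I_(a + b)) : 'I_((a + b) + (c + d)) := lshift _ j.

End FourSequences.

Arguments weights4 : clear implicits.
Arguments seq1 : clear implicits.
Arguments seq2 : clear implicits.
Arguments seq3 : clear implicits.
Arguments seq4 : clear implicits.
Arguments seq12 : clear implicits.

(* The base ring Q[X_1, X_2], for two sequences of length i. *)
Section TwoSequences.
Variable i : nat.

Definition weights2 : 'I_(i + i) -> nat := catw (@stdw i) (@stdw i).

Definition potential2 (n : nat) : {mpoly rat[i + i]} :=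
  Fat n (pvar (@lshift i i)) - Fat n (pvar (@rshift i i)).

Definition line2 (n : nat) : mfact (i + i) :=
  line n weights2 (@lshift i i) (@rshift i i).

End TwoSequences.

Arguments weights2 : clear implicits.

(* qq is the generator q of the field Q(q). *)
Definition qq : {fraction {poly rat}} := tofrac 'X.

Definition qint (m : nat) : {fraction {poly rat}} :=
  (qq ^+ m - qq ^- m) / (qq - qq^-1).

Definition qfact (m : nat) : {fraction {poly rat}} :=
  \prod_(1 <= k < m.+1) qint k.

Definition qbinom (n1 n2 : nat) : {fraction {poly rat}} :=
  qfact n1 / (qfact n2 * qfact (n1 - n2)).

(* The multiplicities p(j, n1; n2), uniquely determined for
   j <= n1 n2 - n2^2 by the expansion of the quantum binomial; they are
   nonnegative. *)
Definition qmult (j n1 n2 : nat) : nat :=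
  ClassicalEpsilon.epsilon (inhabits (fun=> 0%N))
    (fun p : nat -> nat => qbinom n1 n2 =
       \sum_(l < (n1 * n2 - n2 ^ 2).+1)
         (p l)%:R * qq ^ (- (n1 * n2)%:Z + (n2 ^ 2)%:Z + 2 * (l : nat)%:Z)) j.

(* Main.v *)
(* The vertices and lines are tensor products of Koszul rows.  A row K(a; z - v),
   with z an internal variable and v a polynomial in the others, is removed by
   setting z = v, up to homotopy equivalence over the base ring.  By Newton's
   identities F_r is the coefficient of X^(n + 1) in - X E'(X) / E(X), where
   E is the series 1 - e_1 X + e_2 X^2 and so on; the series of e(x, y) is the
   product of those of x and y, and all quotients in the rows become explicit.

   (1) X_3 and X_4 enter only through the e_j(X_3, X_4), over which Q[X_3, X_4]
   is free on the monomials of degree at most i_2 in variables of weights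
   1, .., i_1; the quantum binomial counts them by degree.  Eliminating e leaves
   the line.

   (2) Eliminate X_3, and replace X_1 by a new variable in one of its two
   occurrences.  The first i_1 rows eliminate the new variable; the other i_2 rows
   become K(G_l; 0), where G_l is up to a unit the coefficient of degree
   n - i_1 - l of 1 / E(X_2, X_4), for l = 0, .., i_2 - 1.  Q[X_1, X_2, X_4] is
   free over Q[X_1, X_2, G] on similar monomials, and there K(G_l; 0) is
   K(0; G_l)<1> up to a grading shift, so that G is eliminated in turn. *)

Require Import Defs.
From Stdlib Require ClassicalEpsilon.
From Stdlib Require Import FunctionalExtensionality.
From HB Require Import structures.
From mathcomp Require Import all_boot all_order all_algebra all_fingroup.
From mathcomp Require Import ring zify fraction.
From mathcomp.multinomials Require Import mpoly.

Set Implicit Arguments.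
Unset Strict Implicit.
Unset Printing Implicit Defensive.

Import GRing.Theory.
Local Open Scope ring_scope.

(** An elimination removes several variables, but the rings with only some of them gone are never
    formed. All stages live over the full ring, each as the image of an idempotent substitution;
    hence homotopy equivalence is set up for pairs of a factorization and an idempotent, and the
    ring changes only at the end. Only internal variables can be removed, because maps and
    homotopies have to be linear over the base ring. In (2), once X_3 is gone, the rows read K(a_j;
    e_j(X_1, X_4) - e_j(X_2, X_4)): the first i_1 of them could be solved for X_1, but X_1 belongs
    to the base. Its duplicate is internal, and the rows that introduce the duplicate become the
    line when it is sent to X_2. A row is removed through its second entry, but the G_l are first
    entries; each of the i_2 exchanges costs one <1>, and this is the source of <i_2>. Both freeness
    statements rest on spanning: spanning modulo an ideal lifts by induction on the degree, and a
    count of dimensions in each degree forces independence. The list [bdegs] of degrees serves both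
    this count and the quantum binomial. *)

Definition mklin (R : nzRingType) (U V : lmodType R) (f : U -> V)
    (hf : linear f) : {linear U -> V} :=
  HB.pack_for {linear U -> V} f (GRing.isLinear.Build R U V _ f hf).

(** * Homotopy equivalence *)

Section HomotopyEquivalence.
Variable k : nat.
Implicit Types L M N P : factorization k.

Lemma homotopic_eq M N (f g : fmor M N) :
  (forall v, fm0 f v = fm0 g v) -> (forall v, fm1 f v = fm1 g v) ->
  homotopic f g.
Proof.
move=> h0 h1; exists \0, \0; split=> v /=.
  by rewrite h0 subrr raddf0 addr0.
by rewrite h1 subrr raddf0 addr0.
Qed.

Lemma homotopic_trans M N (g f h : fmor M N) :
  homotopic f g -> homotopic g h -> homotopic f h.
Proof.
case=> a0 [a1 [A0 A1]] [b0 [b1 [B0 B1]]].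
exists (a0 \+ b0), (a1 \+ b1); split=> v /=.
  by rewrite linearD /= addrACA -A0 -B0 addrA subrK.
by rewrite linearD /= addrACA -A1 -B1 addrA subrK.
Qed.

Lemma homotopic_sym M N (f g : fmor M N) : homotopic f g -> homotopic g f.
Proof.
case=> a0 [a1 [A0 A1]]; exists (\- a0), (\- a1); split=> v /=.
  by rewrite linearN -opprD -A0 opprB.
by rewrite linearN -opprD -A1 opprB.
Qed.

Lemma homotopic_compl L M N (u : fmor M N) (f g : fmor L M) :
  homotopic f g -> homotopic (fmor_comp u f) (fmor_comp u g).
Proof.
case=> a0 [a1 [A0 A1]]; exists (fm1 u \o a0), (fm0 u \o a1); split=> v /=.
  by rewrite -linearB A0 linearD fm_comm1.
by rewrite -linearB A1 linearD fm_comm0.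
Qed.

Lemma homotopic_compr L M N (f g : fmor M N) (u : fmor L M) :
  homotopic f g -> homotopic (fmor_comp f u) (fmor_comp g u).
Proof.
case=> a0 [a1 [A0 A1]]; exists (a0 \o fm0 u), (a1 \o fm1 u); split=> v /=.
  by rewrite A0 fm_comm0.
by rewrite A1 fm_comm1.
Qed.

(* Homotopy equivalence in the idempotent completion: the pairs (M, e) with e
   idempotent stand for the image of e. *)
Definition kequiv M (e : fmor M M) N (e' : fmor N N) : Prop :=
  exists (f : fmor M N) (g : fmor N M),
    homotopic (fmor_comp g f) e /\ homotopic (fmor_comp f g) e'.

Definition hequiv M N : Prop := kequiv (fmor_id M) (fmor_id N).

Definition idem M (e : fmor M M) : Prop := homotopic (fmor_comp e e) e.

Lemma idem_id M : idem (fmor_id M).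
Proof. exact: homotopic_eq. Qed.

Lemma kequiv_sym M e N e' : @kequiv M e N e' -> @kequiv N e' M e.
Proof. by case=> f [g [gf fg]]; exists g, f. Qed.

(** In [g g' f' f] the inner [g' f'] is replaced by [e'] and then by [f g]; the result [(g f) (g f)]
    is homotopic to [e e], and idempotence of [e] finishes. The other composite is symmetric. *)
Lemma kequiv_trans M e N e' P e'' : idem e -> idem e'' ->
  @kequiv M e N e' -> @kequiv N e' P e'' -> @kequiv M e P e''.
Proof.
move=> ie ie'' [f [g [gf fg]]] [f' [g' [gf' fg']]].
exists (fmor_comp f' f), (fmor_comp g g'); split.
  apply: (homotopic_trans (g := fmor_comp g (fmor_comp (fmor_comp g' f') f))).
    exact: homotopic_eq.
  apply: (homotopic_trans (g := fmor_comp g (fmor_comp e' f))).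
    exact/homotopic_compl/homotopic_compr.
  apply: (homotopic_trans (g := fmor_comp g (fmor_comp (fmor_comp f g) f))).
    exact/homotopic_compl/homotopic_compr/homotopic_sym.
  apply: (homotopic_trans (g := fmor_comp (fmor_comp g f) (fmor_comp g f))).
    exact: homotopic_eq.
  apply: (homotopic_trans (g := fmor_comp e (fmor_comp g f))).
    exact: homotopic_compr.
  by apply: homotopic_trans (homotopic_compl _ gf) ie.
apply: (homotopic_trans (g := fmor_comp f' (fmor_comp (fmor_comp f g) g'))).
  exact: homotopic_eq.
apply: (homotopic_trans (g := fmor_comp f' (fmor_comp e' g'))).
  exact/homotopic_compl/homotopic_compr.
apply: (homotopic_trans (g := fmor_comp f' (fmor_comp (fmor_comp g' f') g'))).
  exact/homotopic_compl/homotopic_compr/homotopic_sym.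
apply: (homotopic_trans (g := fmor_comp (fmor_comp f' g') (fmor_comp f' g'))).
  exact: homotopic_eq.
apply: (homotopic_trans (g := fmor_comp e'' (fmor_comp f' g'))).
  exact: homotopic_compr.
by apply: homotopic_trans (homotopic_compl _ fg') ie''.
Qed.

Lemma hequiv_sym M N : hequiv M N -> hequiv N M.
Proof. exact: kequiv_sym. Qed.

Lemma hequiv_trans N M P : hequiv M N -> hequiv N P -> hequiv M P.
Proof. by apply: kequiv_trans; apply: idem_id. Qed.

Lemma hequiv_iso M N (f : fmor M N) (g : fmor N M) :
  cancel (fm0 f) (fm0 g) -> cancel (fm1 f) (fm1 g) ->
  cancel (fm0 g) (fm0 f) -> cancel (fm1 g) (fm1 f) -> hequiv M N.
Proof.
by move=> a b c d; exists f, g; split; apply: homotopic_eq => v /=.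
Qed.

End HomotopyEquivalence.

(** * Isomorphisms that rename bases and change signs *)

Lemma sgn_sqr (R : comNzRingType) (b : bool) (x : R) : (-1) ^+ b * ((-1) ^+ b * x) = x.
Proof. by rewrite mulrA -signr_addb addbb mul1r. Qed.

(* Y is X with its bases renamed and some basis vectors replaced by their
   opposites. *)
Definition mrel N (X Y : mfact N) : Prop :=
  exists (p0 : mgen0 Y -> mgen0 X) (p1 : mgen1 Y -> mgen1 X)
         (e0 : mgen0 Y -> bool) (e1 : mgen1 Y -> bool),
    [/\ bijective p0 /\ bijective p1,
        forall s, mgrad0 s = mgrad0 (p0 s),
        forall s, mgrad1 s = mgrad1 (p1 s),
        forall t s, md0 t s = (-1) ^+ (e1 t) * ((-1) ^+ (e0 s) * md0 (p1 t) (p0 s))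
      & forall t s, md1 t s = (-1) ^+ (e0 t) * ((-1) ^+ (e1 s) * md1 (p0 t) (p1 s))].

Section Relabelling.
Variable N : nat.
Implicit Types X Y Z : mfact N.

Lemma mrel_refl X : mrel X X.
Proof.
exists id, id, (fun=> false), (fun=> false); split => //.
- by split; exists id.
- by move=> t s; rewrite !mul1r.
- by move=> t s; rewrite !mul1r.
Qed.

Lemma mrel_sym X Y : mrel X Y -> mrel Y X.
Proof.
case=> p0 [p1 [e0 [e1 [[[q0 p0K q0K] [q1 p1K q1K]] g0 g1 h0 h1]]]].
exists q0, q1, (e0 \o q0), (e1 \o q1); split.
- by split; [exists p0 | exists p1].
- by move=> s; rewrite g0 q0K.
- by move=> s; rewrite g1 q1K.
- by move=> t s; rewrite h0 q1K q0K /= [X in _ * X]mulrCA !sgn_sqr.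
- by move=> t s; rewrite h1 q1K q0K /= [X in _ * X]mulrCA !sgn_sqr.
Qed.

Lemma mrel_trans Y X Z : mrel X Y -> mrel Y Z -> mrel X Z.
Proof.
case=> p0 [p1 [e0 [e1 [[b0 b1] g0 g1 h0 h1]]]].
case=> p0' [p1' [e0' [e1' [[b0' b1'] g0' g1' h0' h1']]]].
exists (p0 \o p0'), (p1 \o p1'), (fun s => e0' s (+) e0 (p0' s)),
  (fun s => e1' s (+) e1 (p1' s)); split.
- by split; apply: bij_comp.
- by move=> s; rewrite g0' g0.
- by move=> s; rewrite g1' g1.
- move=> t s; rewrite h0' h0 /= !signr_addb -!mulrA; congr (_ * _).
  by rewrite mulrCA.
- move=> t s; rewrite h1' h1 /= !signr_addb -!mulrA; congr (_ * _).
  by rewrite mulrCA.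
Qed.

(** The degree of the odd generator is an argument, whereas [koszul] reads it off the degrees of the
    entries; that reading fails once a substitution has turned an entry into 0. *)
Definition kosz (d : int) (a b : {mpoly rat[N]}) : mfact N :=
  @MFact N unit unit (fun=> 0) (fun=> d) (fun _ _ => a) (fun _ _ => b).

Lemma inl_eqE (S T : eqType) (a b : S) : (@inl S T a == inl b) = (a == b).
Proof. by []. Qed.
Lemma inr_eqE (S T : eqType) (a b : T) : (@inr S T a == inr b) = (a == b).
Proof. by []. Qed.
Lemma inlr_eqE (S T : eqType) (a : S) (b : T) : (inl a == inr b) = false.
Proof. by []. Qed.
Lemma inrl_eqE (S T : eqType) (a : S) (b : T) : (inr b == inl a) = false.
Proof. by []. Qed.

Lemma mulrn_bool (V : nmodType) (x : V) (b c : bool) : (x *+ b) *+ c = x *+ (b && c).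
Proof. by rewrite -mulrnA mulnb. Qed.

Definition sum_eqE := (inl_eqE, inr_eqE, inlr_eqE, inrl_eqE, xpair_eqE).

Lemma mtens_kosz_assoc d a b X Y :
  mrel (mtens (mtens (kosz d a b) X) Y) (mtens (kosz d a b) (mtens X Y)).
Proof.
exists (fun s => match s with
  | inl (t, inl (x, y)) => inl (inl (t, x), y)
  | inl (t, inr (x, y)) => inr (inr (t, x), y)
  | inr (t, inl (x, y)) => inl (inr (t, x), y)
  | inr (t, inr (x, y)) => inr (inl (t, x), y) end).
exists (fun s => match s with
  | inl (t, inl (x, y)) => inl (inl (t, x), y)
  | inl (t, inr (x, y)) => inr (inr (t, x), y)
  | inr (t, inl (x, y)) => inl (inr (t, x), y)
  | inr (t, inr (x, y)) => inr (inl (t, x), y) end).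
exists (fun=> false), (fun=> false); split.
- split.
    exists (fun s => match s with
      | inl (inl (t, x), y) => inl (t, inl (x, y))
      | inr (inr (t, x), y) => inl (t, inr (x, y))
      | inl (inr (t, x), y) => inr (t, inl (x, y))
      | inr (inl (t, x), y) => inr (t, inr (x, y)) end).
      by case=> [[t [[x y]|[x y]]]|[t [[x y]|[x y]]]].
    by case=> [[[[t x]|[t x]] y]|[[[t x]|[t x]] y]].
  exists (fun s => match s with
    | inl (inl (t, x), y) => inl (t, inl (x, y))
    | inr (inr (t, x), y) => inl (t, inr (x, y))
    | inl (inr (t, x), y) => inr (t, inl (x, y))
    | inr (inl (t, x), y) => inr (t, inr (x, y)) end).
    by case=> [[t [[x y]|[x y]]]|[t [[x y]|[x y]]]].
  by case=> [[[[t x]|[t x]] y]|[[[t x]|[t x]] y]].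
- by case=> [[t [[x y]|[x y]]]|[t [[x y]|[x y]]]] /=; rewrite addrA.
- by case=> [[t [[x y]|[x y]]]|[t [[x y]|[x y]]]] /=; rewrite addrA.
- case=> [[[] [[x y]|[x y]]]|[[] [[x y]|[x y]]]] [[[] [[x' y']|[x' y']]]|[[] [[x' y']|[x' y']]]];
  rewrite /= !mul1r ?sum_eqE ?eqxx ?mulrnDl ?mulNrn ?mulrn_bool ?mulr1n ?mulr0n ?oppr0 ?mul0rn ?andbT //=; by rewrite ?[(y == y') && _]andbC ?opprK.
- case=> [[[] [[x y]|[x y]]]|[[] [[x y]|[x y]]]] [[[] [[x' y']|[x' y']]]|[[] [[x' y']|[x' y']]]];
  rewrite /= !mul1r ?sum_eqE ?eqxx ?mulrnDl ?mulNrn ?mulrn_bool ?mulr1n ?mulr0n ?oppr0 ?mul0rn ?andbT //=; by rewrite ?[(y == y') && _]andbC ?opprK.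
Qed.

Lemma mtens_unit X : mrel (mtens (munit N) X) X.
Proof.
exists (fun s => inl (tt, s)), (fun s => inr (tt, s)), (fun=> false), (fun=> false); split.
- split.
    exists (fun s => match s with inl (_, x) => x | inr (v, _) => of_void _ v end) => //.
    by case=> [[[] x]|[[]]].
  exists (fun s => match s with inr (_, x) => x | inl (v, _) => of_void _ v end) => //.
  by case=> [[[]]|[[] x]].
- by move=> s /=; rewrite add0r.
- by move=> s /=; rewrite add0r.
- by move=> t s; rewrite !mul1r.
- by move=> t s; rewrite !mul1r.
Qed.

(** The signs are the Koszul signs: only products of two odd generators change sign. *)
Lemma mtens_swap X Y : mrel (mtens X Y) (mtens Y X).
Proof.
exists (fun s => match s with inl (y, x) => inl (x, y) | inr (y, x) => inr (x, y) end).
exists (fun s => match s with inl (y, x) => inr (x, y) | inr (y, x) => inl (x, y) end).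
exists (fun s => match s with inl _ => false | inr _ => true end), (fun=> false); split.
- split.
    by exists (fun s => match s with inl (y, x) => inl (x, y) | inr (y, x) => inr (x, y) end);
    case=> [[y x]|[y x]].
  by exists (fun s => match s with inl (y, x) => inr (x, y) | inr (y, x) => inl (x, y) end);
    case=> [[y x]|[y x]].
- by case=> [[y x]|[y x]] /=; rewrite addrC.
- by case=> [[y x]|[y x]] /=; rewrite addrC.
- by case=> [[x y]|[x y]] [[x' y']|[x' y']]; rewrite /= ?expr1 ?mulN1r ?mul1r ?mulNrn ?opprK.
- by case=> [[x y]|[x y]] [[x' y']|[x' y']]; rewrite /= ?expr1 ?mulN1r ?mul1r ?mulNrn ?opprK.
Qed.

Lemma mtens_relr K X Y : mrel X Y -> mrel (mtens K X) (mtens K Y).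
Proof.
case=> p0 [p1 [e0 [e1 [[b0 b1] g0 g1 h0 h1]]]].
have i0 := bij_inj b0; have i1 := bij_inj b1.
exists (fun s => match s with inl (k, x) => inl (k, p0 x) | inr (k, x) => inr (k, p1 x) end).
exists (fun s => match s with inl (k, x) => inl (k, p0 x) | inr (k, x) => inr (k, p1 x) end).
exists (fun s => match s with inl (k, x) => e0 x | inr (k, x) => e1 x end).
exists (fun s => match s with inl (k, x) => e0 x | inr (k, x) => e1 x end).
split.
- case: b0 b1 => [q0 p0K q0K] [q1 p1K q1K]; split.
    by exists (fun s => match s with inl (k, x) => inl (k, q0 x) | inr (k, x) => inr (k, q1 x) end);
      case=> [[k x]|[k x]]; rewrite ?p0K ?q0K ?p1K ?q1K.
  by exists (fun s => match s with inl (k, x) => inl (k, q0 x) | inr (k, x) => inr (k, q1 x) end);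
      case=> [[k x]|[k x]]; rewrite ?p0K ?q0K ?p1K ?q1K.
- by case=> [[k x]|[k x]] /=; rewrite ?g0 ?g1.
- by case=> [[k x]|[k x]] /=; rewrite ?g0 ?g1.
- case=> [[k x]|[k x]] [[k' x']|[k' x']]; rewrite /= ?h0 ?h1 ?(inj_eq i0) ?(inj_eq i1) ?mulrnAr ?mulrN //.
    by case: eqP => [->|_]; rewrite ?mulr0n // !mulr1n sgn_sqr.
  by case: eqP => [->|_]; rewrite ?mulr0n // !mulr1n sgn_sqr.
- case=> [[k x]|[k x]] [[k' x']|[k' x']]; rewrite /= ?h0 ?h1 ?(inj_eq i0) ?(inj_eq i1) ?mulrnAr ?mulrN //.
    by case: eqP => [->|_]; rewrite ?mulr0n // !mulr1n sgn_sqr.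
  by case: eqP => [->|_]; rewrite ?mulr0n // !mulr1n sgn_sqr.
Qed.

Lemma mflip_rel X Y : mrel X Y -> mrel (mflip X) (mflip Y).
Proof.
case=> p0 [p1 [e0 [e1 [b g0 g1 h0 h1]]]].
exists p1, p0, e1, e0; split => //.
- by case: b.
- by move=> t s /=; rewrite h1 !mulrN.
- by move=> t s /=; rewrite h0 !mulrN.
Qed.

Lemma mshift_rel X Y m : mrel X Y -> mrel (mshift X m) (mshift Y m).
Proof.
case=> p0 [p1 [e0 [e1 [b g0 g1 h0 h1]]]].
exists p0, p1, e0, e1; split => //.
- by move=> s /=; rewrite g0.
- by move=> s /=; rewrite g1.
Qed.

(** The flip of [Y] passes over the first factor, so the basis vectors whose component in [X] is odd
    change sign. *)
Lemma mtens_flip X Y : mrel (mtens X (mflip Y)) (mflip (mtens X Y)).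
Proof.
exists (fun s => match s with inl (x, y) => inr (x, y) | inr (x, y) => inl (x, y) end).
exists (fun s => match s with inl (x, y) => inr (x, y) | inr (x, y) => inl (x, y) end).
exists (fun s => match s with inl (x, y) => true | inr (x, y) => false end).
exists (fun s => match s with inl (x, y) => false | inr (x, y) => true end).
split.
- by split; exists (fun s => match s with inl (x, y) => inr (x, y) | inr (x, y) => inl (x, y) end);
    case=> [[k x]|[k x]].
- by case=> [[k x]|[k x]].
- by case=> [[k x]|[k x]].
- by case=> [[k x]|[k x]] [[k' x']|[k' x']];
    rewrite /= ?expr1 ?mulN1r ?mul1r ?mulNrn ?opprK.
- by case=> [[k x]|[k x]] [[k' x']|[k' x']];
    rewrite /= ?expr1 ?mulN1r ?mul1r ?mulNrn ?opprK.
Qed.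

Lemma mtens_shift X Y m : mrel (mtens X (mshift Y m)) (mshift (mtens X Y) m).
Proof.
exists id, id, (fun=> false), (fun=> false); split.
- by split; exists id.
- by case=> [[x y]|[x y]] /=; rewrite addrA.
- by case=> [[x y]|[x y]] /=; rewrite addrA.
- by move=> t s; rewrite !mul1r.
- by move=> t s; rewrite !mul1r.
Qed.

(** After the exchange of the entries the former odd generator is the even one; the shift by [d]
    puts both generators back in their degrees 0 and [d]. *)
Lemma mtens_kosz_flip d a b X :
  mrel (mtens (kosz d a b) X) (mflip (mshift (mtens (kosz (- d) b a) X) d)).
Proof.
exists (fun s => match s with inl (x, y) => inl (x, y) | inr (x, y) => inr (x, y) end).
exists (fun s => match s with inl (x, y) => inl (x, y) | inr (x, y) => inr (x, y) end).
exists (fun s => match s with inl _ => false | inr _ => true end).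
exists (fun s => match s with inl _ => true | inr _ => false end).
split.
- by split; exists (fun s => match s with inl (x, y) => inl (x, y) | inr (x, y) => inr (x, y) end);
    case=> [[k x]|[k x]].
- by case=> [[k x]|[k x]] /=; rewrite addrAC ?addNr ?add0r.
- by case=> [[k x]|[k x]] /=; rewrite addrAC ?addNr ?add0r.
- by case=> [[[] x]|[[] x]] [[[] x']|[[] x']];
    rewrite /= ?expr1 ?mulN1r ?mul1r ?mulNrn ?opprK.
- by case=> [[[] x]|[[] x]] [[[] x']|[[] x']];
    rewrite /= ?expr1 ?mulN1r ?mul1r ?mulNrn ?opprK.
Qed.

Lemma mshift_shift X m m' : mrel (mshift (mshift X m) m') (mshift X (m + m')).
Proof.
exists id, id, (fun=> false), (fun=> false); split.
- by split; exists id.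
- by move=> s /=; rewrite addrA.
- by move=> s /=; rewrite addrA.
- by move=> t s; rewrite !mul1r.
- by move=> t s; rewrite !mul1r.
Qed.

End Relabelling.

Section RelabelEquiv.
Variables (N k : nat) (x : 'I_k -> 'I_N) (w : 'I_N -> nat).
Implicit Types X Y : mfact N.

Definition relab (I J : finType) (p : J -> I) (e : J -> bool) (v : res_free x I) : res_free x J :=
  [ffun s => (-1) ^+ (e s) * v (p s)].

Lemma relab_linear I J p e : linear (@relab I J p e).
Proof.
by move=> a u v; apply/ffunP => s; rewrite !ffunE mulrDr mulrCA.
Qed.

Lemma zhomog_sign d (b : bool) p : zhomog w d p -> zhomog w d ((-1) ^+ b * p).
Proof.
by case: b => //= h m; rewrite ?mul1r ?expr1 ?mulN1r ?(perm_mem (msuppN _)) => /h.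
Qed.

Lemma relab_comm (I J I' J' : finType) (p : J -> I) (e : J -> bool) (p' : J' -> I') (e' : J' -> bool)
  (D : I' -> I -> {mpoly rat[N]}) (D' : J' -> J -> {mpoly rat[N]}) :
  bijective p ->
  (forall t s, D' t s = (-1) ^+ (e' t) * ((-1) ^+ (e s) * D (p' t) (p s))) ->
  forall v, relab p' e' (res_mx D v) = res_mx D' (relab p e v).
Proof.
move=> bp h v; apply/ffunP => t; rewrite !ffunE.
rewrite (reindex p) /=; last exact: onW_bij.
rewrite mulr_sumr; apply: eq_bigr => s _; rewrite !ffunE h -!mulrA; congr (_ * _).
by rewrite mulrCA sgn_sqr.
Qed.

Lemma mrel_fmor X Y : mrel X Y -> exists (f : fmor (restrict_to x w X) (restrict_to x w Y))
  (g : fmor (restrict_to x w Y) (restrict_to x w X)),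
  [/\ cancel (fm0 f) (fm0 g), cancel (fm1 f) (fm1 g),
      cancel (fm0 g) (fm0 f) & cancel (fm1 g) (fm1 f)].
Proof.
case=> p0 [p1 [e0 [e1 [[b0 b1] g0 g1 h0 h1]]]].
have [q0 p0K q0K] := b0; have [q1 p1K q1K] := b1.
have c0 : bijective q0 by exists p0.
have c1 : bijective q1 by exists p1.
unshelve eexists (FMor (fm0 := (mklin (relab_linear p0 e0) : {linear fmod0 (restrict_to x w X) -> fmod0 (restrict_to x w Y)})) (fm1 := (mklin (relab_linear p1 e1) : {linear fmod1 (restrict_to x w X) -> fmod1 (restrict_to x w Y)})) _ _ _ _).
- by move=> d v h i; rewrite /= ffunE g0; apply/zhomog_sign/h.
- by move=> d v h i; rewrite /= ffunE g1; apply/zhomog_sign/h.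
- exact: relab_comm.
- exact: relab_comm.
unshelve eexists (FMor (fm0 := (mklin (relab_linear q0 (e0 \o q0)) : {linear fmod0 (restrict_to x w Y) -> fmod0 (restrict_to x w X)})) (fm1 := (mklin (relab_linear q1 (e1 \o q1)) : {linear fmod1 (restrict_to x w Y) -> fmod1 (restrict_to x w X)})) _ _ _ _).
- by move=> d v h i; rewrite /= ffunE -(q0K i) -g0 p0K; apply/zhomog_sign/h.
- by move=> d v h i; rewrite /= ffunE -(q1K i) -g1 p1K; apply/zhomog_sign/h.
- apply: relab_comm => // t s.
  by rewrite h0 q1K q0K /= [X in _ * X]mulrCA !sgn_sqr.
- apply: relab_comm => // t s.
  by rewrite h1 q1K q0K /= [X in _ * X]mulrCA !sgn_sqr.
by split=> v; apply/ffunP => s; rewrite !ffunE /= ?q0K ?q1K ?p0K ?p1K sgn_sqr.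
Qed.

Lemma mrel_hequiv X Y : mrel X Y -> hequiv (restrict_to x w X) (restrict_to x w Y).
Proof. by case/mrel_fmor => f [g [a b c d]]; apply: (hequiv_iso (f := f) (g := g)). Qed.

End RelabelEquiv.

(** * Direct sums of shifted copies of one factorization *)

Section DirectSums.
Variable N : nat.
Implicit Types X Y Z : mfact N.

(** A single presentation with block index [J], where [mbigsum] nests binary sums: maps act block by
    block, and a free extension of rings produces exactly this form. *)
Definition msumI (J : finType) (e : J -> int) Z : mfact N :=
  @MFact N (J * mgen0 Z)%type (J * mgen1 Z)%type
    (fun s => e s.1 + mgrad0 s.2) (fun s => e s.1 + mgrad1 s.2)
    (fun t s => md0 t.2 s.2 *+ (t.1 == s.1)) (fun t s => md1 t.2 s.2 *+ (t.1 == s.1)).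

Definition msumS (es : seq int) Z : mfact N :=
  msumI (fun j : 'I_(size es) => es`_j) Z.

Lemma msumI_reindex (J J' : finType) (e : J -> int) (p : J' -> J) Z :
  bijective p -> mrel (msumI e Z) (msumI (e \o p) Z).
Proof.
move=> bp; have ip := bij_inj bp; case: bp => q pK qK.
exists (fun s => (p s.1, s.2)), (fun s => (p s.1, s.2)), (fun=> false), (fun=> false); split => //.
- by split; exists (fun s => (q s.1, s.2)) => -[a b] /=; rewrite ?pK ?qK.
- by move=> t s /=; rewrite !mul1r (inj_eq ip).
- by move=> t s /=; rewrite !mul1r (inj_eq ip).
Qed.

Lemma eq_msumI (J : finType) (e e' : J -> int) Z : e =1 e' -> mrel (msumI e Z) (msumI e' Z).
Proof.
move=> ee; exists id, id, (fun=> false), (fun=> false); split => //.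
- by split; exists id.
- by move=> s /=; rewrite ee.
- by move=> s /=; rewrite ee.
- by move=> t s /=; rewrite !mul1r.
- by move=> t s /=; rewrite !mul1r.
Qed.

Lemma msum_rel X X' Y Y' : mrel X X' -> mrel Y Y' -> mrel (msum X Y) (msum X' Y').
Proof.
case=> p0 [p1 [e0 [e1 [[b0 b1] g0 g1 h0 h1]]]].
case=> p0' [p1' [e0' [e1' [[b0' b1'] g0' g1' h0' h1']]]].
exists (fun s => match s with inl a => inl (p0 a) | inr a => inr (p0' a) end).
exists (fun s => match s with inl a => inl (p1 a) | inr a => inr (p1' a) end).
exists (fun s => match s with inl a => e0 a | inr a => e0' a end).
exists (fun s => match s with inl a => e1 a | inr a => e1' a end).
split.
- case: b0 b1 b0' b1' => [q0 p0K q0K] [q1 p1K q1K] [q0' p0K' q0K'] [q1' p1K' q1K']; split.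
    by exists (fun s => match s with inl a => inl (q0 a) | inr a => inr (q0' a) end);
      case=> a; rewrite ?p0K ?q0K ?p0K' ?q0K'.
  by exists (fun s => match s with inl a => inl (q1 a) | inr a => inr (q1' a) end);
    case=> a; rewrite ?p1K ?q1K ?p1K' ?q1K'.
- by case.
- by case.
- by case=> a [] b /=; rewrite ?mulr0.
- by case=> a [] b /=; rewrite ?mulr0.
Qed.

Lemma msum_msumI (J J' : finType) (e : J -> int) (e' : J' -> int) Z :
  mrel (msum (msumI e Z) (msumI e' Z))
    (msumI (fun j : J + J' => match j with inl a => e a | inr b => e' b end) Z).
Proof.
exists (fun s => match s with (inl a, z) => inl (a, z) | (inr a, z) => inr (a, z) end).
exists (fun s => match s with (inl a, z) => inl (a, z) | (inr a, z) => inr (a, z) end).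
exists (fun=> false), (fun=> false); split.
- by split; exists (fun s => match s with inl (a, z) => (inl a, z) | inr (a, z) => (inr a, z) end);
    do ?case.
- by do 2?case.
- by do 2?case.
- by case=> [[a|a] z] [[b|b] y] /=; rewrite !mul1r.
- by case=> [[a|a] z] [[b|b] y] /=; rewrite !mul1r.
Qed.

Lemma msumS_cat es es' Z : mrel (msum (msumS es Z) (msumS es' Z)) (msumS (es ++ es') Z).
Proof.
apply: mrel_trans (msum_msumI _ _ _) _.
have sE : size (es ++ es') = (size es + size es')%N by rewrite size_cat.
have bij_p : bijective (fun i : 'I_(size (es ++ es')) => split (cast_ord sE i)).
  exists (fun u => cast_ord (esym sE) (unsplit u)) => i.
    by rewrite splitK cast_ordK.
  by rewrite cast_ordKV unsplitK.
apply: mrel_trans (msumI_reindex _ _ bij_p) (eq_msumI _ _) => i /=.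
rewrite nth_cat; case: splitP => j /= ->; first by rewrite ltn_ord.
by rewrite ltnNge leq_addr /= addKn.
Qed.

Lemma msumS_perm es es' Z : perm_eq es es' -> mrel (msumS es Z) (msumS es' Z).
Proof.
move=> pe; apply/mrel_sym.
have sE := perm_size pe.
have /tuple_permP[p pE] : perm_eq es (in_tuple es') by [].
have bij_p : bijective (fun i : 'I_(size es) => p (cast_ord sE i)).
  exists (fun i => cast_ord (esym sE) ((p^-1)%g i)) => i.
    by rewrite permK cast_ordK.
  by rewrite cast_ordKV permKV.
apply: mrel_trans (msumI_reindex _ _ bij_p) (eq_msumI _ _) => i /=.
have -> : nth 0 es i = nth 0 [tuple tnth (in_tuple es') (p i0)  | i0 < size es'] (cast_ord sE i).
  by rewrite -pE.
by rewrite -tnth_nth tnth_mktuple (tnth_nth 0).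
Qed.

Lemma msumS_nil Z : mrel (mzero N) (msumS [::] Z).
Proof.
have f (A : finType) (s : 'I_(@size int [::]) * A) : False by case: s => [[]].
exists (fun s => False_rect _ (f _ s)), (fun s => False_rect _ (f _ s)), (fun=> false), (fun=> false).
split; try by move=> s; case: (f _ s).
by split; exists (of_void _) => // s; case: (f _ s).
Qed.

Lemma msumS1 d Z : mrel (mshift Z d) (msumS [:: d] Z).
Proof.
exists snd, snd, (fun=> false), (fun=> false); split.
- by split; exists (fun s => (ord0, s)) => // -[i s] /=; rewrite [i]ord1.
- by case=> i s /=; rewrite ord1 /= addrC.
- by case=> i s /=; rewrite ord1 /= addrC.
- by case=> i s [j t] /=; rewrite [i]ord1 [j]ord1 eqxx !mul1r.
- by case=> i s [j t] /=; rewrite [i]ord1 [j]ord1 eqxx !mul1r.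
Qed.

Lemma msumI_flip (J : finType) (e : J -> int) Z : mrel (mflip (msumI e Z)) (msumI e (mflip Z)).
Proof.
exists id, id, (fun=> false), (fun=> false); split => //.
- by split; exists id.
- by move=> t s /=; rewrite !mul1r mulNrn.
- by move=> t s /=; rewrite !mul1r mulNrn.
Qed.

Lemma msumI_iter_flip (J : finType) (e : J -> int) Z m :
  mrel (iter m (@mflip N) (msumI e Z)) (msumI e (iter m (@mflip N) Z)).
Proof.
elim: m => [|m ih]; first exact: mrel_refl.
by rewrite !iterS; apply: mrel_trans (mflip_rel ih) (msumI_flip _ _).
Qed.

Lemma iter_flip_rel X Y m : mrel X Y -> mrel (iter m (@mflip N) X) (iter m (@mflip N) Y).
Proof. by move=> h; elim: m => // m ih; rewrite !iterS; apply: mflip_rel. Qed.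

Lemma msumI_mshift (J : finType) (e : J -> int) Z d :
  mrel (msumI e (mshift Z d)) (msumI (fun j => e j + d) Z).
Proof.
exists id, id, (fun=> false), (fun=> false); split => //.
- by split; exists id.
- by move=> s /=; rewrite addrAC addrA.
- by move=> s /=; rewrite addrAC addrA.
- by move=> t s /=; rewrite !mul1r.
- by move=> t s /=; rewrite !mul1r.
Qed.

Lemma msumI_rel (J : finType) (e : J -> int) X Y : mrel X Y -> mrel (msumI e X) (msumI e Y).
Proof.
case=> p0 [p1 [e0 [e1 [[b0 b1] g0 g1 h0 h1]]]].
exists (fun s => (s.1, p0 s.2)), (fun s => (s.1, p1 s.2)), (e0 \o snd), (e1 \o snd); split.
- case: b0 b1 => [q0 p0K q0K] [q1 p1K q1K]; split.
    by exists (fun s => (s.1, q0 s.2)) => -[a b] /=; rewrite ?p0K ?q0K.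
  by exists (fun s => (s.1, q1 s.2)) => -[a b] /=; rewrite ?p1K ?q1K.
- by move=> s /=; rewrite g0.
- by move=> s /=; rewrite g1.
- by move=> t s /=; rewrite h0 !mulrnAr.
- by move=> t s /=; rewrite h1 !mulrnAr.
Qed.

Lemma mbigsum_msumS (M : nat) (F : nat -> mfact N) (es : nat -> seq int) Z :
  (forall j, (j < M)%N -> mrel (F j) (msumS (es j) Z)) ->
  mrel (mbigsum M F) (msumS (flatten [seq es j | j <- iota 0 M]) Z).
Proof.
move=> h; rewrite /mbigsum -(big_mkord xpredT) /index_iota subn0.
have: forall j, j \in iota 0 M -> mrel (F j) (msumS (es j) Z).
  by move=> j; rewrite mem_iota add0n => /h.
elim: (iota 0 M) => [|j s ih] hs; first by rewrite big_nil; apply: msumS_nil.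
rewrite big_cons /=; apply: mrel_trans (msumS_cat _ _ _); apply: msum_rel.
  by apply: hs; rewrite mem_head.
by apply: ih => l ls; apply: hs; rewrite inE ls orbT.
Qed.

Lemma mpower_msumS X d m Z : mrel X (mshift Z d) -> mrel (mpower X m) (msumS (nseq m d) Z).
Proof.
move=> h; rewrite /mpower.
have -> : nseq m d = flatten [seq [:: d] | j <- iota 0 m].
  by elim: m 0%N => //= m ih i; rewrite -ih.
apply: mbigsum_msumS => j _; apply: mrel_trans h _; exact: msumS1.
Qed.

End DirectSums.

(** * Homotopy equivalence under flips, shifts and sums *)

Lemma res_mxN N k (x : 'I_k -> 'I_N) (I J : finType) (D : J -> I -> {mpoly rat[N]})
    (v : res_free x I) :
  res_mx (fun t s => - D t s) v = - res_mx D v.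
Proof.
apply/ffunP => t; rewrite !ffunE -sumrN.
by apply: eq_bigr => s _; rewrite mulNr.
Qed.

Section Functoriality.
Variables (k : nat).

Lemma homotopic_flip N N' (x : 'I_k -> 'I_N) (x' : 'I_k -> 'I_N') w w' X X'
  (f g : fmor (restrict_to x w X) (restrict_to x' w' X'))
  (f' g' : fmor (restrict_to x w (mflip X)) (restrict_to x' w' (mflip X'))) :
  (forall v, fm0 f' v = fm1 f v) -> (forall v, fm1 f' v = fm0 f v) ->
  (forall v, fm0 g' v = fm1 g v) -> (forall v, fm1 g' v = fm0 g v) ->
  homotopic f g -> homotopic f' g'.
Proof.
move=> f0 f1 g0 g1 [a0 [a1 [A0 A1]]]; exists (\- a1), (\- a0); split=> v /=.
  by rewrite f0 g0 A1 !res_mxN linearN /= opprK linearN opprK.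
by rewrite f1 g1 A0 !res_mxN linearN /= opprK linearN opprK.
Qed.

Definition fmor_flip N N' (x : 'I_k -> 'I_N) (x' : 'I_k -> 'I_N') w w' X X'
    (f : fmor (restrict_to x w X) (restrict_to x' w' X')) :
  fmor (restrict_to x w (mflip X)) (restrict_to x' w' (mflip X')).
Proof.
unshelve refine (FMor (M := restrict_to x w (mflip X)) (N := restrict_to x' w' (mflip X'))
   (fm0 := fm1 f) (fm1 := fm0 f) _ _ _ _).
- exact: (fm1_homog f).
- exact: (fm0_homog f).
- by move=> v /=; rewrite !res_mxN linearN fm_comm1.
- by move=> v /=; rewrite !res_mxN linearN fm_comm0.
Defined.

Lemma hequiv_flip N N' (x : 'I_k -> 'I_N) (x' : 'I_k -> 'I_N') w w' X X' :
  hequiv (restrict_to x w X) (restrict_to x' w' X') ->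
  hequiv (restrict_to x w (mflip X)) (restrict_to x' w' (mflip X')).
Proof.
case=> f [g [gf fg]]; exists (fmor_flip f), (fmor_flip g); split.
  exact: homotopic_flip gf.
exact: homotopic_flip fg.
Qed.

Lemma hequiv_iter_flip N N' (x : 'I_k -> 'I_N) (x' : 'I_k -> 'I_N') w w' X X' m :
  hequiv (restrict_to x w X) (restrict_to x' w' X') ->
  hequiv (restrict_to x w (iter m (@mflip N) X)) (restrict_to x' w' (iter m (@mflip N') X')).
Proof. by move=> h; elim: m => // m ih; rewrite !iterS; apply: hequiv_flip. Qed.

Lemma subD_swap (V : zmodType) (d e m : V) : d - (e + m) = d - m - e.
Proof. by rewrite opprD addrA addrAC. Qed.

Definition fmor_shift N N' (x : 'I_k -> 'I_N) (x' : 'I_k -> 'I_N') w w' X X' m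
    (f : fmor (restrict_to x w X) (restrict_to x' w' X')) :
  fmor (restrict_to x w (mshift X m)) (restrict_to x' w' (mshift X' m)).
Proof.
unshelve refine (FMor (M := restrict_to x w (mshift X m)) (N := restrict_to x' w' (mshift X' m))
   (fm0 := fm0 f) (fm1 := fm1 f) _ _ _ _).
- move=> d v h i /=; rewrite subD_swap.
  apply: (fm0_homog f (d := d - m)) => j.
  by move: (h j); rewrite /= subD_swap.
- move=> d v h i /=; rewrite subD_swap.
  apply: (fm1_homog f (d := d - m)) => j.
  by move: (h j); rewrite /= subD_swap.
- by move=> v /=; rewrite fm_comm0.
- by move=> v /=; rewrite fm_comm1.
Defined.

Lemma hequiv_shift N N' (x : 'I_k -> 'I_N) (x' : 'I_k -> 'I_N') w w' X X' m :
  hequiv (restrict_to x w X) (restrict_to x' w' X') ->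
  hequiv (restrict_to x w (mshift X m)) (restrict_to x' w' (mshift X' m)).
Proof.
by case=> f [g [gf fg]]; exists (fmor_shift m f), (fmor_shift m g).
Qed.

End Functoriality.

Section SumEquiv.
Variables (k : nat) (J : finType) (e : J -> int).

Definition slice N (x : 'I_k -> 'I_N) (I : finType) (j : J) (v : res_free x (J * I)%type) :
  res_free x I := [ffun i => v (j, i)].

Definition blockwise N N' (x : 'I_k -> 'I_N) (x' : 'I_k -> 'I_N') (I I' : finType)
    (f : res_free x I -> res_free x' I')
    (v : res_free x (J * I)%type) : res_free x' (J * I')%type :=
  [ffun t => f (slice t.1 v) t.2].

Lemma slice_blockwise N N' (x : 'I_k -> 'I_N) (x' : 'I_k -> 'I_N') (I I' : finType)
    (f : res_free x I -> res_free x' I') v j :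
  slice j (blockwise f v) = f (slice j v).
Proof. by apply/ffunP => i; rewrite !ffunE. Qed.

Lemma slice_inj N (x : 'I_k -> 'I_N) (I : finType) (u v : res_free x (J * I)%type) :
  (forall j, slice j u = slice j v) -> u = v.
Proof. by move=> h; apply/ffunP => -[j i]; move/ffunP: (h j) => /(_ i); rewrite !ffunE. Qed.

Lemma slice_linear N (x : 'I_k -> 'I_N) (I : finType) (j : J) : linear (@slice N x I j).
Proof. by move=> a u v; apply/ffunP => i; rewrite !ffunE. Qed.

Lemma sliceD N (x : 'I_k -> 'I_N) (I : finType) (j : J) : {morph @slice N x I j : u v / u + v}.
Proof. by move=> u v; apply/ffunP => i; rewrite !ffunE. Qed.

Lemma sliceB N (x : 'I_k -> 'I_N) (I : finType) (j : J) : {morph @slice N x I j : u v / u - v}.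
Proof. by move=> u v; apply/ffunP => i; rewrite !ffunE. Qed.

Lemma blockwise_linear N N' (x : 'I_k -> 'I_N) (x' : 'I_k -> 'I_N') (I I' : finType)
    (f : {linear res_free x I -> res_free x' I'}) : linear (@blockwise _ _ _ _ _ _ f).
Proof.
move=> a u v; apply: slice_inj => j.
by rewrite slice_linear !slice_blockwise slice_linear linearP.
Qed.

HB.instance Definition _ N N' (x : 'I_k -> 'I_N) (x' : 'I_k -> 'I_N') (I I' : finType)
    (f : {linear res_free x I -> res_free x' I'}) :=
  GRing.isLinear.Build {mpoly rat[k]} (res_free x (J * I)%type) (res_free x' (J * I')%type) _
    (@blockwise _ _ _ _ _ _ f) (@blockwise_linear _ _ _ _ _ _ f).

Lemma slice_res_mx N (x : 'I_k -> 'I_N) (I I' : finType) (D : I' -> I -> {mpoly rat[N]}) j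
    (v : res_free x (J * I)%type) :
  slice j (res_mx (fun (t : J * I') (s : J * I) => D t.2 s.2 *+ (t.1 == s.1)) v)
   = res_mx D (slice j v).
Proof.
apply/ffunP => t; rewrite !ffunE.
transitivity (\sum_j' \sum_i (D t i *+ (j == j')) * v (j', i)).
  by rewrite pair_bigA; apply: eq_bigr => -[].
rewrite (bigD1 j) //= [X in _ + X]big1 ?addr0.
  by apply: eq_bigr => s _; rewrite eqxx mulr1n ffunE.
move=> j' /negbTE nj; apply: big1 => i _.
by rewrite eq_sym nj mul0r.
Qed.

Definition fmor_blockwise N N' (x : 'I_k -> 'I_N) (x' : 'I_k -> 'I_N') w w' X X'
    (f : fmor (restrict_to x w X) (restrict_to x' w' X')) :
  fmor (restrict_to x w (msumI e X)) (restrict_to x' w' (msumI e X')).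
Proof.
unshelve refine (FMor (M := restrict_to x w (msumI e X)) (N := restrict_to x' w' (msumI e X'))
   (fm0 := blockwise (fm0 f)) (fm1 := blockwise (fm1 f)) _ _ _ _).
- move=> d v h [j i] /=; rewrite ffunE opprD addrA.
  by apply: (fm0_homog f (d := d - e j)) => t /=; rewrite ffunE -addrA -opprD; apply: h.
- move=> d v h [j i] /=; rewrite ffunE opprD addrA.
  by apply: (fm1_homog f (d := d - e j)) => t /=; rewrite ffunE -addrA -opprD; apply: h.
- move=> v; apply: slice_inj => j /=.
  by rewrite slice_res_mx !slice_blockwise slice_res_mx; apply: (fm_comm0 f).
- move=> v; apply: slice_inj => j /=.
  by rewrite slice_res_mx !slice_blockwise slice_res_mx; apply: (fm_comm1 f).
Defined.

Lemma homotopic_blockwise N N' (x : 'I_k -> 'I_N) (x' : 'I_k -> 'I_N') w w' X X'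
  (f g : fmor (restrict_to x w X) (restrict_to x' w' X'))
  (f' g' : fmor (restrict_to x w (msumI e X)) (restrict_to x' w' (msumI e X'))) :
  (forall v, fm0 f' v = blockwise (fm0 f) v) -> (forall v, fm1 f' v = blockwise (fm1 f) v) ->
  (forall v, fm0 g' v = blockwise (fm0 g) v) -> (forall v, fm1 g' v = blockwise (fm1 g) v) ->
  homotopic f g -> homotopic f' g'.
Proof.
move=> f0 f1 g0 g1 [a0 [a1 [A0 A1]]].
exists (blockwise a0), (blockwise a1); split=> v; apply: slice_inj => j.
  rewrite f0 g0 sliceB sliceD /= !slice_blockwise !slice_res_mx !slice_blockwise.
  exact: A0.
rewrite f1 g1 sliceB sliceD /= !slice_blockwise !slice_res_mx !slice_blockwise.
exact: A1.
Qed.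

Lemma blockwise_comp N1 N2 N3 (x1 : 'I_k -> 'I_N1) (x2 : 'I_k -> 'I_N2) (x3 : 'I_k -> 'I_N3)
  (I1 I2 I3 : finType) (f : res_free x2 I2 -> res_free x3 I3) (g : res_free x1 I1 -> res_free x2 I2) v :
  blockwise f (blockwise g v) = blockwise (f \o g) v.
Proof. by apply: slice_inj => j; rewrite !slice_blockwise. Qed.

Lemma blockwise_id N1 (x1 : 'I_k -> 'I_N1) (I1 : finType) (v : res_free x1 (J * I1)%type) :
  v = blockwise idfun v.
Proof. by apply: slice_inj => j; rewrite !slice_blockwise. Qed.

Lemma hequiv_msumI N N' (x : 'I_k -> 'I_N) (x' : 'I_k -> 'I_N') w w' X X' :
  hequiv (restrict_to x w X) (restrict_to x' w' X') ->
  hequiv (restrict_to x w (msumI e X)) (restrict_to x' w' (msumI e X')).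
Proof.
case=> f [g [gf fg]]; exists (fmor_blockwise f), (fmor_blockwise g); split.
  apply: homotopic_blockwise gf => v; try exact: blockwise_id; exact: blockwise_comp.
apply: homotopic_blockwise fg => v; try exact: blockwise_id; exact: blockwise_comp.
Qed.

End SumEquiv.

(** * Potentials of matrix presentations *)

Section Potentials.
Variable N : nat.
Implicit Types X Y : mfact N.

Definition mpot X (om : {mpoly rat[N]}) : Prop :=
  (forall s s', \sum_t md1 s t * md0 t s' = om *+ (s == s' :> mgen0 X)) /\
  (forall t t', \sum_s md0 t s * md1 s t' = om *+ (t == t' :> mgen1 X)).

Lemma mpot_flip X om : mpot X om -> mpot (mflip X) om.
Proof.
by case=> h0 h1; split=> s s' /=; [rewrite -h1 | rewrite -h0]; apply: eq_bigr => t _; rewrite mulrNN.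
Qed.

Lemma mpot_shift X m om : mpot X om -> mpot (mshift X m) om.
Proof. by []. Qed.

Lemma mpot_rel X Y om : mrel X Y -> mpot X om -> mpot Y om.
Proof.
case=> p0 [p1 [e0 [e1 [[b0 b1] g0 g1 h0 h1]]]] [k0 k1]; split=> s s'.
  rewrite -(inj_eq (bij_inj b0)).
  transitivity ((-1) ^+ (e0 s) * ((-1) ^+ (e0 s') * (om *+ (p0 s == p0 s')))); last first.
    by case: eqP => [/(bij_inj b0) ->|_]; rewrite ?mulr0n ?mulr0 // mulr1n sgn_sqr.
  rewrite -k0 [in RHS](reindex p1) /=; last exact: onW_bij.
  rewrite !mulr_sumr; apply: eq_bigr => t _; rewrite h0 h1 -!mulrA; congr (_ * _).
  by rewrite [X in _ * X]mulrCA sgn_sqr mulrCA.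
rewrite -(inj_eq (bij_inj b1)).
transitivity ((-1) ^+ (e1 s) * ((-1) ^+ (e1 s') * (om *+ (p1 s == p1 s')))); last first.
  by case: eqP => [/(bij_inj b1) ->|_]; rewrite ?mulr0n ?mulr0 // mulr1n sgn_sqr.
rewrite -k1 [in RHS](reindex p0) /=; last exact: onW_bij.
rewrite !mulr_sumr; apply: eq_bigr => t _; rewrite h0 h1 -!mulrA; congr (_ * _).
by rewrite [X in _ * X]mulrCA sgn_sqr mulrCA.
Qed.

Lemma mpot_munit : mpot (munit N) 0.
Proof. by split=> [] [] // []; rewrite mul0rn big1 // => -[]. Qed.

Lemma mpot_msumI (J : finType) (e : J -> int) X om : mpot X om -> mpot (msumI e X) om.
Proof.
case=> h0 h1; split=> -[j s] [j' s'].
  rewrite -(pair_bigA _ (fun l t => (md1 s t *+ (j == l)) * (md0 t s' *+ (l == j')))) /=.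
  rewrite (bigD1 j) //= [X in _ + X]big1 ?addr0; last first.
    by move=> l /negbTE lj; rewrite big1 // => i _; rewrite eq_sym lj mul0r.
  rewrite xpair_eqE eqxx; case: eqP => _ /=; last by rewrite big1 // => t _; rewrite mulr0.
  by rewrite -h0; apply: eq_bigr.
rewrite -(pair_bigA _ (fun l t => (md0 s t *+ (j == l)) * (md1 t s' *+ (l == j')))) /=.
rewrite (bigD1 j) //= [X in _ + X]big1 ?addr0; last first.
  by move=> l /negbTE lj; rewrite big1 // => i _; rewrite eq_sym lj mul0r.
rewrite xpair_eqE eqxx; case: eqP => _ /=; last by rewrite big1 // => t _; rewrite mulr0.
by rewrite -h1; apply: eq_bigr.
Qed.

Lemma sum_deltal (I : finType) (i : I) (c : {mpoly rat[N]}) (F : I -> {mpoly rat[N]}) :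
  \sum_j (c *+ (i == j)) * F j = c * F i.
Proof.
rewrite (bigD1 i) //= eqxx mulr1n big1 ?addr0 // => j /negbTE ji.
by rewrite eq_sym ji mul0r.
Qed.

Lemma sum_deltar (I : finType) (i : I) (c : {mpoly rat[N]}) (F : I -> {mpoly rat[N]}) :
  \sum_j F j * (c *+ (j == i)) = F i * c.
Proof.
rewrite (bigD1 i) //= eqxx mulr1n big1 ?addr0 // => j /negbTE ->.
by rewrite mulr0.
Qed.

Lemma sum_kosz (I : finType) (F : unit * I -> {mpoly rat[N]}) : \sum_p F p = \sum_i F (tt, i).
Proof.
transitivity (\sum_u \sum_i F (u, i)); first by rewrite pair_bigA; apply: eq_bigr => -[].
by rewrite (bigD1 tt) //= [X in _ + X]big1 ?addr0 // => -[].
Qed.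

Lemma mpot_kosz d a b X om : mpot X om -> mpot (mtens (kosz d a b) X) (om + a * b).
Proof.
case=> h0 h1; split.
- case=> -[[] s] [[[] s']|[[] s']]; rewrite big_sumType /= !sum_kosz /= ?sum_eqE ?eqxx /= ?mulr1n ?mulr0n.
  + under [X in _ + X]eq_bigr do rewrite !mulr1n.
    by rewrite sum_deltal mulrnAr h0 -mulrnDl addrC [b * a]mulrC.
  + under eq_bigr do rewrite mulr1n; under [X in _ + X]eq_bigr do rewrite mulr1n.
    by rewrite sum_deltal sum_deltar mulrN [b * _]mulrC addNr.
  + under eq_bigr do rewrite mulr1n; under [X in _ + X]eq_bigr do rewrite mulr1n.
    by rewrite sum_deltal sum_deltar mulNr [a * _]mulrC addNr.
  + under eq_bigr do rewrite !mulr1n mulrNN.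
    by rewrite h1 sum_deltal mulrnAr -mulrnDl.
- case=> -[[] s] [[[] s']|[[] s']]; rewrite big_sumType /= !sum_kosz /= ?sum_eqE ?eqxx /= ?mulr1n ?mulr0n.
  + under [X in _ + X]eq_bigr do rewrite !mulr1n mulrNN.
    by rewrite sum_deltal mulrnAr h0 -mulrnDl addrC.
  + under eq_bigr do rewrite mulr1n; under [X in _ + X]eq_bigr do rewrite mulr1n.
    by rewrite sum_deltal sum_deltar mulNr [a * _]mulrC subrr.
  + under eq_bigr do rewrite mulr1n; under [X in _ + X]eq_bigr do rewrite mulr1n.
    by rewrite sum_deltal sum_deltar mulrN [b * _]mulrC subrr.
  + under eq_bigr do rewrite !mulr1n.
    by rewrite h1 sum_deltal mulrnAr -mulrnDl [b * a]mulrC.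
Qed.

End Potentials.

(** * Substitutions and gradings *)

Section Substitution.

Lemma mpoly_ring_ind N (P : {mpoly rat[N]} -> Prop) :
  (forall c, P c%:MP) -> (forall i, P 'X_i) ->
  (forall p q, P p -> P q -> P (p + q)) ->
  (forall p q, P p -> P q -> P (p * q)) -> forall p, P p.
Proof.
move=> hC hX hD hM p; elim/mpolyind: p => [|c m p _ _ Pp]; first by rewrite -mpolyC0.
apply: (hD) => //; rewrite -mul_mpolyC; apply: (hM) => //.
rewrite mpolyXE_id; apply: (big_ind P) => [|p1 p2|i _]; first by rewrite -mpolyC1.
  exact: hM.
elim: (m i) => [|e ih]; first by rewrite expr0 -mpolyC1.
by rewrite exprS; apply: hM.
Qed.

Definition psub N N' (g : 'I_N -> {mpoly rat[N']}) (p : {mpoly rat[N]}) : {mpoly rat[N']} :=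
  p \mPo [tuple g i | i < N].

Fact psub_zmod N N' (g : 'I_N -> {mpoly rat[N']}) : zmod_morphism (psub g).
Proof. by move=> p q; rewrite /psub rmorphB. Qed.

Fact psub_monoid N N' (g : 'I_N -> {mpoly rat[N']}) : monoid_morphism (psub g).
Proof. by split=> [|p q]; rewrite /psub ?rmorph1 ?rmorphM. Qed.

HB.instance Definition _ N N' (g : 'I_N -> {mpoly rat[N']}) :=
  GRing.isZmodMorphism.Build {mpoly rat[N]} {mpoly rat[N']} (psub g) (psub_zmod g).
HB.instance Definition _ N N' (g : 'I_N -> {mpoly rat[N']}) :=
  GRing.isMonoidMorphism.Build {mpoly rat[N]} {mpoly rat[N']} (psub g) (psub_monoid g).

Lemma psubC N N' (g : 'I_N -> {mpoly rat[N']}) c : psub g c%:MP = c%:MP.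
Proof. exact: comp_mpolyC. Qed.

Lemma psubX N N' (g : 'I_N -> {mpoly rat[N']}) i : psub g 'X_i = g i.
Proof. by rewrite /psub comp_mpolyXU -tnth_nth tnth_mktuple. Qed.

Lemma psubZ N N' (g : 'I_N -> {mpoly rat[N']}) c p : psub g (c *: p) = c *: psub g p.
Proof. exact: comp_mpolyZ. Qed.

Lemma psub_uniq N N' (g : 'I_N -> {mpoly rat[N']}) (f : {rmorphism {mpoly rat[N]} -> {mpoly rat[N']}}) :
  (forall c, f c%:MP = c%:MP) -> (forall i, f 'X_i = g i) -> forall p, psub g p = f p.
Proof.
move=> hC hX p; elim/mpoly_ring_ind: p => [c|i|p q hp hq|p q hp hq].
- by rewrite psubC hC.
- by rewrite psubX hX.
- by rewrite !rmorphD /= hp hq.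
- by rewrite !rmorphM /= hp hq.
Qed.

Lemma eq_psub N N' (g h : 'I_N -> {mpoly rat[N']}) : g =1 h -> psub g =1 psub h.
Proof. by move=> gh; apply: (psub_uniq (f := psub h)) => [c|i] /=; rewrite ?psubC // psubX gh. Qed.

Lemma psub_comp N1 N2 N3 (g : 'I_N1 -> {mpoly rat[N2]}) (h : 'I_N2 -> {mpoly rat[N3]}) p :
  psub h (psub g p) = psub (fun i => psub h (g i)) p.
Proof.
apply/esym; apply: (psub_uniq (f := psub h \o psub g)) => [c|i] /=.
  by rewrite !psubC.
by rewrite psubX.
Qed.

Lemma psub_id N p : psub (fun i : 'I_N => 'X_i) p = p.
Proof. exact: comp_mpoly_id. Qed.

(** Existence of divided differences. The polynomials [p] with this property contain the variables
    and are closed under products, because p q - p' q' = (p - p') q + p' (q - q'). *)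
Lemma psub_dvd N N' (g h : 'I_N -> {mpoly rat[N']}) b :
  (forall i, exists c, c * b = g i - h i) -> forall p, exists c, c * b = psub g p - psub h p.
Proof.
move=> hb p; elim/mpoly_ring_ind: p => [c|i|p q [c hc] [d hd]|p q [c hc] [d hd]].
- by exists 0; rewrite !psubC subrr mul0r.
- by rewrite !psubX.
- by exists (c + d); rewrite mulrDl hc hd !rmorphD /= opprD addrACA.
- exists (c * psub g q + psub h p * d).
  rewrite mulrDl mulrAC hc -mulrA hd !rmorphM /= mulrBl mulrBr.
  by rewrite addrA subrK.
Qed.

Lemma pinclE N k (x : 'I_k -> 'I_N) p : pincl x p = psub (pvar x) p.
Proof. by []. Qed.

Lemma psub_pincl N N' k (x : 'I_k -> 'I_N) (g : 'I_N -> {mpoly rat[N']}) p :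
  psub g (pincl x p) = psub (fun i => g (x i)) p.
Proof. by rewrite pinclE psub_comp; apply: eq_psub => i; rewrite psubX. Qed.

End Substitution.

Section Homogeneity.
Variables (N : nat) (w : 'I_N -> nat).
Implicit Types p q : {mpoly rat[N]}.

Lemma zhomogP (d : nat) p : zhomog w d p <-> p \is d.-homog for (wdeg w).
Proof.
split=> [h|/dhomogP h m /h <- //]; apply/dhomogP => m /h /eqP.
by rewrite eqz_nat => /eqP.
Qed.

Lemma zhomog0 d : zhomog w d 0.
Proof. by move=> m; rewrite msupp0. Qed.

Lemma zhomogD d p q : zhomog w d p -> zhomog w d q -> zhomog w d (p + q).
Proof. by move=> hp hq m /msuppD_le; rewrite mem_cat => /orP[/hp|/hq]. Qed.

Lemma zhomogN d p : zhomog w d p -> zhomog w d (- p).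
Proof. by move=> h m; rewrite (perm_mem (msuppN p)) => /h. Qed.

Lemma zhomogB d p q : zhomog w d p -> zhomog w d q -> zhomog w d (p - q).
Proof. by move=> hp hq; apply/zhomogD/zhomogN. Qed.

Lemma zhomogM d e p q : zhomog w d p -> zhomog w e q -> zhomog w (d + e) (p * q).
Proof.
move=> hp hq m /msuppM_le /allpairsP [[m1 m2] /= [/hp h1 /hq h2 ->]].
by rewrite mfD PoszD h1 h2.
Qed.

Lemma zhomog_sum d (I : Type) (r : seq I) (P : pred I) (F : I -> {mpoly rat[N]}) :
  (forall i, P i -> zhomog w d (F i)) -> zhomog w d (\sum_(i <- r | P i) F i).
Proof. by move=> h; apply: big_ind => // [|p q]; [apply: zhomog0 | apply: zhomogD]. Qed.

Lemma zhomogMn d p m : zhomog w d p -> zhomog w d (p *+ m).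
Proof.
by move=> h; elim: m => [|m ih]; rewrite ?mulr0n ?mulrS; [apply: zhomog0 | apply: zhomogD].
Qed.

Lemma zhomogC c : zhomog w 0 c%:MP.
Proof.
move=> m; rewrite msuppC; case: eqP => // _; rewrite inE => /eqP ->.
by rewrite mf0.
Qed.

Lemma zhomogZ d c p : zhomog w d p -> zhomog w d (c *: p).
Proof. by move=> h; rewrite -mul_mpolyC -[d]add0r; apply/zhomogM/h/zhomogC. Qed.

Lemma wdegU i : wdeg w U_(i)%MM = w i.
Proof.
rewrite /wdeg (bigD1 i) //= mnm1E eqxx mul1n big1 ?addn0 // => j /negbTE ji.
by rewrite mnm1E eq_sym ji mul0n.
Qed.

Lemma zhomogX i : zhomog w (w i) 'X_i.
Proof. by move=> m; rewrite msuppX inE => /eqP ->; rewrite wdegU. Qed.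

Lemma zhomogXm m : zhomog w (wdeg w m) 'X_[m].
Proof. by move=> m'; rewrite msuppX inE => /eqP ->. Qed.

Lemma zhomogXn d p m : zhomog w d p -> zhomog w (d * m%:Z) (p ^+ m).
Proof.
move=> h; elim: m => [|m ih]; first by rewrite mulr0 expr0 -mpolyC1; apply: zhomogC.
by rewrite exprS -natz mulrS mulrDr mulr1 natz; apply: zhomogM.
Qed.

Lemma zhomog_neg d p : zhomog w d p -> p != 0 -> exists e : nat, d = e.
Proof.
move=> h nz; exists (wdeg w (mlead p)); apply/esym/h.
exact: mlead_supp.
Qed.

Lemma pihomogM (d e : nat) p q : zhomog w d q ->
  pihomog (wdeg w) (e + d) (p * q) = pihomog (wdeg w) e p * q.
Proof.
move=> hq; elim/mpolyind: p => [|c m p _ _ ih]; first by rewrite mul0r !linear0 mul0r.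
rewrite mulrDl !linearD /= ih mulrDl; congr (_ + _).
rewrite -scalerAl !linearZ /= -scalerAl; congr (_ *: _).
have hXq : 'X_[m] * q \is (wdeg w m + d).-homog for (wdeg w).
  by apply/zhomogP; rewrite PoszD; apply/zhomogM/hq/zhomogXm.
rewrite pihomogX; case: eqP => [<-|/eqP ne]; first by rewrite pihomog_dE.
by rewrite mul0r (pihomog_ne0 _ hXq) // eqn_add2r.
Qed.

(** A component of [c] in a wrong degree, multiplied by [q], is a component of [c * q] in a degree
    other than [e], hence 0; and [q] is not a zero divisor. *)
Lemma zhomog_div d e c q : q != 0 -> zhomog w d q -> zhomog w e (c * q) -> zhomog w (e - d) c.
Proof.
move=> nzq hq hcq M hM; have [d' dE] := zhomog_neg hq nzq; move: hq; rewrite dE => hq.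
apply/eqP; rewrite eq_sym subr_eq eq_sym; apply/negPn/negP => ne.
move: (hM); rewrite mcoeff_msupp => /negP; apply.
suff : pihomog (wdeg w) (wdeg w M) c = 0.
  rewrite pihomogE => /mpolyP /(_ M); rewrite mcoeff0 linear_sum /=.
  rewrite big_mkcond (bigD1_seq M) //= eqxx big1 => [|m /negbTE mM].
    by rewrite mcoeffZ mcoeffX eqxx mulr1 addr0 => /eqP.
  by rewrite mcoeffZ mcoeffX mM mulr0 if_same.
apply: (mulIf nzq); rewrite mul0r -(pihomogM _ _ hq).
have [->|nz] := eqVneq (c * q) 0; first by rewrite linear0.
have [e' eE] := zhomog_neg hcq nz; move: hcq; rewrite eE => /zhomogP hcq.
rewrite (pihomog_ne0 _ hcq) //; apply/eqP => h; case/negP: ne.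
by rewrite eE h PoszD.
Qed.

End Homogeneity.

Lemma zhomog_psub N N' (w : 'I_N -> nat) (w' : 'I_N' -> nat) (g : 'I_N -> {mpoly rat[N']}) :
  (forall i, zhomog w' (w i) (g i)) ->
  forall d p, zhomog w d p -> zhomog w' d (psub g p).
Proof.
move=> hg d p hp; rewrite [p]mpolyE raddf_sum /= big_seq.
apply: zhomog_sum => m /hp <-; rewrite psubZ; apply: zhomogZ.
rewrite mpolyXE_id rmorph_prod /= /wdeg.
elim/big_rec2: _ => [|i y1 y2 _ h]; first by rewrite -mpolyC1; apply: zhomogC.
rewrite PoszD; apply: zhomogM h; rewrite rmorphXn /= psubX PoszM mulrC.
exact: zhomogXn.
Qed.

(** * Freeness over the base ring *)

Section GradedFree.
Variables (N k : nat) (x : 'I_k -> 'I_N) (w : 'I_N -> nat) (wk : 'I_k -> nat).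
Hypothesis x_inj : injective x.
Hypothesis w_x : forall i, w (x i) = wk i.

(** Every monomial factors uniquely into one in the variables named by [x] and an [inner] one, which
    avoids them. So the larger ring is free over the base ring on the [inner] monomials, the
    coefficients being given by [cf]. *)
Let inner (m : 'X_{1..N}) : bool := [forall j, m (x j) == 0%N].
Let outer_part (m : 'X_{1..N}) : 'X_{1..k} := [multinom m (x j) | j < k].
Let inner_part (m : 'X_{1..N}) : 'X_{1..N} :=
  [multinom if i \in codom x then 0%N else m i | i < N].
Let lift (u : 'X_{1..k}) : 'X_{1..N} := (\sum_j U_(x j) *+ u j)%MM.

Let liftE u j : lift u (x j) = u j.
Proof.
rewrite mnm_sumE (bigD1 j) //= mulmnE mnm1E eqxx mul1n big1 ?addn0 // => l /negbTE lj.
by rewrite mulmnE mnm1E (inj_eq x_inj) lj.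
Qed.

Let lift0 u i : i \notin codom x -> lift u i = 0%N.
Proof.
move=> ni; rewrite mnm_sumE big1 // => l _; rewrite mulmnE mnm1E.
by case: eqP => // xi; case/negP: ni; rewrite -xi codom_f.
Qed.

Let inner_partP m : inner (inner_part m).
Proof. by apply/forallP => j; rewrite mnmE codom_f. Qed.

Let mnm_split m : m = (lift (outer_part m) + inner_part m)%MM.
Proof.
apply/mnmP => i; rewrite mnmDE mnmE; case: ifP => [/codomP[j ->]|/negbT ni].
  by rewrite liftE mnmE addn0.
by rewrite lift0.
Qed.

Let outerD u m : inner m -> outer_part (lift u + m)%MM = u.
Proof. by move=> /forallP h; apply/mnmP => j; rewrite mnmE mnmDE liftE (eqP (h j)) addn0. Qed.

Let innerD u m : inner m -> inner_part (lift u + m)%MM = m.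
Proof.
move=> /forallP h; apply/mnmP => i; rewrite mnmE mnmDE.
case: ifP => [/codomP[j ->]|/negbT ni]; first by rewrite (eqP (h j)).
by rewrite lift0.
Qed.

Let pincl_Xm u : pincl x 'X_[u] = 'X_[lift u].
Proof.
rewrite pinclE mpolyXE_id rmorph_prod /= -mprodXnE; apply: eq_bigr => j _.
by rewrite rmorphXn /= psubX.
Qed.

Let wdeg_lift u : wdeg w (lift u) = wdeg wk u.
Proof.
rewrite /lift (big_morph (wdeg w) (wdegD w) (wdeg0 w)) /wdeg.
apply: eq_bigr => j _; rewrite -w_x -(wdegU w) /wdeg big_distrr /=.
by apply: eq_bigr => i _; rewrite mulmnE mulnAC mulnC.
Qed.

Let cf (p : {mpoly rat[N]}) (m : 'X_{1..N}) : {mpoly rat[k]} :=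
  \sum_(M <- msupp p | inner_part M == m) p@_M *: 'X_[outer_part M].

Let cf_homog d p m : zhomog w d p -> zhomog wk (d - (wdeg w m)%:Z) (cf p m).
Proof.
move=> hp; rewrite /cf big_seq_cond; apply: zhomog_sum => M /andP[/hp <- /eqP <-].
apply: zhomogZ; rewrite {1}[M]mnm_split wdegD wdeg_lift PoszD addrK.
exact: zhomogXm.
Qed.

Let cf_sum p (ms : seq 'X_{1..N}) : uniq ms ->
  (forall M, M \in msupp p -> inner_part M \in ms) ->
  \sum_(m <- ms) pincl x (cf p m) * 'X_[m] = p.
Proof.
move=> ums hms; rewrite [RHS]mpolyE.
transitivity (\sum_(m <- ms) \sum_(M <- msupp p) if inner_part M == m then p@_M *: 'X_[M] else 0).
  apply: eq_bigr => m _; rewrite -big_mkcond /cf pinclE rmorph_sum /= mulr_suml.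
  apply: eq_bigr => M /eqP <-; rewrite psubZ -pinclE pincl_Xm -scalerAl -mpolyXD.
  by rewrite -mnm_split.
rewrite exchange_big /= big_seq [RHS]big_seq; apply: eq_bigr => M hM.
rewrite (bigD1_seq (inner_part M)) ?hms //= eqxx big1 ?addr0 // => m /negbTE.
by rewrite eq_sym => ->.
Qed.

Variables (S : finType) (e : S -> int).

Let basis_index : choiceType := (S * {m : 'X_{1..N} | inner m})%type.
Let bvec (i : basis_index) : res_free x S := [ffun s => 'X_[val i.2] *+ (i.1 == s)].
Let bdeg (i : basis_index) : int := e i.1 + (wdeg w (val i.2))%:Z.

Let gmod := res_gmodule x w e.

Let coordE (s : seq basis_index) (c : basis_index -> {mpoly rat[k]}) t :
  (\sum_(i <- s) c i *: (bvec i : gmod)) t =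
  \sum_(i <- s | i.1 == t) pincl x (c i) * 'X_[val i.2].
Proof.
rewrite big_mkcond; elim: s => [|i s ih]; first by rewrite !big_nil ffunE.
by rewrite !big_cons -ih !ffunE; case: eqP => _; rewrite ?mulr1n ?mulr0n ?mulr0 ?add0r.
Qed.

Let spanning (v : gmod) : exists (s : seq basis_index) (c : basis_index -> {mpoly rat[k]}),
  [/\ uniq s, v = \sum_(i <- s) c i *: (bvec i : gmod)
    & forall d, gm_homog d v -> forall i, i \in s -> zhomog wk (d - bdeg i) (c i)].
Proof.
pose ms := undup [seq (exist _ (inner_part M) (inner_partP M) : {m | inner m}) |
                   M <- flatten [seq msupp (v s) | s <- enum S]].
exists (allpairs pair (enum S) ms), (fun i => cf (v i.1) (val i.2)); split.
- by apply: allpairs_uniq; rewrite ?enum_uniq ?undup_uniq // => -[a b] [c d].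
- apply/ffunP => t; rewrite coordE.
  rewrite big_mkcond big_allpairs_dep /=.
  rewrite -[LHS](cf_sum (ms := map val ms)).
  + rewrite big_map; 
    rewrite big_enum /= (bigD1 t) //= eqxx [X in _ + X]big1 ?addr0 //.
    by move=> j /negbTE ->; rewrite big1.
  + by rewrite map_inj_uniq ?undup_uniq //; apply: val_inj.
  + move=> M hM; apply/mapP; exists (exist _ (inner_part M) (inner_partP M)) => //.
    rewrite mem_undup; apply/mapP; exists M => //.
    by apply/flattenP; exists (msupp (v t)) => //; apply: map_f; rewrite mem_enum.
- move=> d hv i _; rewrite /bdeg opprD addrA; apply: cf_homog; exact: hv.
Qed.

Lemma graded_free_restrict : graded_free wk gmod.
Proof.
exists basis_index, bvec, bdeg; split.
- by move=> v; have [s [c [_ -> _]]] := spanning v; exists s, c.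
- move=> s c us h0 i0 i0s.
  have : (\sum_(i <- s) c i *: (bvec i : gmod)) i0.1 = 0 by rewrite h0 ffunE.
  rewrite coordE => h; apply/mpolyP => u; rewrite mcoeff0.
  have := congr1 (fun p => p@_(lift u + val i0.2)%MM) h.
  rewrite mcoeff0 linear_sum /= big_mkcond (bigD1_seq i0) //= eqxx.
  have cE (c0 : {mpoly rat[k]}) (m m' : {m | inner m}) :
      (pincl x c0 * 'X_[val m])@_(lift u + val m')%MM = if m == m' then c0@_u else 0.
    rewrite pinclE [c0 in LHS]mpolyE rmorph_sum /= mulr_suml linear_sum /=.
    under eq_bigr do rewrite psubZ -pinclE pincl_Xm -scalerAl -mpolyXD mcoeffZ mcoeffX.
    transitivity (\sum_(M <- msupp c0) c0@_M * ((M == u) && (m == m'))%:R).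
      apply: eq_bigr => M _; congr (_ * (_ : bool)%:R); apply/eqP/andP => [E|[/eqP -> /eqP -> //]].
      split; first by rewrite -(outerD M (valP m)) E (outerD _ (valP m')).
      by apply/eqP/val_inj; rewrite -(innerD M (valP m)) E (innerD _ (valP m')).
    case: eqP => _; last by rewrite big1 // => M _; rewrite andbF mulr0.
    under eq_bigr do rewrite andbT.
    rewrite [c0 in RHS]mpolyE linear_sum /=; apply: eq_bigr => M _.
    by rewrite mcoeffZ mcoeffX.
  rewrite cE eqxx big1 ?addr0 // => i ni; case: (i.1 =P i0.1) => // i1.
  rewrite cE ifF //; apply: contraNF ni => /eqP i2.
  by case: i i0 i1 i2 {i0s h} => a b [a' b'] /= -> ->.
- move=> d v; split=> [hv|[s [c [us -> hc]]] t].
    by have [s [c [us E hc]]] := spanning v; exists s, c; split => //; apply: hc.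
  rewrite coordE big_seq_cond; apply: zhomog_sum => i /andP[/hc h /eqP it].
  have := zhomogM (zhomog_psub (w' := w) (g := pvar x) _ h) (@zhomogXm N w (val i.2)).
  rewrite -pinclE -it /bdeg opprD addrA subrK; apply => j.
  by rewrite -w_x; apply: zhomogX.
Qed.

End GradedFree.

Lemma is_factorization_restrict N k (x : 'I_k -> 'I_N) w wk (X : mfact N) om d :
  injective x -> (forall i, w (x i) = wk i) -> zhomog wk d om ->
  mpot X (pincl x om) -> is_factorization wk om (restrict_to x w X).
Proof.
move=> xi wx hom [p0 p1]; split.
- by exists d.
- exact: graded_free_restrict.
- exact: graded_free_restrict.
- move=> v; apply/ffunP => s; rewrite !ffunE.
  transitivity (\sum_s' (\sum_t md1 s t * md0 t s') * v s').
    under eq_bigr do rewrite ffunE mulr_sumr.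
    rewrite exchange_big; apply: eq_bigr => s' _ /=.
    by rewrite mulr_suml; apply: eq_bigr => t _; rewrite mulrA.
  under eq_bigr do rewrite p0.
  exact: sum_deltal.
- move=> v; apply/ffunP => s; rewrite !ffunE.
  transitivity (\sum_s' (\sum_t md0 s t * md1 t s') * v s').
    under eq_bigr do rewrite ffunE mulr_sumr.
    rewrite exchange_big; apply: eq_bigr => s' _ /=.
    by rewrite mulr_suml; apply: eq_bigr => t _; rewrite mulrA.
  under eq_bigr do rewrite p1.
  exact: sum_deltal.
Qed.

(* The differentials are homogeneous of degree c. *)
Definition mgood N (w : 'I_N -> nat) (c : int) (X : mfact N) : Prop :=
  (forall t s, zhomog w (c + mgrad0 s - mgrad1 t) (@md0 N X t s)) /\
  (forall t s, zhomog w (c + mgrad1 s - mgrad0 t) (@md1 N X t s)).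

Definition msubst N N' (f : {mpoly rat[N]} -> {mpoly rat[N']}) (X : mfact N) : mfact N' :=
  @MFact N' (mgen0 X) (mgen1 X) (@mgrad0 N X) (@mgrad1 N X)
    (fun t s => f (md0 t s)) (fun t s => f (md1 t s)).

Section Coordinatewise.
Variables (k N N' : nat) (x : 'I_k -> 'I_N) (x' : 'I_k -> 'I_N').

Definition cw (I : finType) (f : {mpoly rat[N]} -> {mpoly rat[N']}) (v : res_free x I) :
  res_free x' I := [ffun i => f (v i)].

Definition base_linear (f : {mpoly rat[N]} -> {mpoly rat[N']}) : Prop :=
  forall r p q, f (pincl x r * p + q) = pincl x' r * f p + f q.

Lemma cw_linear (I : finType) f : base_linear f -> linear (@cw I f).
Proof. by move=> h a u v; apply/ffunP => i; rewrite !ffunE h. Qed.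

Lemma base_linear_rmorph (f : {rmorphism {mpoly rat[N]} -> {mpoly rat[N']}}) :
  (forall r, f (pincl x r) = pincl x' r) -> base_linear f.
Proof. by move=> h r p q; rewrite rmorphD rmorphM /= h. Qed.

Lemma cw_res_mx (I J : finType) (D : J -> I -> {mpoly rat[N]}) (D' : J -> I -> {mpoly rat[N']})
    (f : {rmorphism {mpoly rat[N]} -> {mpoly rat[N']}}) v :
  (forall t s, f (D t s) = D' t s) -> cw f (res_mx D v) = res_mx D' (cw f v).
Proof.
move=> h; apply/ffunP => t; rewrite !ffunE rmorph_sum; apply: eq_bigr => s _.
by rewrite rmorphM /= h ffunE.
Qed.

End Coordinatewise.

Lemma fmor_msubst k N0 N N' (x : 'I_k -> 'I_N) (x' : 'I_k -> 'I_N') w w'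
    (f : {mpoly rat[N0]} -> {mpoly rat[N]}) (g : {mpoly rat[N0]} -> {mpoly rat[N']})
    (h : {rmorphism {mpoly rat[N]} -> {mpoly rat[N']}}) X :
  (forall p, h (f p) = g p) ->
  (forall r, h (pincl x r) = pincl x' r) ->
  (forall d p, zhomog w d p -> zhomog w' d (h p)) ->
  exists e : fmor (restrict_to x w (msubst f X)) (restrict_to x' w' (msubst g X)),
    (forall v, fm0 e v = cw x' h v) /\ (forall v, fm1 e v = cw x' h v).
Proof.
move=> hfg hf wf; have bf := base_linear_rmorph hf.
unshelve eexists (FMor
   (fm0 := (mklin (cw_linear bf) : {linear fmod0 (restrict_to x w (msubst f X)) -> fmod0 (restrict_to x' w' (msubst g X))}))
   (fm1 := (mklin (cw_linear bf) : {linear fmod1 (restrict_to x w (msubst f X)) -> fmod1 (restrict_to x' w' (msubst g X))})) _ _ _ _).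
- by move=> d v hv i; rewrite ffunE; apply/wf/hv.
- by move=> d v hv i; rewrite ffunE; apply/wf/hv.
- by move=> v; apply: cw_res_mx => t s; apply: hfg.
- by move=> v; apply: cw_res_mx => t s; apply: hfg.
by [].
Qed.

(** In use [f] is an idempotent substitution; it commutes with the differentials because it fixes
    their entries, and thus becomes an idempotent endomorphism. *)
Lemma fmor_fixed k N (x : 'I_k -> 'I_N) w (f : {rmorphism {mpoly rat[N]} -> {mpoly rat[N]}}) X :
  (forall r, f (pincl x r) = pincl x r) ->
  (forall d p, zhomog w d p -> zhomog w d (f p)) ->
  (forall t s, f (@md0 N X t s) = md0 t s) -> (forall t s, f (@md1 N X t s) = md1 t s) ->
  exists e : fmor (restrict_to x w X) (restrict_to x w X),
    (forall v, fm0 e v = cw x f v) /\ (forall v, fm1 e v = cw x f v).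
Proof.
move=> hf wf f0 f1; have bf := base_linear_rmorph hf.
unshelve eexists (FMor
   (fm0 := (mklin (cw_linear bf) : {linear fmod0 (restrict_to x w X) -> fmod0 (restrict_to x w X)}))
   (fm1 := (mklin (cw_linear bf) : {linear fmod1 (restrict_to x w X) -> fmod1 (restrict_to x w X)})) _ _ _ _).
- by move=> d v h i; rewrite ffunE; apply/wf/h.
- by move=> d v h i; rewrite ffunE; apply/wf/h.
- by move=> v; apply: cw_res_mx.
- by move=> v; apply: cw_res_mx.
by [].
Qed.

(** * Elimination of a variable *)

Section KoszulCoordinates.
Variables (k N : nat) (x : 'I_k -> 'I_N).
Implicit Types I J : finType.

(** The scalars of [res_free] come from the base ring only; this is multiplication by an element of
    the larger ring. *)
Definition amul I (a : {mpoly rat[N]}) (v : res_free x I) : res_free x I := [ffun i => a * v i].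

Definition pk I J (u : res_free x I) (v : res_free x J) : res_free x (unit * I + unit * J)%type :=
  [ffun s => match s with inl (_, i) => u i | inr (_, j) => v j end].
Definition pl I J (z : res_free x (unit * I + unit * J)%type) : res_free x I :=
  [ffun i => z (inl (tt, i))].
Definition pr I J (z : res_free x (unit * I + unit * J)%type) : res_free x J :=
  [ffun j => z (inr (tt, j))].

Lemma pkE I J z : z = pk (@pl I J z) (pr z).
Proof. by apply/ffunP => -[[[] i]|[[] i]]; rewrite !ffunE. Qed.

Lemma pl_pk I J (u : res_free x I) (v : res_free x J) : pl (pk u v) = u.
Proof. by apply/ffunP => i; rewrite !ffunE. Qed.

Lemma pr_pk I J (u : res_free x I) (v : res_free x J) : pr (pk u v) = v.
Proof. by apply/ffunP => i; rewrite !ffunE. Qed.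

Lemma pl_linear I J : linear (@pl I J).
Proof. by move=> a u v; apply/ffunP => i; rewrite !ffunE. Qed.

Lemma pr_linear I J : linear (@pr I J).
Proof. by move=> a u v; apply/ffunP => i; rewrite !ffunE. Qed.

Lemma pk_linear I J a (u u' : res_free x I) (v v' : res_free x J) :
  pk (a *: u + u') (a *: v + v') = a *: pk u v + pk u' v'.
Proof. by apply/ffunP => -[[[] i]|[[] i]]; rewrite !ffunE. Qed.

Lemma pkD I J (u u' : res_free x I) (v v' : res_free x J) :
  pk u v + pk u' v' = pk (u + u') (v + v').
Proof. by apply/ffunP => -[[[] i]|[[] i]]; rewrite !ffunE. Qed.

Lemma pkN I J (u : res_free x I) (v : res_free x J) : - pk u v = pk (- u) (- v).
Proof. by apply/ffunP => -[[[] i]|[[] i]]; rewrite !ffunE. Qed.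

Lemma cw_pk I J f (u : res_free x I) (v : res_free x J) :
  cw x f (pk u v) = pk (cw x f u) (cw x f v).
Proof. by apply/ffunP => -[[[] i]|[[] i]]; rewrite !ffunE. Qed.

Lemma res_mx_amul I J (D : J -> I -> {mpoly rat[N]}) a (v : res_free x I) :
  res_mx D (amul a v) = amul a (res_mx D v).
Proof.
apply/ffunP => t; rewrite !ffunE mulr_sumr; apply: eq_bigr => s _.
by rewrite ffunE mulrCA.
Qed.

Variables (d : int) (a b : {mpoly rat[N]}) (X : mfact N).
Let C := mtens (kosz d a b) X.

Lemma kosz_d0 (u : res_free x (mgen0 X)) (v : res_free x (mgen1 X)) :
  res_mx (@md0 N C) (pk u v) =
  pk (amul a u - res_mx (@md1 N X) v) (res_mx (@md0 N X) u + amul b v).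
Proof.
apply/ffunP => -[[[] i]|[[] i]]; rewrite !ffunE /= big_sumType /= !sum_kosz /=.
  congr (_ + _); last first.
    by rewrite -sumrN; apply: eq_bigr => s _; rewrite ffunE ?eqxx mulr1n mulNr.
  by under eq_bigr do rewrite ffunE; rewrite sum_deltal.
congr (_ + _); last by under eq_bigr do rewrite ffunE; rewrite sum_deltal.
by apply: eq_bigr => s _; rewrite ffunE ?eqxx mulr1n.
Qed.

Lemma kosz_d1 (u : res_free x (mgen0 X)) (v : res_free x (mgen1 X)) :
  res_mx (@md1 N C) (pk u v) =
  pk (amul b u + res_mx (@md1 N X) v) (amul a v - res_mx (@md0 N X) u).
Proof.
apply/ffunP => -[[[] i]|[[] i]]; rewrite !ffunE /= big_sumType /= !sum_kosz /=.
  congr (_ + _); first by under eq_bigr do rewrite ffunE; rewrite sum_deltal.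
  by apply: eq_bigr => s _; rewrite ffunE ?eqxx mulr1n.
rewrite [RHS]addrC; congr (_ + _); last by under eq_bigr do rewrite ffunE; rewrite sum_deltal.
by rewrite -sumrN; apply: eq_bigr => s _; rewrite ffunE ?eqxx mulr1n mulNr.
Qed.

End KoszulCoordinates.

Lemma pquotP N (p q : {mpoly rat[N]}) : (exists c, c * q = p) -> pquot p q * q = p.
Proof. exact: (ClassicalEpsilon.epsilon_spec (inhabits 0) (fun c => c * q = p)). Qed.

Lemma res_mx_homog k N (x : 'I_k -> 'I_N) w c (I J : finType) (e : I -> int) (e' : J -> int)
    (D : J -> I -> {mpoly rat[N]}) :
  (forall t s, zhomog w (c + e s - e' t) (D t s)) ->
  forall d v, @gm_homog k (res_gmodule x w e) d v ->
  @gm_homog k (res_gmodule x w e') (d + c) (res_mx D v).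
Proof.
move=> hD d v hv t; rewrite ffunE; apply: zhomog_sum => s _.
have := zhomogM (hD t s) (hv s); congr zhomog.
by ring.
Qed.

(* The equivalence of the images of two substitutions f and f' acting
   coordinatewise. *)
Definition kequiv_on k N N' (x : 'I_k -> 'I_N) (x' : 'I_k -> 'I_N') w w' (Z : mfact N) f
    (Z' : mfact N') f' : Prop :=
  forall (e : fmor (restrict_to x w Z) (restrict_to x w Z))
         (e' : fmor (restrict_to x' w' Z') (restrict_to x' w' Z')),
  (forall v, fm0 e v = cw x f v) -> (forall v, fm1 e v = cw x f v) ->
  (forall v, fm0 e' v = cw x' f' v) -> (forall v, fm1 e' v = cw x' f' v) ->
  kequiv e e'.

(* ta sets b = 0 and th substitutes for the variables eliminated before; the divided
   difference bt p = (th p - ta p) / b gives the homotopies. *)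
Section EliminationStep.
Variables (k N : nat) (x : 'I_k -> 'I_N) (w : 'I_N -> nat) (c d : int).
Variables (a b : {mpoly rat[N]}) (X : mfact N) (om : {mpoly rat[k]}).
Variables th ta : {rmorphism {mpoly rat[N]} -> {mpoly rat[N]}}.
Hypothesis th_base : forall r, th (pincl x r) = pincl x r.
Hypothesis ta_base : forall r, ta (pincl x r) = pincl x r.
Hypothesis th_homog : forall e p, zhomog w e p -> zhomog w e (th p).
Hypothesis ta_homog : forall e p, zhomog w e p -> zhomog w e (ta p).
Hypothesis thta : forall p, th (ta p) = ta p.
Hypothesis tath : forall p, ta (th p) = ta p.
Hypothesis thth : forall p, th (th p) = th p.
Hypothesis tata : forall p, ta (ta p) = ta p.
Hypothesis b_neq0 : b != 0.
Hypothesis th_b : th b = b.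
Hypothesis ta_b : ta b = 0.
Hypothesis th_a : th a = a.
Hypothesis dvd_b : forall p, exists q, q * b = th p - ta p.
Hypothesis b_homog : zhomog w (c + d) b.
Hypothesis th_X0 : forall t s, th (@md0 N X t s) = md0 t s.
Hypothesis th_X1 : forall t s, th (@md1 N X t s) = md1 t s.
Hypothesis X_good : mgood w c X.
Hypothesis X_pot : mpot X (pincl x om - a * b).

Let bt p := pquot (th p - ta p) b.
Let btE p : bt p * b = th p - ta p.
Proof. exact: pquotP. Qed.
Let bt_uniq p q : q * b = th p - ta p -> bt p = q.
Proof. by move=> h; apply: (mulIf b_neq0); rewrite btE h. Qed.
Let bt_lin : base_linear x x bt.
Proof.
move=> r p q; apply: bt_uniq; rewrite mulrDl -mulrA !btE !rmorphD !rmorphM /= th_base ta_base.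
by rewrite mulrBr opprD addrACA.
Qed.
Let bt_mul p : bt (b * p) = th p.
Proof. by apply: bt_uniq; rewrite !rmorphM /= th_b ta_b mul0r subr0 mulrC. Qed.
Let bt_th p : bt (th p) = bt p.
Proof. by apply: bt_uniq; rewrite btE thth tath. Qed.
Let th_bt p : th (bt p) = bt p.
Proof.
by apply: (mulIf b_neq0); rewrite btE -{1}th_b -rmorphM /= btE rmorphB /= thth thta.
Qed.
Let bt_ta p : bt (ta p) = 0.
Proof. by apply: bt_uniq; rewrite thta tata subrr mul0r. Qed.
Let bt_homog e p : zhomog w e p -> zhomog w (e - (c + d)) (bt p).
Proof.
move=> h; apply: (zhomog_div b_neq0 b_homog); rewrite btE.
by apply: zhomogB; [apply: th_homog | apply: ta_homog].
Qed.

Let C := mtens (kosz d a b) X.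
Let Y := msubst ta X.
Let Th (I : finType) (v : res_free x I) : res_free x I := cw x th v.
Let Ta (I : finType) (v : res_free x I) : res_free x I := cw x ta v.
Let B (I : finType) (v : res_free x I) : res_free x I := cw x bt v.
Let d0 (v : res_free x (mgen0 X)) : res_free x (mgen1 X) := res_mx (@md0 N X) v.
Let d1 (v : res_free x (mgen1 X)) : res_free x (mgen0 X) := res_mx (@md1 N X) v.
Let d0' (v : res_free x (mgen0 X)) : res_free x (mgen1 X) := res_mx (@md0 N Y) v.
Let d1' (v : res_free x (mgen1 X)) : res_free x (mgen0 X) := res_mx (@md1 N Y) v.

Let Ta_lin (I : finType) : linear (@Ta I).
Proof. exact: cw_linear (base_linear_rmorph ta_base). Qed.
Let B_lin (I : finType) : linear (@B I).
Proof. exact: cw_linear bt_lin. Qed.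
Let TaD (I : finType) : {morph @Ta I : u v / u + v}.
Proof. exact: (linearD (mklin (@Ta_lin I))). Qed.
Let BD (I : finType) : {morph @B I : u v / u + v}.
Proof. exact: (linearD (mklin (@B_lin I))). Qed.
Let BB (I : finType) : {morph @B I : u v / u - v}.
Proof. exact: (linearB (mklin (@B_lin I))). Qed.
Let B0 (I : finType) : @B I 0 = 0.
Proof. by have := @BB I 0 0; rewrite !subrr. Qed.
Let d0B : {morph d0 : u v / u - v}.
Proof. by move=> u v; rewrite /d0 linearB. Qed.
Let d1B : {morph d1 : u v / u - v}.
Proof. by move=> u v; rewrite /d1 linearB. Qed.
Let d00 : d0 0 = 0.
Proof. by rewrite /d0 linear0. Qed.
Let d10 : d1 0 = 0.
Proof. by rewrite /d1 linear0. Qed.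
Let d0N : {morph d0 : u / - u}.
Proof. by move=> u; rewrite /d0 linearN. Qed.
Let d1N : {morph d1 : u / - u}.
Proof. by move=> u; rewrite /d1 linearN. Qed.
Let d0b v : d0 (amul b v) = amul b (d0 v).
Proof. exact: res_mx_amul. Qed.
Let d1b v : d1 (amul b v) = amul b (d1 v).
Proof. exact: res_mx_amul. Qed.

Let bB (I : finType) (v : res_free x I) : amul b (B v) = Th v - Ta v.
Proof. by apply/ffunP => i; rewrite !ffunE mulrC btE. Qed.
Let Bb (I : finType) (v : res_free x I) : B (amul b v) = Th v.
Proof. by apply/ffunP => i; rewrite !ffunE bt_mul. Qed.
Let BTh (I : finType) (v : res_free x I) : B (Th v) = B v.
Proof. by apply/ffunP => i; rewrite !ffunE bt_th. Qed.
Let ThB (I : finType) (v : res_free x I) : Th (B v) = B v.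
Proof. by apply/ffunP => i; rewrite !ffunE th_bt. Qed.
Let BTa (I : finType) (v : res_free x I) : B (Ta v) = 0.
Proof. by apply/ffunP => i; rewrite !ffunE bt_ta. Qed.
Let ThTa (I : finType) (v : res_free x I) : Th (Ta v) = Ta v.
Proof. by apply/ffunP => i; rewrite !ffunE /= thta. Qed.
Let TaTa (I : finType) (v : res_free x I) : Ta (Ta v) = Ta v.
Proof. by apply/ffunP => i; rewrite !ffunE /= tata. Qed.
Let Tab (I : finType) (v : res_free x I) : Ta (amul b v) = 0.
Proof. by apply/ffunP => i; rewrite !ffunE rmorphM /= ta_b mul0r. Qed.
Let Tha (I : finType) (v : res_free x I) : Th (amul a v) = amul a (Th v).
Proof. by apply/ffunP => i; rewrite !ffunE rmorphM /= th_a. Qed.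
Let Thd0 v : Th (d0 v) = d0 (Th v).
Proof. by apply: cw_res_mx => t s; apply: th_X0. Qed.
Let Thd1 v : Th (d1 v) = d1 (Th v).
Proof. by apply: cw_res_mx => t s; apply: th_X1. Qed.
Let Tad0 v : Ta (d0 v) = d0' (Ta v).
Proof. by apply: cw_res_mx. Qed.
Let Tad1 v : Ta (d1 v) = d1' (Ta v).
Proof. by apply: cw_res_mx. Qed.
Let Tad0' v : Ta (d0' v) = d0' (Ta v).
Proof. by apply: cw_res_mx => t s; apply: tata. Qed.
Let Tad1' v : Ta (d1' v) = d1' (Ta v).
Proof. by apply: cw_res_mx => t s; apply: tata. Qed.

Let amulN (I : finType) p (v : res_free x I) : amul p (- v) = - amul p v.
Proof. by apply/ffunP => i; rewrite !ffunE mulrN. Qed.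

Let dd (I J : finType) (D0 : J -> I -> {mpoly rat[N]}) (D1 : I -> J -> {mpoly rat[N]}) p
    (v : res_free x I) :
  (forall s s', \sum_t D1 s t * D0 t s' = p *+ (s == s')) ->
  res_mx D1 (res_mx D0 v) = amul p v.
Proof.
move=> h; apply/ffunP => s; rewrite !ffunE.
transitivity (\sum_s' (\sum_t D1 s t * D0 t s') * v s').
  under eq_bigr do rewrite ffunE mulr_sumr.
  rewrite exchange_big; apply: eq_bigr => s' _ /=.
  by rewrite mulr_suml; apply: eq_bigr => t _; rewrite mulrA.
under eq_bigr do rewrite h.
exact: sum_deltal.
Qed.

Let amul0 (I : finType) p : amul p 0 = 0 :> res_free x I.
Proof. by apply/ffunP => i; rewrite !ffunE mulr0. Qed.

Let d1d0 v : d1 (d0 v) = amul (pincl x om - a * b) v.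
Proof. exact: dd X_pot.1. Qed.
Let d0d1 v : d0 (d1 v) = amul (pincl x om - a * b) v.
Proof. exact: dd X_pot.2. Qed.

(** The potential [om] comes from the base ring, so it passes through [B], and [B] kills [Ta v];
    only the term [a * b] contributes. This identity makes [g] compatible with the differentials. *)
Let B_pot (I : finType) (v : res_free x I) : B (amul (pincl x om - a * b) (Ta v)) = - amul a (Ta v).
Proof.
have -> : amul (pincl x om - a * b) (Ta v) = om *: Ta v - amul b (amul a (Ta v)).
  by apply/ffunP => i; rewrite !ffunE mulrBl [a * b]mulrC mulrA.
by rewrite BB -[om *: _]addr0 B_lin BTa scaler0 B0 add0r Bb Tha ThTa sub0r.
Qed.

Let Tad0E v : d0' (Ta v) = d0 (Ta v) - amul b (B (d0 (Ta v))).
Proof. by rewrite bB Thd0 ThTa opprB addrC subrK Tad0 TaTa. Qed.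
Let Tad1E v : d1' (Ta v) = d1 (Ta v) - amul b (B (d1 (Ta v))).
Proof. by rewrite bB Thd1 ThTa opprB addrC subrK Tad1 TaTa. Qed.

(** [B] fails to commute with [d0] exactly by the correction term of [g], so this is in substance
    the homotopy identity. *)
Let Bd0Ta v : B (d0 (Ta v)) = B (d0 v) - d0 (B v).
Proof.
have -> : Ta v = Th v - amul b (B v) by rewrite bB opprB addrC subrK.
by rewrite d0B -Thd0 BB BTh d0b Bb Thd0 ThB.
Qed.
Let Bd1Ta v : B (d1 (Ta v)) = B (d1 v) - d1 (B v).
Proof.
have -> : Ta v = Th v - amul b (B v) by rewrite bB opprB addrC subrK.
by rewrite d1B -Thd1 BB BTh d1b Bb Thd1 ThB.
Qed.

(** [f] projects to the even generator of the row and sets b = 0. In [g] the component on the odd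
    generator gets multiplied by [b] under the differential, so that [- B (d0 (Ta v))] corrects [d0]
    to its value at b = 0. *)
Let f0 (z : res_free x (unit * mgen0 X + unit * mgen1 X)%type) := Ta (pl z).
Let f1 (z : res_free x (unit * mgen0 X + unit * mgen1 X)%type) := Ta (pr z).
Let g0 (v : res_free x (mgen0 X)) := pk (Ta v) (- B (d0 (Ta v))).
Let g1 (v : res_free x (mgen1 X)) := pk (- B (d1 (Ta v))) (Ta v).
Let h0 (z : res_free x (unit * mgen0 X + unit * mgen1 X)%type) : res_free x (unit * mgen0 X + unit * mgen1 X)%type :=
  pk (B (pl z)) 0.
Let h1 (z : res_free x (unit * mgen0 X + unit * mgen1 X)%type) : res_free x (unit * mgen0 X + unit * mgen1 X)%type :=
  pk 0 (B (pr z)).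

Let f0_lin : linear f0. Proof. by move=> r u v; rewrite /f0 pl_linear Ta_lin. Qed.
Let f1_lin : linear f1. Proof. by move=> r u v; rewrite /f1 pr_linear Ta_lin. Qed.
Let g0_lin : linear g0.
Proof. by move=> r u v; rewrite /g0 Ta_lin /d0 linearP B_lin opprD -scalerN pk_linear. Qed.
Let g1_lin : linear g1.
Proof. by move=> r u v; rewrite /g1 Ta_lin /d1 linearP B_lin opprD -scalerN pk_linear. Qed.
Let h0_lin : linear h0.
Proof. by move=> r u v; rewrite /h0 pl_linear B_lin -pk_linear scaler0 addr0. Qed.
Let h1_lin : linear h1.
Proof. by move=> r u v; rewrite /h1 pr_linear B_lin -pk_linear scaler0 addr0. Qed.

Let f_fmor : exists f : fmor (restrict_to x w C) (restrict_to x w Y),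
  (forall z, fm0 f z = f0 z) /\ (forall z, fm1 f z = f1 z).
Proof.
unshelve eexists (FMor
   (fm0 := (mklin f0_lin : {linear fmod0 (restrict_to x w C) -> fmod0 (restrict_to x w Y)}))
   (fm1 := (mklin f1_lin : {linear fmod1 (restrict_to x w C) -> fmod1 (restrict_to x w Y)})) _ _ _ _).
- move=> e z h i; rewrite !ffunE; apply: ta_homog.
  by have := h (inl (tt, i)); rewrite /= add0r.
- move=> e z h i; rewrite !ffunE; apply: ta_homog.
  by have := h (inr (tt, i)); rewrite /= add0r.
- move=> z; rewrite [z]pkE /= /f0 /f1 (kosz_d0 d) pr_pk pl_pk TaD Tab addr0.
  exact: Tad0.
- move=> z; rewrite [z]pkE /= /f0 /f1 (kosz_d1 d) pr_pk pl_pk TaD Tab add0r.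
  exact: Tad1.
by [].
Qed.

Let g_fmor : exists g : fmor (restrict_to x w Y) (restrict_to x w C),
  (forall z, fm0 g z = g0 z) /\ (forall z, fm1 g z = g1 z).
Proof.
unshelve eexists (FMor
   (fm0 := (mklin g0_lin : {linear fmod0 (restrict_to x w Y) -> fmod0 (restrict_to x w C)}))
   (fm1 := (mklin g1_lin : {linear fmod1 (restrict_to x w Y) -> fmod1 (restrict_to x w C)})) _ _ _ _).
- move=> e v hv [[[] i]|[[] i]]; rewrite ffunE.
    by rewrite ffunE /= add0r; apply/ta_homog/hv.
  rewrite ffunE ffunE; apply: zhomogN.
  have hT : @gm_homog k (res_gmodule x w (@mgrad0 N X)) e (Ta v) by move=> j; rewrite ffunE; apply/ta_homog/hv.
  have hD := res_mx_homog X_good.1 hT; have := bt_homog (hD i); congr zhomog => /=.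
  by ring.
- move=> e v hv [[[] i]|[[] i]]; rewrite ffunE; last first.
    by rewrite ffunE /= add0r; apply/ta_homog/hv.
  rewrite ffunE ffunE; apply: zhomogN.
  have hT : @gm_homog k (res_gmodule x w (@mgrad1 N X)) e (Ta v) by move=> j; rewrite ffunE; apply/ta_homog/hv.
  have hD := res_mx_homog X_good.2 hT; have := bt_homog (hD i); congr zhomog => /=.
  by ring.
- move=> v; rewrite /= /g0 /g1 (kosz_d0 d) -/(d0' v) -/(d0 _) -/(d1 _) Tad0' Tad0E d1B d1b BB Bb.
  rewrite d1d0 B_pot Thd1 ThB d1N amulN !opprK opprB opprK.
  by rewrite addrC.
- move=> v; rewrite /= /g0 /g1 (kosz_d1 d) -/(d1' v) -/(d0 _) -/(d1 _) Tad1' Tad1E d0B d0b BB Bb.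
  rewrite d0d1 B_pot Thd0 ThB d0N amulN !opprK opprB opprK.
  by rewrite addrC [X in pk _ X]addrC.
by [].
Qed.

(** [f g] equals [Ta] exactly. [g f] differs from [Th] by the homotopy [h0], [h1], which applies [B]
    to the coordinate on the even generator of the row and places the result on the odd one. *)
Lemma elim_step : kequiv_on x x w w (mtens (kosz d a b) X) th (msubst ta X) ta.
Proof.
move=> e e' e0 e1 e0' e1'.
have [f [f0E f1E]] := f_fmor; have [g [g0E g1E]] := g_fmor.
exists f, g; split; last first.
  apply: homotopic_eq => v /=; rewrite ?e0' ?e1' ?f0E ?f1E ?g0E ?g1E.
    by rewrite /f0 /g0 pl_pk; apply: TaTa.
  by rewrite /f1 /g1 pr_pk; apply: TaTa.
apply: homotopic_sym; exists (mklin h0_lin), (mklin h1_lin).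
split=> z; rewrite [z]pkE /= ?e0 ?e1 ?f0E ?f1E ?g0E ?g1E /f0 /f1 /g0 /g1 /h0 /h1 ?(kosz_d0 d) ?(kosz_d1 d)
  cw_pk !pl_pk !pr_pk.
  rewrite !pkN !pkD -!/(Th _) -!/(d0 _) -!/(d1 _) TaTa d10 addr0 add0r amul0 sub0r bB.
  by rewrite BD Bb Bd0Ta opprK addrCA addrA.
rewrite !pkN !pkD -!/(Th _) -!/(d0 _) -!/(d1 _) TaTa d00 !add0r amul0 sub0r bB.
by rewrite BD Bb Bd1Ta opprK addrA.
Qed.

End EliminationStep.

(** * Sequences of Koszul rows *)

Section Rows.
Variable N : nat.
Implicit Types X Y Z K : mfact N.

(* (d, a, b) stands for K(a; b) with its odd generator in degree d. *)
Definition krow : Type := (int * {mpoly rat[N]} * {mpoly rat[N]})%type.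

Definition mrows (s : seq krow) (X : mfact N) : mfact N :=
  foldr (fun (r : krow) (Y : mfact N) => mtens (kosz r.1.1 r.1.2 r.2) Y) X s.

Definition rows_pot (s : seq krow) : {mpoly rat[N]} := \sum_(r <- s) r.1.2 * r.2.

Definition row_good (w : 'I_N -> nat) (c : int) (r : krow) : Prop :=
  zhomog w (c - r.1.1) r.1.2 /\ zhomog w (c + r.1.1) r.2.

Lemma mpot_mrows s X om : mpot X om -> mpot (mrows s X) (om + rows_pot s).
Proof.
move=> h; elim: s => [|r s ih]; first by rewrite /rows_pot big_nil addr0.
by rewrite /rows_pot big_cons addrCA addrC; apply: mpot_kosz.
Qed.

Lemma mgood_kosz w c d a b X : zhomog w (c - d) a -> zhomog w (c + d) b -> mgood w c X ->
  mgood w c (mtens (kosz d a b) X).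
Proof.
move=> ha hb [h0 h1]; split.
- case=> -[[] t] [[[] s]|[[] s]] /=; rewrite ?mulr1n.
  + case: eqP => [->|_]; last exact: zhomog0.
    by rewrite mulr1n; move: ha; congr zhomog; ring.
  + by apply/zhomogN; move: (h1 t s); congr zhomog; ring.
  + by move: (h0 t s); congr zhomog; ring.
  + case: eqP => [->|_]; last exact: zhomog0.
    by rewrite mulr1n; move: hb; congr zhomog; ring.
- case=> -[[] t] [[[] s]|[[] s]] /=; rewrite ?mulr1n.
  + case: eqP => [->|_]; last exact: zhomog0.
    by rewrite mulr1n; move: hb; congr zhomog; ring.
  + by move: (h1 t s); congr zhomog; ring.
  + by apply/zhomogN; move: (h0 t s); congr zhomog; ring.
  + case: eqP => [->|_]; last exact: zhomog0.
    by rewrite mulr1n; move: ha; congr zhomog; ring.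
Qed.

Lemma mgood_mrows w c s X : (forall r, r \in s -> row_good w c r) -> mgood w c X ->
  mgood w c (mrows s X).
Proof.
move=> hs hX; elim: s hs => [//|r s ih] hs.
have [ha hb] := hs r (mem_head _ _).
by apply: mgood_kosz => //; apply: ih => r' hr'; apply: hs; rewrite inE hr' orbT.
Qed.

Lemma mgood_munit w c : mgood w c (munit N).
Proof. by split=> -[] // [] []. Qed.

Lemma mrows_cat s t X : mrows (s ++ t) X = mrows s (mrows t X).
Proof. by rewrite /mrows foldr_cat. Qed.

Lemma mrows_rel s X Y : mrel X Y -> mrel (mrows s X) (mrows s Y).
Proof. by move=> h; elim: s => //= r s ih; apply: mtens_relr. Qed.

Lemma mrows_mtens s X Y : mrel (mtens (mrows s X) Y) (mrows s (mtens X Y)).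
Proof.
elim: s => [|r s ih]; first exact: mrel_refl.
by apply: mrel_trans (mtens_kosz_assoc _ _ _ _ _) _; apply: mtens_relr.
Qed.

(** Each row contributes one flip and one shift, and both can be pulled out of the tensor product
    with the rows before it. *)
Lemma mrows_swap s X :
  mrel (mrows s X) (iter (size s) (@mflip N)
    (mshift (mrows [seq (- r.1.1, r.2, r.1.2) | r <- s] X) (\sum_(r <- s) r.1.1))).
Proof.
elim: s => [|r s ih].
  rewrite big_nil /=; exists id, id, (fun=> false), (fun=> false); split.
  - by split; exists id.
  - by move=> i; rewrite /= addr0.
  - by move=> i; rewrite /= addr0.
  - by move=> t i; rewrite /= !mul1r.
  - by move=> t i; rewrite /= !mul1r.
rewrite big_cons /=; apply: mrel_trans (mtens_kosz_flip _ _ _ _) _.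
apply: mflip_rel; apply: mrel_trans (mshift_rel _ (mtens_relr _ ih)) _.
have flips m Z K : mrel (mtens K (iter m (@mflip N) Z)) (iter m (@mflip N) (mtens K Z)).
  elim: m => [|m ihm] /=; first exact: mrel_refl.
  by apply: mrel_trans (mtens_flip _ _) (mflip_rel ihm).
have shifts m Z d : mrel (mshift (iter m (@mflip N) Z) d) (iter m (@mflip N) (mshift Z d)).
  elim: m => [|m ihm] /=; first exact: mrel_refl.
  exact: (mflip_rel ihm).
apply: mrel_trans (mshift_rel _ (flips _ _ _)) _.
apply: mrel_trans (shifts _ _ _) _; apply: iter_flip_rel.
apply: mrel_trans (mshift_rel _ (mtens_shift _ _ _)) _.
by rewrite addrC; apply: mshift_shift.
Qed.

End Rows.

Section Substitute.
Variables N N' : nat.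

Definition rsubst (f : {mpoly rat[N]} -> {mpoly rat[N']}) (r : krow N) : krow N' :=
  (r.1.1, f r.1.2, f r.2).

Lemma eq_msubst (f g : {mpoly rat[N]} -> {mpoly rat[N']}) X : f =1 g -> msubst f X = msubst g X.
Proof. by move=> fg; rewrite (functional_extensionality f g). Qed.

Lemma msubst_mtens (f : {additive {mpoly rat[N]} -> {mpoly rat[N']}}) X Y :
  msubst f (mtens X Y) = mtens (msubst f X) (msubst f Y).
Proof.
rewrite /msubst /mtens /=; congr MFact.
  apply: functional_extensionality => -[[t1 t2]|[t1 t2]];
  by apply: functional_extensionality => -[[s1 s2]|[s1 s2]]; rewrite raddfMn ?raddfN.
apply: functional_extensionality => -[[t1 t2]|[t1 t2]];
by apply: functional_extensionality => -[[s1 s2]|[s1 s2]]; rewrite raddfMn ?raddfN.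
Qed.

Lemma msubst_mrows (f : {additive {mpoly rat[N]} -> {mpoly rat[N']}}) s X :
  msubst f (mrows s X) = mrows [seq rsubst f r | r <- s] (msubst f X).
Proof. by elim: s => //= r s ih; rewrite msubst_mtens ih. Qed.

Lemma msubst_comp N'' (f : {mpoly rat[N]} -> {mpoly rat[N']}) (g : {mpoly rat[N']} -> {mpoly rat[N'']}) X :
  msubst g (msubst f X) = msubst (g \o f) X.
Proof. by []. Qed.

Lemma mgood_msubst w w' c (f : {mpoly rat[N]} -> {mpoly rat[N']}) X :
  (forall d p, zhomog w d p -> zhomog w' d (f p)) -> mgood w c X -> mgood w' c (msubst f X).
Proof. by move=> hf [h0 h1]; split=> t s; apply: hf; [apply: h0 | apply: h1]. Qed.

Lemma mpot_msubst (f : {rmorphism {mpoly rat[N]} -> {mpoly rat[N']}}) X om :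
  mpot X om -> mpot (msubst f X) (f om).
Proof.
case=> h0 h1; split=> s s'.
  transitivity (f (om *+ (s == s'))); last by rewrite rmorphMn.
  by rewrite -h0 rmorph_sum; apply: eq_bigr => t _; rewrite rmorphM.
transitivity (f (om *+ (s == s'))); last by rewrite rmorphMn.
by rewrite -h1 rmorph_sum; apply: eq_bigr => t _; rewrite rmorphM.
Qed.

End Substitute.

Lemma msubst_id N (f : {mpoly rat[N]} -> {mpoly rat[N]}) X : f =1 id -> msubst f X = X.
Proof. by move=> h; rewrite (eq_msubst _ h); case: X. Qed.

Lemma cwK k N (x : 'I_k -> 'I_N) I (f : {mpoly rat[N]} -> {mpoly rat[N]}) (v : res_free x I) :
  (forall p, f (f p) = f p) -> cw x f (cw x f v) = cw x f v.
Proof. by move=> h; apply/ffunP => i; rewrite !ffunE h. Qed.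

Definition substitutes k N (x : 'I_k -> 'I_N) w (Z : mfact N) (f : {rmorphism {mpoly rat[N]} -> {mpoly rat[N]}}) :
  Prop :=
  [/\ forall r, f (pincl x r) = pincl x r,
      forall d p, zhomog w d p -> zhomog w d (f p),
      forall p, f (f p) = f p,
      forall t s, f (@md0 N Z t s) = md0 t s & forall t s, f (@md1 N Z t s) = md1 t s].

Lemma kequiv_on_trans k N N' (x : 'I_k -> 'I_N) (x' : 'I_k -> 'I_N') w w'
    (Z Z' : mfact N) (Z'' : mfact N') (f f' : {rmorphism {mpoly rat[N]} -> {mpoly rat[N]}}) f'' :
  substitutes x w Z f -> substitutes x w Z' f' -> (forall p, f'' (f'' p) = f'' p) ->
  kequiv_on x x w w Z f Z' f' -> kequiv_on x x' w w' Z' f' Z'' f'' ->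
  kequiv_on x x' w w' Z f Z'' f''.
Proof.
case=> [_ _ ff _ _] [b' h' _ m0 m1] ff'' k1 k2 e e'' e0 e1 e0'' e1''.
have [e' [e0' e1']] := fmor_fixed b' h' m0 m1.
apply: (kequiv_trans (e' := e')).
- by apply: homotopic_eq => u /=; rewrite ?e0 ?e1 cwK.
- by apply: homotopic_eq => u /=; rewrite ?e0'' ?e1'' cwK.
- exact: k1.
- exact: k2.
Qed.

Lemma kequiv_on_refl k N (x : 'I_k -> 'I_N) w (Z : mfact N) f :
  (forall p, f (f p) = f p) -> kequiv_on x x w w Z f Z f.
Proof.
move=> ff e e' e0 e1 e0' e1'.
by exists e, e; split; apply: homotopic_eq => u /=; rewrite ?e0 ?e1 ?e0' ?e1' cwK.
Qed.

Section Elimination.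
Variables (k N N' m : nat) (x' : 'I_k -> 'I_N') (x : 'I_k -> 'I_N).
Variables (w : 'I_N -> nat) (w' : 'I_N' -> nat) (c : int).
Variables (io : 'I_N' -> 'I_N) (z : 'I_m -> 'I_N) (cs : 'I_N -> 'I_N' + 'I_m).
Hypothesis cs_io : forall t, cs (io t) = inl t.
Hypothesis cs_z : forall l, cs (z l) = inr l.
Hypothesis csK : forall i, match cs i with inl t => io t = i | inr l => z l = i end.
Variable v : 'I_m -> {mpoly rat[N']}.
Hypothesis x_io : forall i, x i = io (x' i).
Hypothesis w_io : forall t, w (io t) = w' t.
Hypothesis v_homog : forall l, zhomog w' (w (z l)) (v l).

Definition retraction (i : 'I_N) : {mpoly rat[N']} :=
  match cs i with inl t => 'X_t | inr l => v l end.
Let retract := psub retraction.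
Let sec : {mpoly rat[N']} -> {mpoly rat[N]} := psub (fun t => 'X_(io t)).
(** [th j] substitutes for the first [j] eliminated variables. It is idempotent because every [v l]
    is a polynomial in the retained variables, and [th m] is [retract] followed by [sec]. *)
Let G (j : nat) (i : 'I_N) : {mpoly rat[N]} :=
  match cs i with inl t => 'X_i | inr l => if (l < j)%N then sec (v l) else 'X_i end.
Let th (j : nat) := psub (G j).

Let th_sec j p : th j (sec p) = sec p.
Proof.
rewrite /th /sec psub_comp; apply: eq_psub => t.
by rewrite psubX /G cs_io.
Qed.

Let th_th i j p : th i (th j p) = th (maxn i j) p.
Proof.
rewrite /th psub_comp; apply: eq_psub => l; rewrite {2 3}/G.
case E: (cs l) => [t|t]; first by rewrite psubX /G E.
rewrite leq_max; case: (ltnP t j) => _; first by rewrite orbT; apply: th_sec.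
by rewrite orbF psubX /G E.
Qed.

Let thl i j p : (i <= j)%N -> th j (th i p) = th j p.
Proof. by move=> ij; rewrite th_th (maxn_idPl ij). Qed.

Let thr i j p : (i <= j)%N -> th i (th j p) = th j p.
Proof. by move=> ij; rewrite th_th (maxn_idPr ij). Qed.

Let th0 p : th 0 p = p.
Proof.
rewrite -[RHS]psub_id; apply: eq_psub => l; rewrite /G.
by case: (cs l).
Qed.

Let thm p : th m p = sec (retract p).
Proof.
rewrite /th /sec /retract psub_comp; apply: eq_psub => l; rewrite /retraction /G.
have := csK l; case: (cs l) => [t <-|t _]; first by rewrite psubX.
by rewrite ltn_ord.
Qed.

Let retract_sec p : retract (sec p) = p.
Proof.
rewrite /retract /sec psub_comp -[RHS]psub_id; apply: eq_psub => t.
by rewrite psubX /retraction cs_io.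
Qed.

Let th_base j r : th j (pincl x r) = pincl x r.
Proof.
rewrite /th psub_pincl pinclE; apply: eq_psub => i.
by rewrite /pvar x_io /G cs_io.
Qed.

Let sec_base r : sec (pincl x' r) = pincl x r.
Proof. by rewrite /sec psub_pincl pinclE; apply: eq_psub => i; rewrite /pvar x_io. Qed.

Let retract_base r : retract (pincl x r) = pincl x' r.
Proof. by rewrite /retract psub_pincl pinclE; apply: eq_psub => i; rewrite /retraction x_io cs_io. Qed.

Let sec_homog d p : zhomog w' d p -> zhomog w d (sec p).
Proof. by apply: zhomog_psub => t; rewrite -w_io; apply: zhomogX. Qed.

Let retract_homog d p : zhomog w d p -> zhomog w' d (retract p).
Proof.
apply: zhomog_psub => i; rewrite /retraction; have := csK i; case: (cs i) => [t <-|t <-] //.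
by rewrite w_io; apply: zhomogX.
Qed.

Let th_homog j d p : zhomog w d p -> zhomog w d (th j p).
Proof.
apply: zhomog_psub => i; rewrite /G; have := csK i.
case: (cs i) => [t <-|t <-]; first exact: zhomogX.
by case: ifP => _; [apply/sec_homog/v_homog | apply: zhomogX].
Qed.

Variables (rows : seq (krow N)) (X : mfact N) (omX : {mpoly rat[N]}) (om : {mpoly rat[k]}) (s0 : rat).
Hypothesis s0_neq0 : s0 != 0.
Hypothesis size_rows : size rows = m.
Hypothesis rowsP : forall j : 'I_m,
  psub (fun i => match cs i with
    | inl t => 'X_i
    | inr l => if (l < j)%N then psub (fun t => 'X_(io t)) (v l) else 'X_i end)
    (nth (0, 0, 0) rows j).2 = s0 *: ('X_(z j) - psub (fun t => 'X_(io t)) (v j)).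
Hypothesis rows_good : forall r, r \in rows -> row_good w c r.
Hypothesis X_good : mgood w c X.
Hypothesis X_pot : mpot X omX.
Hypothesis om_rows : omX + rows_pot rows = pincl x om.

Let r_ (j : nat) := nth (0, 0, 0) rows j.

Let row_b (j : 'I_m) : th j (r_ j).2 = s0 *: ('X_(z j) - sec (v j)).
Proof. exact: rowsP. Qed.

Let row_b0 i j : (i < j)%N -> (j <= m)%N -> th j (r_ i).2 = 0.
Proof.
move=> ij jm; have im := leq_trans ij jm.
have := th_th j i (r_ i).2; rewrite (maxn_idPl (ltnW ij)) => <-.
rewrite (row_b (Ordinal im)) /th psubZ rmorphB /= psubX -/(th j _) th_sec.
by rewrite /G cs_z ij subrr scaler0.
Qed.

Let kequiv_from j : (j <= m)%N ->
  kequiv_on x x w w (msubst (th j) (mrows (drop j rows) X)) (th j) (msubst (th m) X) (th m).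
Proof.
have subm (Z : mfact N) jj : substitutes x w (msubst (th jj) Z) (th jj).
  split; [exact: th_base | exact: th_homog | | |] => *;
  exact: thr.
have [q jE] : exists q, (m - j)%N = q by exists (m - j)%N.
elim: q j jE => [|q ih] j jE jm.
  have -> : j = m by lia.
  rewrite drop_oversize ?size_rows //=; apply: kequiv_on_refl => p.
  exact: thr.
have jm' : (j < m)%N by lia.
have jr : (j < size rows)%N by rewrite size_rows.
apply: (kequiv_on_trans (subm _ _) (subm (mrows (drop j.+1 rows) X) j.+1)); last first.
- by apply: ih => //; lia.
2: by move=> p; apply: thr.
rewrite (drop_nth (0, 0, 0) jr) -/(r_ j) /= msubst_mtens.
rewrite -[msubst (th j) (kosz _ _ _)]/(kosz (r_ j).1.1 (th j (r_ j).1.2) (th j (r_ j).2)).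
have <- : msubst (th j.+1) (msubst (th j) (mrows (drop j.+1 rows) X)) = msubst (th j.+1) (mrows (drop j.+1 rows) X).
  by rewrite msubst_comp; apply: eq_msubst => p; apply: thl.
have [ga gb] : row_good w c (r_ j) by apply/rows_good/mem_nth.
have jE' : (Ordinal jm' : nat) = j by [].
have bE := row_b (Ordinal jm').
apply: (elim_step (om := om) (c := c)).
- exact: th_base.
- exact: th_base.
- exact: th_homog.
- exact: th_homog.
- by move=> p; apply: thr.
- by move=> p; apply: thl.
- by move=> p; apply: thr.
- by move=> p; apply: thr.
- rewrite bE scaler_eq0 (negbTE s0_neq0) /=.
  (* The entry is nonzero: since [sec (v j)] does not involve [z j], the substitution of
     [sec (v j) + 1] for [z j] turns the difference into 1. *)
  pose h (i : 'I_N) : {mpoly rat[N]} :=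
    if i == z (Ordinal jm') then sec (v (Ordinal jm')) + 1 else 'X_i.
  apply/eqP => /(congr1 (psub h)); rewrite rmorph0 rmorphB /= psubX {1}/h eqxx.
  have -> : psub h (sec (v (Ordinal jm'))) = sec (v (Ordinal jm')).
    rewrite /sec psub_comp; apply: eq_psub => t; rewrite psubX /h.
    by case: eqP => // E; have := cs_io t; rewrite E cs_z.
  by rewrite addrAC subrr add0r => /eqP; rewrite oner_eq0.
- exact: thr.
- by apply: etrans (thl _ _) _ => //; apply: row_b0.
- exact: thr.
- move=> p; rewrite -/(r_ j).
  have jj1 : (j <= j.+1)%N by [].
  have [u uE] : exists u, u * ('X_(z (Ordinal jm')) - sec (v (Ordinal jm'))) = th j p - th j.+1 p.
    apply: psub_dvd => i; rewrite /G; have := csK i; case: (cs i) => [t _|l zl].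
      by exists 0; rewrite mul0r subrr.
    rewrite ltnS; case: (ltnP l j) => lj.
      by rewrite (ltnW lj); exists 0; rewrite mul0r subrr.
    case: (leqP l j) => lj'; last by exists 0; rewrite mul0r subrr.
    have <- : l = Ordinal jm' by apply: val_inj => /=; lia.
    by exists 1; rewrite mul1r zl.
  exists (s0^-1 *: u).
  by rewrite bE -scalerAl -scalerAr scalerA mulVf // scale1r.
- by apply: th_homog.
- move=> t s; apply: thr; lia.
- move=> t s; apply: thr; lia.
- apply: mgood_msubst; first exact: th_homog.
  by apply: mgood_mrows => // r /mem_drop; apply: rows_good.
- have := mpot_msubst (psub (G j)) (mpot_mrows (drop j.+1 rows) X_pot); congr mpot.
  (* The rows already used vanish under [th j], so the row [j] and those after it, with [X], still
     have the base potential [om] in total. *)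
  have take0 : th j (\sum_(r <- take j rows) r.1.2 * r.2) = 0.
    rewrite /th rmorph_sum big_seq; apply: big1 => r /(nthP (0, 0, 0)) [i].
    rewrite size_take jr => ij <-; rewrite nth_take // rmorphM /= -/(th j _) -/(th j _) -/(r_ i).
    by rewrite (row_b0 ij) ?mulr0 // ltnW.
  have := congr1 (th j) om_rows; rewrite th_base => <-.
  rewrite -{2}(cat_take_drop j rows) (drop_nth (0, 0, 0) jr) /rows_pot big_cat big_cons /= -/(r_ j).
  rewrite /th in take0 *; rewrite !rmorphD /= take0 add0r rmorphM /=.
  by rewrite [_ * _ + _]addrC addrA addrK.
Qed.

(** A row needs the shape [s0 (z_j - v_j)] only after the substitutions for the earlier variables,
    which admits triangular systems. [kequiv_from] removes the rows inside the large ring; the last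
    step identifies the image of [th m] with the small ring through [retract] and [sec]. *)
Lemma elim_hequiv : hequiv (restrict_to x w (mrows rows X)) (restrict_to x' w' (msubst (psub retraction) X)).
Proof.
have k1 := kequiv_from (leq0n m); rewrite drop0 msubst_id // in k1.
have k2 : kequiv_on x x' w w' (msubst (th m) X) (th m) (msubst retract X) id.
  move=> e e' e0 e1 e0' e1'.
  have rt p : retract (th m p) = retract p by rewrite thm retract_sec.
  have [f [f0 f1]] := fmor_msubst X rt retract_base retract_homog.
  have st p : sec (retract p) = th m p by rewrite thm.
  have [g [g0 g1]] := fmor_msubst X st sec_base sec_homog.
  exists f, g; split; apply: homotopic_eq => u /=; apply/ffunP => i;
  rewrite ?f0 ?f1 ?g0 ?g1 ?e0 ?e1 ?e0' ?e1' !ffunE.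
  - exact: st.
  - exact: st.
  - exact: retract_sec.
  - exact: retract_sec.
have := kequiv_on_trans _ _ _ k1 k2; apply.
- split => //; first exact: th_base; first exact: th_homog; try by move=> *; apply: th0.
- split; [exact: th_base | exact: th_homog | | |] => *; exact: thr.
- by [].
- by move=> u; apply/ffunP => i; rewrite ffunE; apply/esym/th0.
- by move=> u; apply/ffunP => i; rewrite ffunE; apply/esym/th0.
- by move=> u; apply/ffunP => i; rewrite ffunE.
- by move=> u; apply/ffunP => i; rewrite ffunE.
Qed.

End Elimination.

(* A = {mpoly rat[N]} is a free module over P = {mpoly rat[N1]}, acting through
   psub g, on the homogeneous basis vb. *)
Definition homog_basis N N1 (w : 'I_N -> nat) (w1 : 'I_N1 -> nat) (g : 'I_N1 -> {mpoly rat[N]})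
    (J : finType) (e : J -> int) (vb : J -> {mpoly rat[N]}) : Prop :=
  [/\ forall i, zhomog w (w1 i) (g i),
      forall j, zhomog w (e j) (vb j),
      forall a, exists c : J -> {mpoly rat[N1]}, a = \sum_j psub g (c j) * vb j,
      forall c : J -> {mpoly rat[N1]}, \sum_j psub g (c j) * vb j = 0 -> forall j, c j = 0
    & forall d a, zhomog w d a -> exists c : J -> {mpoly rat[N1]},
        a = \sum_j psub g (c j) * vb j /\ forall j, zhomog w1 (d - e j) (c j)].

(** * Change of rings along a free extension *)

Section FreeExtension.
Variables (k N N1 : nat) (x : 'I_k -> 'I_N) (x1 : 'I_k -> 'I_N1).
Variables (w : 'I_N -> nat) (w1 : 'I_N1 -> nat) (g : 'I_N1 -> {mpoly rat[N]}).
Variables (J : finType) (e : J -> int) (vb : J -> {mpoly rat[N]}).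
Hypothesis basis : homog_basis w w1 g e vb.
Hypothesis base_g : forall r, psub g (pincl x1 r) = pincl x r.

Let g_homog i : zhomog w (w1 i) (g i). Proof. by case: basis. Qed.
Let vb_homog j : zhomog w (e j) (vb j). Proof. by case: basis. Qed.

Let co (a : {mpoly rat[N]}) : J -> {mpoly rat[N1]} :=
  ClassicalEpsilon.epsilon (inhabits (fun=> 0)) (fun c => a = \sum_j psub g (c j) * vb j).
Let coE a : \sum_j psub g (co a j) * vb j = a.
Proof.
case: basis => _ _ h _ _.
exact/esym/(ClassicalEpsilon.epsilon_spec (inhabits (fun=> 0)) (fun c => a = \sum_j psub g (c j) * vb j)).
Qed.
Let co_uniq a c : a = \sum_j psub g (c j) * vb j -> forall j, co a j = c j.
Proof.
case: basis => _ _ _ h _ aE j; apply/eqP; rewrite -subr_eq0; apply/eqP.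
apply: (h (fun j => co a j - c j)).
under eq_bigr do rewrite rmorphB mulrBl.
by rewrite sumrB coE -aE subrr.
Qed.
Let co_homog d a j : zhomog w d a -> zhomog w1 (d - e j) (co a j).
Proof.
case: basis => _ _ _ _ h /h [c [aE hc]].
by rewrite (co_uniq aE).
Qed.

Variable Z : mfact N1.

Let split_map (I : finType) (v : res_free x I) : res_free x1 (J * I)%type := [ffun t => co (v t.2) t.1].
Let join_map (I : finType) (u : res_free x1 (J * I)%type) : res_free x I :=
  [ffun i => \sum_j psub g (u (j, i)) * vb j].

Let join_lin (I : finType) : linear (@join_map I).
Proof.
move=> a u v; apply/ffunP => i; rewrite !ffunE mulr_sumr -big_split; apply: eq_bigr => j _ /=.
by rewrite !ffunE rmorphD rmorphM /= base_g mulrDl mulrA.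
Qed.

Let joinK (I : finType) (u : res_free x1 (J * I)%type) : split_map (join_map u) = u.
Proof.
apply/ffunP => -[j i]; rewrite !ffunE /=.
by rewrite (co_uniq (c := fun j => u (j, i))).
Qed.

Let splitK (I : finType) (v : res_free x I) : join_map (split_map v) = v.
Proof.
apply/ffunP => i; rewrite !ffunE -[RHS]coE.
by apply: eq_bigr => j _; rewrite ffunE.
Qed.

Let split_lin (I : finType) : linear (@split_map I).
Proof. by move=> a u v; rewrite -{1}[u]splitK -{1}[v]splitK -join_lin joinK. Qed.

Let join_homog (I : finType) (gr : I -> int) (d : int) (u : res_free x1 (J * I)%type) :
  (forall t : J * I, zhomog w1 (d - (e t.1 + gr t.2)) (u t)) ->
  forall i, zhomog w (d - gr i) (@join_map I u i).
Proof.
move=> hu i; rewrite ffunE; apply: zhomog_sum => j _.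
have := zhomogM (zhomog_psub g_homog (hu (j, i))) (@vb_homog j); congr zhomog => /=.
by ring.
Qed.

Let split_homog (I : finType) (gr : I -> int) (d : int) (v : res_free x I) :
  (forall i, zhomog w (d - gr i) (v i)) ->
  forall t : J * I, zhomog w1 (d - (e t.1 + gr t.2)) (@split_map I v t).
Proof.
move=> hv [j i]; rewrite ffunE /=; have := @co_homog _ _ j (hv i); congr zhomog.
by ring.
Qed.

Let join_mx (I I' : finType) (D : I' -> I -> {mpoly rat[N1]}) (u : res_free x1 (J * I)%type) :
  join_map (res_mx (fun (t : J * I') (s : J * I) => D t.2 s.2 *+ (t.1 == s.1)) u) =
  res_mx (fun t s => psub g (D t s)) (join_map u).
Proof.
apply/ffunP => t; rewrite !ffunE.
transitivity (\sum_j \sum_s psub g (D t s) * psub g (u (j, s)) * vb j).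
  apply: eq_bigr => j _; rewrite -mulr_suml; congr (_ * _).
  have /ffunP/(_ t) := slice_res_mx D j u; rewrite !ffunE => ->.
  by rewrite rmorph_sum; apply: eq_bigr => s _; rewrite ffunE rmorphM.
rewrite exchange_big; apply: eq_bigr => s _ /=; rewrite ffunE mulr_sumr.
by apply: eq_bigr => j _; rewrite mulrA.
Qed.

(** Coordinates in the basis [vb] identify the larger ring with a sum of shifted copies of the
    smaller one. Matrix entries from the smaller ring act on each copy separately, so the
    differentials become block diagonal. *)
Lemma free_extension :
  hequiv (restrict_to x w (msubst (psub g) Z)) (restrict_to x1 w1 (msumI e Z)).
Proof.
have [g0 g1] : exists f : fmor (restrict_to x1 w1 (msumI e Z)) (restrict_to x w (msubst (psub g) Z)),
    (forall v, fm0 f v = join_map v) /\ (forall v, fm1 f v = join_map v).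
  unshelve eexists (FMor
   (fm0 := (mklin (@join_lin (mgen0 Z)) : {linear fmod0 (restrict_to x1 w1 (msumI e Z)) -> fmod0 (restrict_to x w (msubst (psub g) Z))}))
   (fm1 := (mklin (@join_lin (mgen1 Z)) : {linear fmod1 (restrict_to x1 w1 (msumI e Z)) -> fmod1 (restrict_to x w (msubst (psub g) Z))})) _ _ _ _).
  - by move=> d v h; apply: join_homog.
  - by move=> d v h; apply: join_homog.
  - by move=> v; apply: join_mx.
  - by move=> v; apply: join_mx.
  by [].
case: g1 => g00 g01.
have [f0 f1] : exists f : fmor (restrict_to x w (msubst (psub g) Z)) (restrict_to x1 w1 (msumI e Z)),
    (forall v, fm0 f v = split_map v) /\ (forall v, fm1 f v = split_map v).
  unshelve eexists (FMor
   (fm0 := (mklin (@split_lin (mgen0 Z)) : {linear fmod0 (restrict_to x w (msubst (psub g) Z)) -> fmod0 (restrict_to x1 w1 (msumI e Z))}))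
   (fm1 := (mklin (@split_lin (mgen1 Z)) : {linear fmod1 (restrict_to x w (msubst (psub g) Z)) -> fmod1 (restrict_to x1 w1 (msumI e Z))})) _ _ _ _).
  - by move=> d v h; apply: split_homog.
  - by move=> d v h; apply: split_homog.
  - by move=> v; rewrite /= -[v in LHS]splitK -join_mx joinK.
  - by move=> v; rewrite /= -[v in LHS]splitK -join_mx joinK.
  by [].
case: f1 => f10 f11.
apply: (hequiv_iso (f := f0) (g := g0)) => v.
- by rewrite f10 g00 splitK.
- by rewrite f11 g01 splitK.
- by rewrite g00 f10 joinK.
- by rewrite g01 f11 joinK.
Qed.

End FreeExtension.

(** * Power sums and Koszul rows *)

Section Series.
Variable R : comNzRingType.
Implicit Types (E G H : {poly R}).

Definition eser r (u : 'I_r -> R) : {poly R} :=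
  1 + \sum_(j < r) ((-1) ^+ j.+1 * u j) *: 'X^(j.+1).

(* The inverse of E modulo 'X^M, for E with constant term 1. *)
Definition sinv (M : nat) E : {poly R} := \sum_(l < M) (1 - E) ^+ l.

(** Congruence modulo ['X^M]. Power series are represented by polynomials, so inverses exist only up
    to this relation. *)
Definition eqX (M : nat) (p q : {poly R}) : Prop := exists s, p - q = 'X^M * s.

Lemma eqX_coef M p q i : eqX M p q -> (i < M)%N -> p`_i = q`_i.
Proof.
case=> s h iM; apply/eqP; rewrite -subr_eq0 -coefB h coefXnM iM.
by rewrite eqxx.
Qed.

Lemma X_dvd (p : {poly R}) : p`_0 = 0 -> exists q, p = 'X * q.
Proof.
move=> p0; exists (drop_poly 1 p); rewrite mulrC -[LHS](poly_take_drop 1).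
rewrite (_ : take_poly 1 p = 0) ?add0r ?expr1 //.
by apply/polyP => i; rewrite coef_take_poly coef0; case: i.
Qed.

(** [E] times the geometric sum is [1 - (1 - E) ^+ M], and [1 - E] is divisible by ['X]. *)
Lemma sinvP M E : E`_0 = 1 -> eqX M (E * sinv M E) 1.
Proof.
move=> E0; have [q qE] : exists q, 1 - E = 'X * q.
  by apply: X_dvd; rewrite coefB coef1 eqxx E0 subrr.
exists (- q ^+ M).
have := subrX1 (1 - E) M; rewrite -/(sinv M E) qE exprMn => h.
have -> : 'X^M * - q ^+ M = - (1 + ('X * q - 1) * sinv M E) by rewrite -h; ring.
set H := sinv M E; have -> : E = 1 - 'X * q by rewrite -qE opprB addrC subrK.
by ring.
Qed.

Lemma sinv_coef0 M E : E`_0 = 1 -> (0 < M)%N -> (sinv M E)`_0 = 1.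
Proof.
move=> E0 M0; have := eqX_coef (sinvP M E0) M0.
by rewrite coefM big_ord1 E0 mul1r coef1.
Qed.

(* Newton's identities: for E the product of the 1 - t_i X, this is the sum of the
   t_i ^+ n.+1. *)
Definition psum (n : nat) E : R := - ('X * E^`() * sinv n.+2 E)`_n.+1.

(** Only the coefficient of index [n.+1] is read, and two inverses agree modulo ['X^(n.+2)]. *)
Lemma psumE n E G : E`_0 = 1 -> eqX n.+2 (E * G) 1 -> psum n E = - ('X * E^`() * G)`_n.+1.
Proof.
move=> E0 [s hs]; have [q hq] := sinvP n.+2 E0; congr (- _); apply: (@eqX_coef n.+2) => //.
set H := sinv _ _ in hq *; exists ('X * E^`() * (G * q - H * s)).
have -> : 'X * E^`() * H - 'X * E^`() * G =
  'X * E^`() * (G * (E * H - 1) - H * (E * G - 1)) by ring.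
by rewrite hs hq; ring.
Qed.

(** [psum] is a coefficient of a logarithmic derivative, which turns products into sums. *)
Lemma psumM n E1 E2 : E1`_0 = 1 -> E2`_0 = 1 -> psum n (E1 * E2) = psum n E1 + psum n E2.
Proof.
move=> h1 h2; have [q1 e1] := sinvP n.+2 h1; have [q2 e2] := sinvP n.+2 h2.
rewrite (psumE (E := E1 * E2) (G := sinv n.+2 E1 * sinv n.+2 E2)).
- rewrite /psum -opprD -coefD; congr (- _); apply: (@eqX_coef n.+2) => //.
  set H1 := sinv _ E1 in e1 *; set H2 := sinv _ E2 in e2 *.
  exists ('X * E1^`() * H1 * q2 + 'X * E2^`() * H2 * q1).
  rewrite derivM.
  have -> : 'X * (E1^`() * E2 + E1 * E2^`()) * (H1 * H2) - ('X * E1^`() * H1 + 'X * E2^`() * H2)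
    = 'X * E1^`() * H1 * (E2 * H2 - 1) + 'X * E2^`() * H2 * (E1 * H1 - 1) by ring.
  by rewrite e1 e2; ring.
- by rewrite coefM big_ord1 h1 h2 mulr1.
- set H1 := sinv _ E1 in e1 *; set H2 := sinv _ E2 in e2 *.
  exists (q1 * (E2 * H2) + q2).
  have -> : E1 * E2 * (H1 * H2) - 1 = (E1 * H1 - 1) * (E2 * H2) + (E2 * H2 - 1) by ring.
  by rewrite e1 [in X in _ + X]e2; ring.
Qed.

Lemma psum1 n : psum n 1 = 0.
Proof. by rewrite /psum -polyC1 derivC mulr0 mul0r coef0 oppr0. Qed.

Lemma psum_linear n (a : R) : psum n (1 - a *: 'X) = a ^+ n.+1.
Proof.
rewrite (psumE (G := \sum_(l < n.+2) (a *: 'X) ^+ l)).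
- rewrite derivB derivZ derivX -polyC1 derivC sub0r mulrN mulNr coefN opprK.
  rewrite -scalerAr mulr1 -scalerAl coefZ coefXM /= coef_sum.
  have lt : (n < n.+2)%N by [].
  rewrite (bigD1 (Ordinal lt)) //= big1 => [|i ni].
    by rewrite exprZn coefZ coefXn eqxx mulr1 addr0 exprS.
  rewrite exprZn coefZ coefXn; case: eqP => [E|_]; last by rewrite mulr0.
  by case/negP: ni; apply/eqP/val_inj.
- by rewrite coefB coefZ coefX coef1 mulr0 subr0.
- exists (- (a ^+ n.+2)%:P); have := subrX1 (a *: 'X) n.+2; rewrite exprZn => h.
  have -> : 'X^(n.+2) * - (a ^+ n.+2)%:P = - (1 + (a ^+ n.+2 *: 'X^(n.+2) - 1)).
    by rewrite mulrN mulrC mul_polyC addrCA subrr addr0.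
  by rewrite h; ring.
Qed.

Lemma eserM_coef0 r (u : 'I_r -> R) : (eser u)`_0 = 1.
Proof.
rewrite coefD coef1 coef_sum big1 ?addr0 // => j _.
by rewrite coefZ coefXn mulr0.
Qed.

Lemma eser_coefS r (u : 'I_r -> R) (j : 'I_r) : (eser u)`_j.+1 = (-1) ^+ j.+1 * u j.
Proof.
rewrite coefD coef1 add0r coef_sum (bigD1 j) //= coefZ coefXn eqxx mulr1 big1 ?addr0 //.
move=> i ij; rewrite coefZ coefXn eqSS; case: eqP => [E|_]; last by rewrite mulr0.
by case/negP: ij; apply/eqP/val_inj.
Qed.

Lemma eser_coef_ge r (u : 'I_r -> R) i : (r < i)%N -> (eser u)`_i = 0.
Proof.
case: i => // i ri; rewrite coefD coef1 add0r coef_sum big1 // => j _.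
rewrite coefZ coefXn eqSS; case: eqP => [E|_]; last by rewrite mulr0.
by move: ri; rewrite E ltnS leqNgt ltn_ord.
Qed.

Lemma eser_of_poly r (E : {poly R}) : E`_0 = 1 -> (size E <= r.+1)%N ->
  eser (fun j : 'I_r => (-1) ^+ j.+1 * E`_j.+1) = E.
Proof.
move=> E0 sE; apply/polyP => -[|i]; first by rewrite eserM_coef0.
case: (ltnP i r) => ir; last first.
  by rewrite eser_coef_ge // nth_default // (leq_trans sE).
by rewrite (eser_coefS _ (Ordinal ir)) /= signrMK.
Qed.

Lemma size_eser r (u : 'I_r -> R) : (size (eser u) <= r.+1)%N.
Proof. by apply/leq_sizeP => j; apply: eser_coef_ge. Qed.

Lemma eser_uniq r (u v : 'I_r -> R) : eser u = eser v -> u =1 v.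
Proof.
move=> h j; have := congr1 (fun p : {poly R} => p`_j.+1) h; rewrite !eser_coefS.
exact: (inv_inj (signrMK _)).
Qed.

(* The explicit quotient of psum n E1 - psum n E2 when E1 - E2 is a multiple of
   'X^(j + 1). *)
Definition pquo (n j : nat) E1 E2 : R :=
  (-1) ^+ j * ((j.+1%:R *: E2 - 'X * E2^`()) * sinv n.+2 E1 * sinv n.+2 E2)`_(n - j).

(** Over the common denominator E1 E2 the difference of logarithmic derivatives has numerator (E1' -
    E2') E2 - E2' (E1 - E2). Both differences are explicit monomials; the factor ['X^(j.+1)] taken
    out of the result moves the coefficient from [n.+1] to [n - j]. *)
Lemma psumB n j E1 E2 (c : R) : (j <= n)%N -> E1`_0 = 1 -> E2`_0 = 1 ->
  E1 - E2 = ((-1) ^+ j.+1 * c) *: 'X^(j.+1) ->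
  psum n E1 - psum n E2 = pquo n j E1 E2 * c.
Proof.
move=> jn h1 h2 D; have [q1 e1] := sinvP n.+2 h1; have [q2 e2] := sinvP n.+2 h2.
rewrite /psum /pquo; set H1 := sinv _ E1 in e1 *; set H2 := sinv _ E2 in e2 *.
rewrite -opprB opprK.
have D' : E1^`() - E2^`() = ((-1) ^+ j.+1 * c) *: (j.+1%:R *: 'X^j).
  by rewrite -derivB D derivZ derivXn -scaler_nat.
have -> : - ('X * E2^`() * H2)`_n.+1 + ('X * E1^`() * H1)`_n.+1 =
          ('X * (E1^`() - E2^`()) * E2 * H1 * H2 - 'X * E2^`() * (E1 - E2) * H1 * H2)`_n.+1.
  rewrite addrC -coefB; apply: (@eqX_coef n.+2) => //.
  exists ('X * E2^`() * H2 * q1 - 'X * E1^`() * H1 * q2).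
  transitivity ('X * E2^`() * H2 * (E1 * H1 - 1) - 'X * E1^`() * H1 * (E2 * H2 - 1)); first by ring.
  by rewrite e1 e2; ring.
rewrite D D'; set s := (-1) ^+ j.+1 * c.
have -> : 'X * (s *: (j.+1%:R *: 'X^j)) * E2 * H1 * H2 - 'X * E2^`() * (s *: 'X^(j.+1)) * H1 * H2 =
   s *: ((j.+1%:R *: E2 - 'X * E2^`()) * H1 * H2 * 'X^(j.+1)).
  by rewrite -!mul_polyC exprS; ring.
rewrite coefZ coefMXn ltnS ltnNge jn /= subSS /s exprS mulN1r.
by ring.
Qed.

(** At equal arguments the series is (j + 1) / E - X E' / E^2 = (j + 1) H + X H' with H = 1 / E. In
    degree n - j the two terms contribute the factors j + 1 and n - j, hence n + 1. The G_l of the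
    closed edge come from here. *)
Lemma pquo_diag n j E : (j <= n)%N -> E`_0 = 1 ->
  pquo n j E E = (-1) ^+ j * (n.+1%:R * (sinv n.+2 E)`_(n - j)).
Proof.
move=> jn h; have [q e] := sinvP n.+2 h; rewrite /pquo; congr (_ * _).
set H := sinv _ E in e *.
transitivity (j.+1%:R *: H + 'X * H^`())`_(n - j).
  apply: (@eqX_coef n.+2); last by lia.
  exists (j.+1%:R *: (H * q) - H * (n.+2%:R * q + 'X * q^`()) + 'X * H^`() * q).
  have dE : E^`() * H + E * H^`() = 'X^(n.+1) * (n.+2%:R * q + 'X * q^`()).
    have <- : (E * H - 1)^`() = E^`() * H + E * H^`() by rewrite derivB -polyC1 derivC subr0 derivM.
    by rewrite e derivM derivXn -mulr_natl exprS; ring.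
  transitivity (j.+1%:R *: (H * (E * H - 1)) - 'X * H * (E^`() * H + E * H^`())
     + 'X * H^`() * (E * H - 1)).
    by rewrite -!mul_polyC; ring.
  by rewrite dE e -!mul_polyC exprS; ring.
rewrite coefD coefZ coefXM; case E1 : (n - j)%N => [|m] /=.
  by rewrite addr0; congr (_%:R * _); lia.
rewrite coef_deriv -[_ *+ m.+1]mulr_natl -mulrDl -natrD; congr (_%:R * _); lia.
Qed.

End Series.

Section Morphism.
Variables (R S : comNzRingType) (f : {rmorphism R -> S}).

Lemma map_eser r (u : 'I_r -> R) : map_poly f (eser u) = eser (fun j => f (u j)).
Proof.
rewrite /eser rmorphD rmorph1 rmorph_sum /=; congr (_ + _); apply: eq_bigr => j _.
by rewrite map_polyZ /= map_polyXn rmorphM rmorphXn rmorphN1.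
Qed.

Lemma map_sinv M (E : {poly R}) : map_poly f (sinv M E) = sinv M (map_poly f E).
Proof.
rewrite /sinv rmorph_sum /=; apply: eq_bigr => l _.
by rewrite rmorphXn rmorphB rmorph1.
Qed.

Lemma map_psum n (E : {poly R}) : f (psum n E) = psum n (map_poly f E).
Proof.
by rewrite /psum rmorphN -coef_map !rmorphM /= map_polyX map_sinv deriv_map.
Qed.

Lemma map_pquo n j (E1 E2 : {poly R}) : f (pquo n j E1 E2) = pquo n j (map_poly f E1) (map_poly f E2).
Proof.
rewrite /pquo rmorphM rmorphXn rmorphN1 -coef_map !rmorphM rmorphB /= !map_sinv rmorphM /=.
by rewrite map_polyX map_polyZ deriv_map /= rmorph_nat.
Qed.

End Morphism.

Section PowerSum.

Lemma eser_mesym r :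
  eser (fun j : 'I_r => mesym r rat j.+1) = \prod_(i < r) (1 - 'X_i *: 'X).
Proof.
under eq_bigr do rewrite -scaleNr addrC.
rewrite bigA_distr /=.
transitivity (\sum_(J : {set 'I_r}) ((-1) ^+ #|J| * \prod_(i in J) 'X_i) *: 'X^(#|J|) : {poly {mpoly rat[r]}}).
  have cR i : (\sum_(J : {set 'I_r}) ((-1) ^+ #|J| * \prod_(i in J) 'X_i) *: 'X^(#|J|) : {poly {mpoly rat[r]}})`_i
     = (-1) ^+ i * mesym r rat i.
    rewrite coef_sum /mesym mulr_sumr [RHS]big_mkcond; apply: eq_bigr => J _.
    rewrite coefZ coefXn eq_sym; case: eqP => [->|_]; first by rewrite mulr1.
    by rewrite mulr0.
  apply/polyP => i; rewrite cR; case: i => [|i].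
    by rewrite eserM_coef0 mesym0E mulr1.
  case: (ltnP i r) => ir; first by rewrite (eser_coefS _ (Ordinal ir)).
  by rewrite eser_coef_ge // mesym_geqnE ?mulr0.
apply: eq_big => [J|J _]; first by rewrite inE.
rewrite -big_mkcond /= scaler_prod prodrN -/(_ ^+ _).
by rewrite prodr_const.
Qed.

Lemma psum_prod n (R : comNzRingType) (I : Type) (s : seq I) (a : I -> R) :
  psum n (\prod_(i <- s) (1 - a i *: 'X)) = \sum_(i <- s) a i ^+ n.+1.
Proof.
have c0 (t : seq I) : (\prod_(i <- t) (1 - a i *: 'X))`_0 = 1.
  elim: t => [|i t ih]; first by rewrite big_nil coef1.
  by rewrite big_cons coefM big_ord1 ih coefB coef1 coefZ coefX mulr0 subr0 mulr1.
elim: s => [|i s ih]; first by rewrite !big_nil psum1.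
rewrite !big_cons psumM ?ih ?psum_linear //.
by rewrite coefB coef1 coefZ coefX mulr0 subr0.
Qed.

Lemma powersum_sym r n : (\sum_(k < r) 'X_k ^+ n : {mpoly rat[r]}) \is symmetric.
Proof.
apply/issymP => s; rewrite rmorph_sum /= (reindex_inj (h := s^-1)%g) /=; last exact: perm_inj.
apply: eq_bigr => k _; rewrite rmorphXn /= msymX; congr ('X_[_] ^+ _).
apply/mnmP => i; rewrite mnmE !mnm1E; congr (_ : bool).
by rewrite (inj_eq perm_inj).
Qed.

Lemma eq_eser (R : comNzRingType) r (u v : 'I_r -> R) : u =1 v -> eser u = eser v.
Proof. by move=> uv; rewrite /eser; under eq_bigr do rewrite uv. Qed.

(** By uniqueness in the fundamental theorem of symmetric polynomials it suffices to compare the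
    values at the elementary symmetric polynomials, where the series factors into the
    [1 - 'X_i *: 'X]. *)
Lemma Fpoly_psum n r : Fpoly n r = psum n (eser (fun j : 'I_r => 'X_j)).
Proof.
apply: msym_fundamental_un; rewrite /Fpoly -symfP ?powersum_sym //.
rewrite -[RHS]/(comp_mpoly _ _) map_psum map_eser /=.
rewrite -(psum_prod n (index_enum 'I_r)) -eser_mesym; apply: (congr1 (psum n)).
by apply: eq_eser => j; rewrite comp_mpolyXU -tnth_nth tnth_mktuple.
Qed.

Lemma Fat_psum n r N (u : 'I_r -> {mpoly rat[N]}) : Fat n u = psum n (eser u).
Proof.
rewrite /Fat Fpoly_psum -/(psub u _) map_psum map_eser; apply: (congr1 (psum n)).
by apply: eq_eser => j; apply: psubX.
Qed.


End PowerSum.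

Section GradedSeries.
Variables (N : nat) (w : 'I_N -> nat).
Implicit Types E : {poly {mpoly rat[N]}}.

Definition gser E : Prop := forall i, zhomog w (2 * i)%N E`_i.

Lemma gserD E1 E2 : gser E1 -> gser E2 -> gser (E1 + E2).
Proof. by move=> h1 h2 i; rewrite coefD; apply: zhomogD. Qed.

Lemma gserN E : gser E -> gser (- E).
Proof. by move=> h i; rewrite coefN; apply: zhomogN. Qed.

Lemma gserM E1 E2 : gser E1 -> gser E2 -> gser (E1 * E2).
Proof.
move=> h1 h2 i; rewrite coefM; apply: zhomog_sum => j _.
by have := zhomogM (h1 j) (h2 (i - j)%N); congr zhomog; have := ltn_ord j; lia.
Qed.

Lemma gser1 : gser 1.
Proof.
move=> [|i]; rewrite coef1; last exact: zhomog0.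
by rewrite -mpolyC1; apply: zhomogC.
Qed.

Lemma gserXn E l : gser E -> gser (E ^+ l).
Proof. by move=> h; elim: l => [|l ih]; rewrite ?expr0 ?exprS; [apply: gser1 | apply: gserM]. Qed.

Lemma gser_sum (I : Type) (s : seq I) (F : I -> {poly {mpoly rat[N]}}) :
  (forall i, gser (F i)) -> gser (\sum_(i <- s) F i).
Proof.
move=> h; elim: s => [|i s ih]; last by rewrite big_cons; apply: gserD.
by rewrite big_nil => i; rewrite coef0; apply: zhomog0.
Qed.

Lemma gser_nat (m : nat) E : gser E -> gser (m%:R *: E).
Proof. by move=> h i; rewrite coefZ mulr_natl; apply: zhomogMn. Qed.

Lemma gser_Xderiv E : gser E -> gser ('X * E^`()).
Proof.
by move=> h [|i]; rewrite coefXM /=; [apply: zhomog0 | rewrite coef_deriv; apply: zhomogMn].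
Qed.

Lemma gser_sinv M E : gser E -> gser (sinv M E).
Proof. by move=> h; apply: gser_sum => l; apply/gserXn/gserD/gserN/h/gser1. Qed.

Lemma gser_eser r (u : 'I_r -> {mpoly rat[N]}) :
  (forall j : 'I_r, zhomog w (2 * j.+1)%N (u j)) -> gser (eser u).
Proof.
move=> h [|i]; first by rewrite eserM_coef0 -mpolyC1; apply: zhomogC.
case: (ltnP i r) => ir; last by rewrite eser_coef_ge //; apply: zhomog0.
rewrite (eser_coefS _ (Ordinal ir)) -signr_odd; apply: zhomog_sign; exact: h.
Qed.

Lemma zhomog_psum n E : gser E -> zhomog w (2 * n.+1)%N (psum n E).
Proof. by move=> h; apply/zhomogN/gserM/gser_sinv/h/gser_Xderiv. Qed.

Lemma zhomog_pquo n j E1 E2 : gser E1 -> gser E2 -> zhomog w (2 * (n - j))%N (pquo n j E1 E2).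
Proof.
move=> h1 h2; rewrite /pquo -signr_odd; apply: zhomog_sign.
apply/gserM/gser_sinv/h2/gserM/gser_sinv/h1/gserD/gserN/gser_Xderiv/h2/gser_nat/h2.
Qed.

(** At -1 the signs built into [eser] cancel: [(eser u).[-1]] is 1 + u_1 + u_2 and so on. This
    connects the homogeneous parts in the definition of [esum] with coefficients of series. *)
Lemma pihomog_gser E m : gser E -> pihomog (wdeg w) (2 * m) (E.[-1]) = (-1) ^+ m * E`_m.
Proof.
move=> h; rewrite horner_coef linear_sum /=.
have pi (i : nat) : pihomog (wdeg w) (2 * m) (E`_i * (-1) ^+ i) = ((-1) ^+ i * E`_i) *+ (m == i).
  have hi : (-1) ^+ i * E`_i \is (2 * i).-homog for (wdeg w).
    by apply/zhomogP; rewrite -signr_odd; apply/zhomog_sign/h.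
  rewrite mulrC; case: eqP => [->|/eqP ne]; first by rewrite pihomog_dE.
  by rewrite (pihomog_ne0 _ hi) // eqn_mul2l negb_or [i == m]eq_sym ne.
under eq_bigr do rewrite pi.
case: (ltnP m (size E)) => mE.
  rewrite (bigD1 (Ordinal mE)) //= eqxx mulr1n big1 ?addr0 // => i ni.
  by case: eqP => // E1; case/negP: ni; apply/eqP/val_inj.
rewrite nth_default // mulr0 big1 // => i _; case: eqP => // E1.
by have := ltn_ord i; rewrite -E1 ltnNge mE.
Qed.

Lemma eser_esum p q (x : 'I_p -> 'I_N) (y : 'I_q -> 'I_N) :
  (forall j : 'I_p, w (x j) = 2 * j.+1)%N -> (forall j : 'I_q, w (y j) = 2 * j.+1)%N ->
  eser (esum w x y) = eser (pvar x) * eser (pvar y).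
Proof.
move=> wx wy.
have gx : gser (eser (pvar x)) by apply: gser_eser => j; rewrite -wx; apply: zhomogX.
have gy : gser (eser (pvar y)) by apply: gser_eser => j; rewrite -wy; apply: zhomogX.
have ev r (u : 'I_r -> {mpoly rat[N]}) : (eser u).[-1] = 1 + \sum_k u k.
  rewrite /eser hornerD hornerC horner_sum; congr (_ + _); apply: eq_bigr => j _.
  by rewrite hornerZ hornerXn mulrC signrMK.
rewrite -[RHS](eser_of_poly (r := p + q)).
- apply: eq_eser => j; rewrite -pihomog_gser; last exact: gserM.
  by rewrite hornerM !ev.
- by rewrite coefM big_ord1 !eserM_coef0 mulr1.
- apply: leq_trans (size_polyMleq _ _) _.
  by have := size_eser (pvar x); have := size_eser (pvar y); lia.
Qed.

End GradedSeries.

Lemma zhomog_eq N (w : 'I_N -> nat) d d' p : d = d' -> zhomog w d p -> zhomog w d' p.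
Proof. by move=> ->. Qed.

Section Chains.
Variables (n r N : nat).
Implicit Types (u v : 'I_r -> {mpoly rat[N]}) (w : 'I_N -> nat).

Definition mix u v (j : nat) (k : 'I_r) : {mpoly rat[N]} :=
  if (nat_of_ord k < j)%N then v k else u k.

Definition cquo u v (j : 'I_r) : {mpoly rat[N]} :=
  pquo n j (eser (mix u v j)) (eser (mix u v j.+1)).

(** Half the difference between the degree 2 (j + 1) of [u j - v j] and the degree 2 (n - j) of the
    quotient, which is 2 j + 1 - n. *)
Definition cdeg (j : nat) : int := (2 * j.+1)%:Z - (n.+1)%:Z.

Definition crows u v : seq (krow N) :=
  [seq (cdeg j, cquo u v j, u j - v j) | j : 'I_r <- enum 'I_r].

Lemma mixB u v (j : 'I_r) :
  eser (mix u v j) - eser (mix u v j.+1) = ((-1) ^+ j.+1 * (u j - v j)) *: 'X^(j.+1).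
Proof.
rewrite /eser opprD addrACA subrr add0r -sumrB (bigD1 j) //= big1 ?addr0 => [|k kj].
  by rewrite /mix ltnn ltnSn -scalerBl mulrBr.
rewrite /mix ltnS [(k <= j)%N]leq_eqVlt.
have -> : (k == j :> nat) = false by apply/negbTE.
by rewrite subrr.
Qed.

Hypothesis rn : (r <= n)%N.

Lemma cquoE u v (j : 'I_r) :
  cquo u v j * (u j - v j) = psum n (eser (mix u v j)) - psum n (eser (mix u v j.+1)).
Proof.
symmetry; apply: psumB; rewrite ?eserM_coef0 //; last exact: mixB.
by apply: ltnW; apply: leq_trans rn.
Qed.

Lemma crows_pot u v : rows_pot (crows u v) = psum n (eser u) - psum n (eser v).
Proof.
rewrite /rows_pot /crows big_map big_enum /=.
under eq_bigr do rewrite cquoE.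
rewrite -(big_mkord xpredT (fun j => psum n (eser (mix u v j)) - psum n (eser (mix u v j.+1)))).
under eq_bigr do rewrite -opprB.
rewrite sumrN telescope_sumr // opprB.
by rewrite (eq_eser (v := u)) ?(eq_eser (u := mix u v r) (v := v)) // => k; rewrite /mix ltn_ord.
Qed.


Lemma crows_good w u v :
  (forall j : 'I_r, zhomog w (2 * j.+1)%N (u j)) -> (forall j : 'I_r, zhomog w (2 * j.+1)%N (v j)) ->
  forall t, t \in crows u v -> row_good w n.+1 t.
Proof.
move=> hu hv t /mapP [j _ ->]; split; last first.
  apply: zhomog_eq (zhomogB (hu j) (hv j)); rewrite [(_, _, _).1.1]/= /cdeg; ring.
have gm l : gser w (eser (mix u v l)).
  by apply: gser_eser => k; rewrite /mix; case: ifP.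
apply: zhomog_eq (@zhomog_pquo _ _ n j _ _ (gm j) (gm j.+1)).
by rewrite [(_, _, _).1.1]/= /cdeg; have := ltn_ord j; lia.
Qed.

End Chains.

Lemma psub_pquo N N' (g : 'I_N -> {mpoly rat[N']}) n j r (u v : 'I_r -> {mpoly rat[N]}) :
  psub g (pquo n j (eser u) (eser v)) = pquo n j (eser (fun i => psub g (u i))) (eser (fun i => psub g (v i))).
Proof.
exact: (etrans (map_pquo (psub g) n j (eser u) (eser v))
               (congr2 (pquo n j) (map_eser (psub g) u) (map_eser (psub g) v))).
Qed.

Lemma psub_cquo N N' (g : 'I_N -> {mpoly rat[N']}) n r (u v : 'I_r -> {mpoly rat[N]}) j :
  psub g (cquo n u v j) = cquo n (fun i => psub g (u i)) (fun i => psub g (v i)) j.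
Proof.
apply: (etrans (psub_pquo g n j (mix u v j) (mix u v j.+1))).
by apply: (congr2 (pquo n j)); apply: eq_eser => k; rewrite /mix; case: ifP.
Qed.

Lemma psub_crows N N' (g : 'I_N -> {mpoly rat[N']}) n r (u v : 'I_r -> {mpoly rat[N]}) :
  [seq rsubst (psub g) t | t <- crows n u v] = crows n (fun i => psub g (u i)) (fun i => psub g (v i)).
Proof.
rewrite /crows -map_comp; apply: eq_map => j; rewrite /rsubst /= psub_cquo.
by rewrite rmorphB.
Qed.

Lemma eq_cquo n r N (u v u' v' : 'I_r -> {mpoly rat[N]}) j : u =1 u' -> v =1 v' ->
  cquo n u v j = cquo n u' v' j.
Proof.
move=> uu vv; rewrite /cquo.
by apply: (congr2 (pquo n j)); apply: eq_eser => k; rewrite /mix uu vv.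
Qed.

Lemma eq_crows n r N (u v u' v' : 'I_r -> {mpoly rat[N]}) : u =1 u' -> v =1 v' ->
  crows n u v = crows n u' v'.
Proof.
move=> uu vv; rewrite /crows; apply: eq_map => j.
by rewrite (eq_cquo _ _ uu vv) uu vv.
Qed.

(** Nonzero differences make [pquot] equal to the explicit quotient. Both entries have to be nonzero
    for [koszul] to read off the degrees that give [cdeg]. *)
Lemma chainE n r N (w : 'I_N -> nat) (u v : 'I_r -> {mpoly rat[N]}) : (r <= n)%N ->
  (forall j : 'I_r, zhomog w (2 * j.+1)%N (u j)) -> (forall j : 'I_r, zhomog w (2 * j.+1)%N (v j)) ->
  (forall j, u j != v j) -> (forall j, cquo n u v j != 0) ->
  chain n w u v = mrows (crows n u v) (munit N).
Proof.
move=> rn hu hv uv q0.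
have pdE d (p : {mpoly rat[N]}) : p != 0 -> zhomog w d%:Z p -> pdeg w p = d.
  move=> p0 /zhomogP hp; rewrite /pdeg; apply: (dhomog_uniq p0 _ hp).
  exact: dhomog_msize hp.
have row (j : 'I_r) : koszul w
      (pquot (Fat n (fun k => if (k < j)%N then v k else u k)
              - Fat n (fun k => if (k <= j)%N then v k else u k))
             (u j - v j)) (u j - v j) = kosz (cdeg n j) (cquo n u v j) (u j - v j).
  have -> : pquot (Fat n (fun k => if (k < j)%N then v k else u k)
              - Fat n (fun k => if (k <= j)%N then v k else u k)) (u j - v j) = cquo n u v j.
    apply: (mulIf (x := u j - v j)); first by rewrite subr_eq0.
    rewrite pquotP; first by rewrite !Fat_psum cquoE.
    by exists (cquo n u v j); rewrite !Fat_psum cquoE.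
  have [hq hb] : row_good w n.+1 (cdeg n j, cquo n u v j, u j - v j).
    by apply: (crows_good rn hu hv); apply: map_f; rewrite mem_enum.
  rewrite /koszul /kosz; congr MFact; congr (fun d => (fun=> d)).
  have jr := ltn_ord j.
  rewrite (pdE (2 * j.+1)%N); first last.
  - by apply: zhomog_eq hb; rewrite [(_, _, _).1.1]/= /cdeg; ring.
  - by rewrite subr_eq0.
  rewrite (pdE (2 * (n - j))%N) //; last by apply: zhomog_eq hq; rewrite [(_, _, _).1.1]/= /cdeg; lia.
  by rewrite /cdeg; lia.
rewrite /chain /crows; under eq_bigr do rewrite row.
have -> : index_enum 'I_r = enum 'I_r by rewrite [index_enum _]unlock -enumT.
elim: (enum _) => [|j s ih]; first by rewrite big_nil.
by rewrite big_cons ih.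
Qed.

(** * Monomial bases and the quantum binomial *)

Section HilbertSeries.

(** The inverse of [1 - 'X^w] cut at exponent [D]: exponent vectors then form a finite type, and for
    positive [w] nothing is lost up to degree [D]. *)
Definition geom (D w : nat) : {poly rat} := \sum_(k < D.+1) 'X^(w * k).

Lemma eqX_mul (R : comNzRingType) M (p p' q q' : {poly R}) :
  eqX M p p' -> eqX M q q' -> eqX M (p * q) (p' * q').
Proof.
case=> s hs [t ht]; exists (s * q + p' * t).
have -> : p * q - p' * q' = (p - p') * q + p' * (q - q') by ring.
by rewrite hs ht; ring.
Qed.

Lemma eqX_refl (R : comNzRingType) M (p : {poly R}) : eqX M p p.
Proof. by exists 0; rewrite subrr mulr0. Qed.

Lemma geomP D w : (0 < w)%N -> eqX D.+1 (geom D w * (1 - 'X^w)) 1.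
Proof.
move=> w0; have := subrX1 ('X^w : {poly rat}) D.+1.
under eq_bigr do rewrite -exprM.
rewrite -/(geom D w) -exprM => h.
exists (- 'X^(w * D.+1 - D.+1)).
rewrite mulrN -exprD subnKC; last by rewrite leq_pmull.
have -> : 'X^(w * D.+1) = 1 + ('X^w - 1) * geom D w :> {poly rat} by rewrite -h; ring.
by ring.
Qed.

Lemma geom_prodP D n (w : 'I_n -> nat) : (forall i, 0 < w i)%N ->
  eqX D.+1 ((\prod_i geom D (w i)) * \prod_i (1 - 'X^(w i))) 1.
Proof.
move=> w0; rewrite -big_split /=; apply: (big_ind (fun p => eqX D.+1 p 1)).
- exact: eqX_refl.
- by move=> p q hp hq; rewrite -[1]mulr1; apply: eqX_mul.
- by move=> i _; apply: geomP.
Qed.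

Lemma geom_prodE D n (w : 'I_n -> nat) :
  \prod_i geom D (w i) = \sum_(m : {ffun 'I_n -> 'I_D.+1}) 'X^(\sum_i w i * m i).
Proof.
rewrite /geom bigA_distr_bigA /=; apply: eq_bigr => m _.
by rewrite (big_morph (fun e => 'X^e) (exprD 'X) (expr0 'X)).
Qed.

Lemma coef_sumX (T : finType) (a : T -> nat) D :
  (\sum_t 'X^(a t) : {poly rat})`_D = #|[set t | a t == D]|%:R.
Proof.
rewrite coef_sum cardsE -sum1_card natr_sum big_mkcond [RHS]big_mkcond /=.
by apply: eq_bigr => t _; rewrite coefXn eq_sym unfold_in eqnE; case: (_ == _).
Qed.

(** The hypothesis, cross-multiplied, says that a polynomial ring with weights [w] has the Hilbert
    series of a sum of copies, shifted by the [e j], of one with weights [d]. The two sets count the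
    contributions in degree [D]. *)
Lemma count_eq D n m (w : 'I_n -> nat) (d : 'I_m -> nat) (J : finType) (e : J -> nat) :
  (forall i, 0 < w i)%N -> (forall i, 0 < d i)%N ->
  (\sum_j 'X^(e j)) * \prod_i (1 - 'X^(w i)) = \prod_i (1 - 'X^(d i)) :> {poly rat} ->
  #|[set t : {ffun 'I_n -> 'I_D.+1} | (\sum_i w i * t i)%N == D]| =
  #|[set t : J * {ffun 'I_m -> 'I_D.+1} | (e t.1 + \sum_i d i * t.2 i)%N == D]|.
Proof.
move=> w0 d0 h; apply/eqP; rewrite -(Num.Theory.eqr_nat rat); apply/eqP.
rewrite -!coef_sumX -geom_prodE.
have -> : \sum_(t : J * {ffun 'I_m -> 'I_D.+1}) 'X^(e t.1 + \sum_i d i * t.2 i) =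
    (\sum_j 'X^(e j)) * \prod_i geom D (d i) :> {poly rat}.
  rewrite geom_prodE mulr_suml (eq_bigr _ (fun j _ => mulr_sumr _ _ _ _)) pair_bigA /=.
  by apply: eq_bigr => t _; rewrite exprD.
apply: (@eqX_coef _ D.+1) => //.
set E := \sum_j _ in h *; set G := \prod_i geom D (w i); set H := \prod_i geom D (d i).
have [s hs] := geom_prodP D w0; have [t ht] := geom_prodP D d0.
rewrite -/G -/H in hs ht; exists (E * H * s - G * t).
have -> : G - E * H = (G * \prod_i (1 - 'X^(w i)) - 1) * (E * H) + G * (1 - H * (E * \prod_i (1 - 'X^(w i)))).
  by ring.
by rewrite h hs -opprB ht; ring.
Qed.

End HilbertSeries.

(** * Freeness from spanning and a dimension count *)

Section FreeOfSpan.
Variables (N M : nat) (w : 'I_N -> nat) (d : 'I_M -> nat) (f : 'I_M -> {mpoly rat[N]}).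
Variables (J : finType) (e : J -> nat) (vb : J -> {mpoly rat[N]}).
Hypothesis w0 : forall i, (0 < w i)%N.
Hypothesis d0 : forall i, (0 < d i)%N.
Hypothesis f_homog : forall i, zhomog w (d i) (f i).
Hypothesis vb_homog : forall j, zhomog w (e j) (vb j).
Hypothesis span : forall a, exists (c : J -> rat) (q : 'I_M -> {mpoly rat[N]}),
  a = \sum_j (c j)%:MP * vb j + \sum_i q i * f i.
Hypothesis count :
  (\sum_j 'X^(e j)) * \prod_i (1 - 'X^(w i)) = \prod_i (1 - 'X^(d i)) :> {poly rat}.

Let pihomogM_lt (D l : nat) p q : (D < l)%N -> zhomog w l q ->
  pihomog (wdeg w) D (p * q) = 0.
Proof.
move=> Dl hq; elim/mpolyind: p => [|c m p _ _ ih]; first by rewrite mul0r linear0.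
rewrite mulrDl linearD /= ih addr0 -scalerAl linearZ /=.
have hXq : 'X_[m] * q \is (wdeg w m + l).-homog for (wdeg w).
  by apply/zhomogP; rewrite PoszD; apply/zhomogM/hq/zhomogXm.
by rewrite (pihomog_ne0 _ hXq) ?scaler0 //; apply/eqP; lia.
Qed.

(** Graded Nakayama: the coefficient of [f i] may be replaced by its part of degree [D - d i], which
    is smaller than [D] since [d i] is positive, and is expanded by induction. *)
Let span_homog (D : nat) a : zhomog w D a -> exists c : J -> {mpoly rat[M]},
  a = \sum_j psub f (c j) * vb j /\ forall j, zhomog d (D%:Z - (e j)%:Z) (c j).
Proof.
elim/ltn_ind: D a => D ih a ha; have [c [q aE]] := span a.
pose q' i := if (d i <= D)%N then pihomog (wdeg w) (D - d i) (q i) else 0.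
have q'E i : pihomog (wdeg w) D (q i * f i) = q' i * f i.
  rewrite /q'; case: leqP => di; last by rewrite mul0r; apply: (pihomogM_lt _ di).
  by rewrite -[in LHS](subnK di) pihomogM.
have : forall i, exists b : J -> {mpoly rat[M]}, q' i = \sum_j psub f (b j) * vb j /\
    forall j, zhomog d (D%:Z - (d i)%:Z - (e j)%:Z) (b j).
  move=> i; rewrite /q'; case: leqP => di; last first.
    exists (fun=> 0); split=> [|j]; last exact: zhomog0.
    by rewrite big1 // => j _; rewrite rmorph0 mul0r.
  have Dd : (D - d i < D)%N by rewrite ltn_subrL d0 (leq_trans (d0 i)).
  have hp : zhomog w (D - d i)%N (pihomog (wdeg w) (D - d i) (q i)).
    by apply/zhomogP/pihomogP.
  have [b [bE hb]] := ih _ Dd _ hp; exists b; split => // j.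
  by apply: zhomog_eq (hb j); lia.
move/fin_all_exists => [b hb].
exists (fun j => (c j *+ (e j == D))%:MP + \sum_i 'X_i * b i j); split.
  rewrite -[LHS](pihomog_dE (mf := wdeg w) (d := D)); last exact/zhomogP.
  rewrite aE linearD !linear_sum /=.
  under [X in _ + X]eq_bigr do rewrite q'E (hb _).1 mulr_suml.
  rewrite exchange_big /= -big_split /=; apply: eq_bigr => j _.
  rewrite rmorphD /= psubC mulrDl rmorph_sum mulr_suml /=; congr (_ + _).
    rewrite mul_mpolyC linearZ /= mul_mpolyC.
    have hv : vb j \is (e j).-homog for (wdeg w) by apply/zhomogP.
    case: eqP => [<-|/eqP ne]; first by rewrite pihomog_dE.
    by rewrite (pihomog_ne0 ne hv) scaler0 mulr0n scale0r.
  by apply: eq_bigr => i _; rewrite rmorphM /= psubX; ring.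
move=> j; apply: zhomogD.
  case: eqP => [<-|_]; last by rewrite mulr0n mpolyC0; apply: zhomog0.
  by rewrite subrr; apply: zhomogC.
apply: zhomog_sum => i _; apply: zhomog_eq (zhomogM (@zhomogX _ d i) ((hb i).2 j)).
by ring.
Qed.

Let span_all a : exists c : J -> {mpoly rat[M]}, a = \sum_j psub f (c j) * vb j.
Proof.
rewrite (pihomog_partitionE (mf := wdeg w) (leqnn (mmeasure (wdeg w) a))).
elim/big_ind: _ => [|p q [c ->] [b ->]|D _].
- by exists (fun=> 0); rewrite big1 // => j _; rewrite rmorph0 mul0r.
- exists (fun j => c j + b j); rewrite -big_split /=; apply: eq_bigr => j _.
  by rewrite rmorphD mulrDl.
- have h : zhomog w D (pihomog (wdeg w) D a) by apply/zhomogP/pihomogP.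
  by have [c [cE _]] := span_homog h; exists c.
Qed.

Section Degree.
Variable D : nat.
Let S := {ffun 'I_N -> 'I_D.+1}.
Let T := (J * {ffun 'I_M -> 'I_D.+1})%type.
Let SD := [set t : S | (\sum_i w i * t i)%N == D].
Let TD := [set t : T | (e t.1 + \sum_i d i * t.2 i)%N == D].
Let mon n (t : {ffun 'I_n -> 'I_D.+1}) : 'X_{1..n} := [multinom t i : nat | i < n].
Let u (t : T) : {mpoly rat[N]} := psub f 'X_[mon t.2] * vb t.1.

Let wdeg_mon n (z : 'I_n -> nat) (t : {ffun 'I_n -> 'I_D.+1}) : wdeg z (mon t) = (\sum_i z i * t i)%N.
Proof. by rewrite /wdeg; apply: eq_bigr => i _; rewrite mnmE mulnC. Qed.

Let mon_surj n (z : 'I_n -> nat) (m : 'X_{1..n}) : (forall i, 0 < z i)%N -> (wdeg z m <= D)%N ->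
  exists t : {ffun 'I_n -> 'I_D.+1}, mon t = m.
Proof.
move=> z0 mD; exists [ffun i => inord (m i)]; apply/mnmP => i; rewrite mnmE ffunE inordK //.
rewrite ltnS (leq_trans _ mD) // /wdeg (bigD1 i) //= (leq_trans _ (leq_addr _ _)) //.
by rewrite leq_pmulr.
Qed.

Let mon_inj n : injective (@mon n).
Proof.
by move=> t t' /mnmP h; apply/ffunP => i; apply: val_inj; have := h i; rewrite !mnmE.
Qed.

Let expand n (z : 'I_n -> nat) (p : {mpoly rat[n]}) (l : nat) : (forall i, 0 < z i)%N -> (l <= D)%N ->
  zhomog z l p ->
  p = \sum_(t : {ffun 'I_n -> 'I_D.+1} | (\sum_i z i * t i)%N == l) p@_(mon t) *: 'X_[mon t].
Proof.
move=> z0 lD hp; apply/mpolyP => m; rewrite linear_sum /=.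
under eq_bigr do rewrite mcoeffZ mcoeffX.
have [mp|mp] := boolP (m \in msupp p); last first.
  rewrite memN_msupp_eq0 // big1 // => t _; case: eqP => [->|_]; last by rewrite mulr0.
  by rewrite memN_msupp_eq0 // mul0r.
have ml : wdeg z m = l by have := hp m mp => -[].
have [t tE] : exists t : {ffun 'I_n -> 'I_D.+1}, mon t = m by apply: (mon_surj z0); rewrite ml.
rewrite (bigD1 t) /=; last by rewrite -(wdeg_mon z) tE ml.
rewrite tE eqxx mulr1 big1 ?addr0 // => t' /andP[_ tt].
case: eqP => [E|_]; last by rewrite mulr0.
by case/negP: tt; apply/eqP/mon_inj; rewrite E.
Qed.

(* The u t span the polynomials of degree D, and by count_eq there are as many of
   them as monomials of degree D; so they are independent. *)
Let Umx : 'M[rat]_(#|TD|, #|SD|) := \matrix_(a, b) (u (enum_val a))@_(mon (enum_val b)).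

Let Umx_free (lam : T -> rat) : \sum_(t in TD) lam t *: u t = 0 -> forall t, t \in TD -> lam t = 0.
Proof.
have [K KU] : exists K : 'M[rat]_(#|SD|, #|TD|), K *m Umx = 1%:M.
  have hs (b : 'I_#|SD|) : exists k : T -> rat, 'X_[mon (enum_val b)] = \sum_(t in TD) k t *: u t.
    have hX : zhomog w D 'X_[mon (enum_val b)].
      have := enum_valP b; rewrite inE -wdeg_mon => /eqP bE.
      by apply: zhomog_eq (@zhomogXm _ w _); rewrite bE.
    have [c [cE hc]] := span_homog hX.
    exists (fun t => (c t.1)@_(mon t.2)); rewrite cE.
    rewrite [RHS](eq_bigl (fun t : T => true && ((e t.1 + \sum_i d i * t.2 i)%N == D))); last first.
      by move=> t; rewrite inE.
    rewrite -(pair_big_dep xpredT (fun j (t : {ffun 'I_M -> 'I_D.+1}) => (e j + \sum_i d i * t i)%N == D)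
       (fun j t => (c j)@_(mon t) *: u (j, t))) /=.
    apply: eq_bigr => j _; rewrite /u /=.
    case: (leqP (e j) D) => eD; last first.
      have -> : c j = 0.
        apply: contraTeq eD => nz; have [l lE] := zhomog_neg (hc j) nz; lia.
      rewrite rmorph0 mul0r big1 // => t _; by rewrite mcoeff0 scale0r.
    rewrite [c j in LHS](expand (l := D - e j) d0); first last.
    - by apply: zhomog_eq (hc j); lia.
    - exact: leq_subr.
    rewrite rmorph_sum mulr_suml /=; apply: eq_big => t; first by apply/eqP/eqP; lia.
    by rewrite psubZ scalerAl.
  have /fin_all_exists [k kE] := hs.
  exists (\matrix_(b, a) k b (enum_val a)); apply/matrixP => b b'; rewrite !mxE.
  have := congr1 (fun p => p@_(mon (enum_val b'))) (kE b).
  rewrite mcoeffX linear_sum /= => h.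
  transitivity ((mon (enum_val b) == mon (enum_val b'))%:R : rat); last first.
    by rewrite (inj_eq (@mon_inj _)) (inj_eq enum_val_inj).
  rewrite h [RHS]big_enum_val /=; apply: eq_bigr => a _; by rewrite !mxE mcoeffZ.
have rf : row_free Umx.
  rewrite /row_free eqn_leq rank_leq_row /=.
  have := mxrankM_maxr K Umx; rewrite KU mxrank1; apply: leq_trans.
  by rewrite -(count_eq D w0 d0 count).
move=> rel t tT.
pose l : 'rV[rat]_#|TD| := \row_a lam (enum_val a).
have : l *m Umx = 0 *m Umx.
  rewrite mul0mx; apply/matrixP => z b; rewrite !mxE.
  have := congr1 (fun p => p@_(mon (enum_val b))) rel; rewrite mcoeff0 linear_sum /= => h.
  apply: (etrans _ h); rewrite [RHS]big_enum_val /=.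
  by apply: eq_bigr => a _; rewrite !mxE mcoeffZ.
move/(row_free_inj rf) => /matrixP /(_ 0 (enum_rank_in tT t)).
by rewrite !mxE enum_rankK_in.
Qed.

Lemma free_degree (c : J -> {mpoly rat[M]}) : (forall j, zhomog d (D%:Z - (e j)%:Z) (c j)) ->
  \sum_j psub f (c j) * vb j = 0 -> forall j, c j = 0.
Proof.
move=> hc rel; pose lam (t : T) := (c t.1)@_(mon t.2).
have lam0 : forall t, t \in TD -> lam t = 0.
  apply: Umx_free.
  rewrite (eq_bigl (fun t : T => true && ((e t.1 + \sum_i d i * t.2 i)%N == D))); last first.
    by move=> t; rewrite inE.
  rewrite -(pair_big_dep xpredT (fun j (t : {ffun 'I_M -> 'I_D.+1}) => (e j + \sum_i d i * t i)%N == D)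
       (fun j t => (c j)@_(mon t) *: u (j, t))) /=; apply: (etrans _ rel).
  apply: eq_bigr => j _; rewrite /u /=.
  case: (leqP (e j) D) => eD; last first.
    have -> : c j = 0.
      apply: contraTeq eD => nz; have [l lE] := zhomog_neg (hc j) nz; lia.
    rewrite rmorph0 mul0r big1 // => t _; by rewrite mcoeff0 scale0r.
  rewrite [c j in RHS](expand (l := D - e j) d0); first last.
  - by apply: zhomog_eq (hc j); lia.
  - exact: leq_subr.
  rewrite rmorph_sum mulr_suml /=; apply: eq_big => t; first by apply/eqP/eqP; lia.
  by rewrite psubZ scalerAl.
move=> j; case: (leqP (e j) D) => eD; last first.
  by apply: contraTeq eD => nz; have [l lE] := zhomog_neg (hc j) nz; lia.
rewrite [c j](expand (l := D - e j) d0); first last.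
- by apply: zhomog_eq (hc j); lia.
- exact: leq_subr.
rewrite big1 // => t /eqP tE; have /lam0 : (j, t) \in TD by rewrite inE /= tE subnKC.
by rewrite /lam /= => ->; rewrite scale0r.
Qed.

End Degree.

Lemma homog_basis_of_span : homog_basis w d f (fun j => (e j)%:Z) vb.
Proof.
split.
- exact: f_homog.
- exact: vb_homog.
- exact: span_all.
- move=> c rel j.
  (* The part of degree [D] of the relation involves the part of [c j] of degree [D - e j]. The test
     guards against truncated subtraction: for [e j > D] nothing contributes. *)
  pose cD (D : nat) j := if (e j <= D)%N then pihomog (wdeg d) (D - e j) (c j) else 0.
  have cD0 D : forall j, cD D j = 0.
    apply: (@free_degree D).
      move=> j'; rewrite /cD; case: leqP => eD; last exact: zhomog0.
      by rewrite subzn //; apply/zhomogP/pihomogP.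
    have pp (p : {mpoly rat[M]}) (l : nat) : pihomog (wdeg w) l (psub f p) = psub f (pihomog (wdeg d) l p).
      elim/mpolyind: p => [|a m p _ _ ih]; first by rewrite !(rmorph0, linear0).
      rewrite rmorphD !linearD rmorphD /= ih psubZ !linearZ /= psubZ; congr (_ *: _ + _).
      have h : psub f 'X_[m] \is (wdeg d m).-homog for (wdeg w).
        by apply/zhomogP; apply: (zhomog_psub f_homog (@zhomogXm _ d m)).
      rewrite pihomogX; case: eqP => [<-|/eqP ne]; first by rewrite pihomog_dE.
      by rewrite rmorph0 (pihomog_ne0 ne h).
    have := congr1 (pihomog (wdeg w) D) rel; rewrite linear0 linear_sum /= => h; apply: (etrans _ h).
    apply: eq_bigr => j' _; rewrite /cD; case: leqP => eD.
      by rewrite -[in RHS](subnK eD) pihomogM // pp.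
    by rewrite rmorph0 mul0r (pihomogM_lt _ eD).
  rewrite (pihomog_partitionE (mf := wdeg d) (leqnn (mmeasure (wdeg d) (c j)))).
  apply: big1 => l _; have := cD0 (l + e j)%N j.
  by rewrite /cD leq_addl addnK.
- move=> D a ha; have [->|nz] := eqVneq a 0.
    exists (fun=> 0); split=> [|j]; last exact: zhomog0.
    by rewrite big1 // => j _; rewrite rmorph0 mul0r.
  have [D' DE] := zhomog_neg ha nz; rewrite DE in ha *.
  exact: span_homog.
Qed.

End FreeOfSpan.

(* The degrees of the monomials of degree at most s in variables of weights
   1, .., p. *)
Fixpoint bdegs (p : nat) : nat -> seq nat :=
  match p with
  | 0 => fun=> [:: 0%N]
  | p'.+1 => fix F (s : nat) := match s with
    | 0 => [:: 0%N]
    | s'.+1 => bdegs p' s'.+1 ++ [seq (e + p'.+1)%N | e <- F s'] end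
  end.

(** * Spanning by monomials of bounded degree *)

Section Spanning.
Variable N : nat.
Local Notation A := {mpoly rat[N]}.
Variables (x h : nat -> A).
Hypothesis x0 : x 0 = 1.
Hypothesis h0 : h 0 = 1.

(** The monomials of total degree at most [s] in [x 1], .., [x p]. The recursion is that of [bdegs],
    so that the two lists match position by position. *)
Fixpoint bmons (p : nat) : nat -> seq A :=
  match p with
  | 0 => fun=> [:: 1]
  | p'.+1 => fix F (s : nat) := match s with
    | 0 => [:: 1]
    | s'.+1 => bmons p' s'.+1 ++ [seq x p'.+1 * v | v <- F s'] end
  end.

Definition is_ideal (I : A -> Prop) : Prop :=
  [/\ I 0, forall a b, I a -> I b -> I (a + b) & forall a b, I b -> I (a * b)].

(** Phrased as an induction principle: the constants, [I] and [x 1], .., [x p] generate the ring. *)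
Definition generates (p : nat) (I : A -> Prop) : Prop :=
  forall P : A -> Prop, (forall a b, P a -> P b -> P (a + b)) -> (forall a b, P a -> P b -> P (a * b)) ->
    (forall c, P c%:MP) -> (forall a, I a -> P a) -> (forall i, (1 <= i <= p)%N -> P (x i)) ->
    forall a, P a.

Definition in_span (I : A -> Prop) (V : seq A) (a : A) : Prop :=
  exists c : seq rat, size c = size V /\ I (a - \sum_(t <- zip c V) t.1%:MP * t.2).

Lemma is_idealN I a : is_ideal I -> I a -> I (- a).
Proof. by case=> _ _ hM Ia; rewrite -mulN1r; apply: hM. Qed.

Lemma generates_const I : is_ideal I -> generates 0 I -> forall a, in_span I [:: 1] a.
Proof.
case=> I0 ID IM gen a; have [c Ic] : exists c : rat, I (a - c%:MP).
  apply: (gen (fun a => exists c : rat, I (a - c%:MP))) => [|||b Ib|i]; last by case/andP=> i1 /(leq_trans i1).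
  - move=> a1 b1 [c Ic] [d Id]; exists (c + d); rewrite mpolyCD opprD addrACA; exact: ID.
  - move=> a1 b1 [c Ic] [d Id]; exists (c * d); rewrite mpolyCM.
    have -> : a1 * b1 - c%:MP * d%:MP = b1 * (a1 - c%:MP) + c%:MP * (b1 - d%:MP) by ring.
    by apply: ID; apply: IM.
  - by move=> c; exists c; rewrite subrr.
  - by exists 0; rewrite mpolyC0 subr0.
by exists [:: c]; split => //; rewrite big_seq1 mulr1.
Qed.

(* Pascal's rule: bmons p s.+1 spans modulo I and x p.+1, and bmons p.+1 s spans
   modulo the annihilator of x p.+1 modulo I. *)
Lemma in_span_spanning p s : forall I, is_ideal I ->
  (forall m, (0 < m <= s + p)%N -> I (\sum_(i < p.+1 | (i <= m)%N) x i * h (m - i))) ->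
  (forall m, (s < m <= s + p)%N -> I (h m)) -> generates p I ->
  forall a, in_span I (bmons p s) a.
Proof.
elim: p s => [|p ihp] s; first by move=> I hI _ _; apply: generates_const.
elim: s => [|s ihs] I hI rel hh gen.
  (* For [s = 0] all [h m] in the range lie in [I]; the relations then put [x 1], .., [x p.+1] into
     [I] by induction on the index, and only constants remain. *)
  apply: generates_const => //; move: (hI) => [I0 ID IM].
  have xI i : (1 <= i <= p.+1)%N -> I (x i).
    elim/ltn_ind: i => i ih /andP[i1 ip].
    have mi : (0 < i <= 0 + p.+1)%N by rewrite i1.
    have := rel i mi; rewrite (bigD1 (Ordinal (ip : (i < p.+2)%N))) /=; last exact: leqnn.
    rewrite subnn h0 mulr1 => Is; rewrite -[x i](addrK (\sum_(j < p.+2 | (j <= i)%N && (j != Ordinal (ip : (i < p.+2)%N))) x j * h (i - j))).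
    apply: (ID _ _ Is); apply: is_idealN => //.
    apply: (big_ind I) => [//|b c|j /andP[ji jn]]; first exact: ID.
    have jni : (j < i)%N by rewrite ltn_neqAle ji andbT; apply: contraNneq jn => e; apply/eqP/val_inj.
    case: (posnP j) => [->|j0]; last by rewrite mulrC; apply/IM/ih => //; rewrite j0; apply: leq_trans (ltnW jni) ip.
    by rewrite subn0; apply/IM/hh; rewrite add0n i1.
  move=> P PD PM PC PI _; apply: gen => // i hi; apply/PI/xI; exact: hi.
move: (hI) => [I0 ID IM] a.
pose I1 b := exists y z, I y /\ b = y + x p.+1 * z.
have hI1 : is_ideal I1.
  split; first by exists 0, 0; rewrite mulr0 addr0.
  - move=> b c [y [z [Iy ->]]] [y' [z' [Iy' ->]]]; exists (y + y'), (z + z').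
    by split; [apply: ID | ring].
  - move=> b c [y [z [Iy ->]]]; exists (b * y), (b * z); split; first exact: IM.
    by ring.
have II1 b : I b -> I1 b by exists b, 0; rewrite mulr0 addr0.
have [| | |c1 [sc1 [y [z [Iy yE]]]]] := ihp s.+1 I1 hI1 _ _ _ a.
- move=> m m0; have m1 : (0 < m <= s.+1 + p.+1)%N by move: m0; lia.
  have := rel m m1; rewrite big_mkcond big_ord_recr /= -big_mkcond /= => Im.
  set S := (X in I1 X).
  exists (S + (if (p.+1 <= m)%N then x p.+1 * h (m - p.+1) else 0)), (if (p.+1 <= m)%N then - h (m - p.+1) else 0).
  by split => //; case: ifP => _; ring.
- by move=> m hm; apply/II1/hh; move: hm; lia.
- move=> P PD PM PC PI Px; apply: gen => // [b Ib|i /andP[i1 ip]]; first by apply/PI/II1.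
  move: ip; rewrite leq_eqVlt => /orP[/eqP ->|ip]; last by apply: Px; rewrite i1.
  by apply: PI; exists 0, 1; rewrite add0r mulr1.
pose I2 b := I (x p.+1 * b).
have hI2 : is_ideal I2.
  split; rewrite /I2; first by rewrite mulr0.
  - by move=> b c Ib Ic; rewrite mulrDr; apply: ID.
  - by move=> b c Ic; rewrite mulrCA; apply: IM.
have II2 b : I b -> I2 b by apply: IM.
have [| | |c2 [sc2 Ic2]] := ihs I2 hI2 _ _ _ z.
- by move=> m m0; apply/II2/rel; move: m0; lia.
- move=> m /andP[sm mp].
  case: (ltnP s.+1 m) => sm1; first by apply/II2/hh; move: mp; lia.
  (* The one new membership, [h s.+1] in [I2], comes from the relation of top index: its last term
     is [x p.+1 * h s.+1], and in all the others the index of [h] exceeds [s.+1], so they lie in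
     [I]. *)
  have -> : m = s.+1 by lia.
  have m0 : (0 < s + p.+2 <= s.+1 + p.+1)%N by lia.
  have := rel _ m0; rewrite big_mkcond big_ord_recr /= ifT; last by lia.
  have -> : (s + p.+2 - p.+1 = s.+1)%N by lia.
  rewrite /I2 => IS.
  set T := (X in I (X + _)) in IS.
  rewrite -[x p.+1 * _](addKr T); apply: (ID) => //; apply: is_idealN => //.
  rewrite /T; apply: (big_ind I) => [//|b c Ib Ic|i _]; first exact: ID.
  case: ifP => // _; apply/IM/hh.
  by have := ltn_ord i; lia.
- move=> P PD PM PC PI Px; apply: gen => // b Ib; exact/PI/II2.
exists (c1 ++ c2); split; first by rewrite !size_cat size_map sc1 sc2.
have zmap (c : seq rat) V : \sum_(t <- zip c [seq x p.+1 * v | v <- V]) t.1%:MP * t.2 =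
    x p.+1 * \sum_(t <- zip c V) t.1%:MP * t.2.
  elim: c V => [|c c' ih] [|v V] /=; rewrite ?big_nil ?mulr0 //.
  by rewrite !big_cons ih mulrDr mulrCA.
rewrite [bmons _ _]/= zip_cat // big_cat /= zmap opprD addrA yE -addrA -mulrBr.
by apply: ID.
Qed.

Lemma size_bmons p s : size (bmons p s) = size (bdegs p s).
Proof.
elim: p s => // p ihp; elim=> // s ihs.
by rewrite [bmons _ _]/= [bdegs _ _]/= !size_cat !size_map ihp ihs.
Qed.

Lemma bmons_homog (w : 'I_N -> nat) p s : (forall i, (1 <= i <= p)%N -> zhomog w (2 * i)%N (x i)) ->
  forall j, (j < size (bmons p s))%N ->
  zhomog w (2 * nth 0%N (bdegs p s) j)%N (nth 0 (bmons p s) j).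
Proof.
have h1 (j : nat) : (j < 1)%N -> zhomog w (2 * nth 0%N [:: 0%N] j)%N (nth 0 [:: 1] j).
  by case: j => // _; rewrite -mpolyC1; apply: zhomogC.
elim: p s => [|p ihp] s hx; first exact: h1.
elim: s => [|s ihs] j; first exact: h1.
rewrite [bmons _ _]/= [bdegs _ _]/= !nth_cat size_cat -size_bmons size_map => js.
case: ltnP => js1.
  by apply: ihp js1 => i /andP[i1 ip]; apply: hx; rewrite i1 ltnW.
have js2 : (j - size (bmons p s.+1) < size (bmons p.+1 s))%N by rewrite ltn_subLR.
have js3 : (j - size (bmons p s.+1) < size (bdegs p.+1 s))%N by rewrite -size_bmons.
rewrite (nth_map (0 : A)) // (nth_map 0%N) //.
have hx1 : zhomog w (2 * p.+1)%N (x p.+1) by apply: hx; rewrite leqnn.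
by apply: zhomog_eq (zhomogM hx1 (ihs _ js2)); rewrite -PoszD mulnDr addnC.
Qed.

End Spanning.

(** * Gaussian binomials and the multiplicities *)

Section Counting.

(** Gauss's product formula for the binomial coefficient in the variable ['X^2], cleared of
    denominators; the recursion of [bdegs] is the corresponding Pascal rule. *)
Lemma bdegs_count p s :
  (\sum_(e <- bdegs p s) 'X^(2 * e)) * \prod_(j < p) (1 - 'X^(2 * j.+1)) =
  \prod_(j < p) (1 - 'X^(2 * (s + j.+1))) :> {poly rat}.
Proof.
elim: p s => [|p ihp] s; first by rewrite !big_ord0 big_seq1 muln0 expr0 mulr1.
elim: s => [|s ihs].
  by rewrite [bdegs _ _]/= big_seq1 muln0 expr0 mul1r.
pose P : {poly rat} := \prod_(j < p) (1 - 'X^(2 * (s.+1 + j.+1))).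
have h1 : (\sum_(e <- bdegs p s.+1) 'X^(2 * e)) * \prod_(j < p.+1) (1 - 'X^(2 * j.+1)) =
    P * (1 - 'X^(2 * p.+1)) :> {poly rat} by rewrite big_ord_recr mulrA ihp.
have h2 : (\sum_(e <- bdegs p.+1 s) 'X^(2 * e)) * \prod_(j < p.+1) (1 - 'X^(2 * j.+1)) =
    (1 - 'X^(2 * s.+1)) * P :> {poly rat}.
  rewrite ihs big_ord_recl addn1; congr (_ * _); apply: eq_bigr => j _.
  by rewrite lift0 -addSnnS.
rewrite [bdegs _ _]/= -[X in map _ X]/(bdegs p.+1 s) big_cat big_map mulrDl h1.
under eq_bigr do rewrite mulnDr exprD.
rewrite -mulr_suml mulrAC h2 big_ord_recr /= -/P.
have -> : 'X^(2 * (s.+1 + p.+1)) = 'X^(2 * p.+1) * 'X^(2 * s.+1) :> {poly rat}.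
  by rewrite -exprD -mulnDr addnC.
by ring.
Qed.

Lemma bdegs_le p s e : e \in bdegs p s -> (e <= p * s)%N.
Proof.
elim: p s e => [|p ihp] s e; first by rewrite inE => /eqP ->.
elim: s e => [|s ihs] e; first by rewrite inE => /eqP ->.
rewrite [bdegs _ _]/= mem_cat => /orP[/ihp|/mapP[e' /ihs h ->]].
  by move=> h; apply: leq_trans h _; rewrite leq_mul2r leqnSn orbT.
by rewrite mulnS addnC leq_add2l.
Qed.

(** Each quantum integer [m] is - q^-m (1 - q^(2 m)) / (q - q^-1). In the quotient the signs and
    denominators cancel, the powers of q leave q^-(p s), and the hypothesis gives the rest. *)
Lemma qbinom_in_field (F : fieldType) (q : F) p s :
  q != 0 -> (forall m, (0 < m)%N -> q ^+ m - 1 != 0) ->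
  (\sum_(e <- bdegs p s) q ^+ (2 * e)) * \prod_(j < p) (1 - q ^+ (2 * j.+1)) =
    \prod_(j < p) (1 - q ^+ (2 * (s + j.+1))) ->
  let qi m := (q ^+ m - q ^- m) / (q - q^-1) in
  let qf m := \prod_(1 <= k < m.+1) qi k in
  qf (p + s)%N / (qf p * qf (p + s - p)%N) =
  \sum_(e <- bdegs p s) q ^ (- (p * s)%:Z + 2 * e%:Z).
Proof.
move=> q0 q1 count qi qf.
have qd : q - q^-1 != 0.
  have -> : q - q^-1 = q^-1 * (q ^+ 2 - 1) by rewrite mulrBr mulr1 exprS mulKf // expr1.
  by rewrite mulf_neq0 ?invr_eq0 // q1.
have qiE m : qi m = - q ^- m * (1 - q ^+ (2 * m)) / (q - q^-1).
  rewrite /qi; congr (_ / _); rewrite mulNr -mulrN opprB mulrBr mulr1 mul2n -addnn exprD mulKf //.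
  by rewrite expf_neq0.
have qi0 m : (0 < m)%N -> qi m != 0.
  move=> m0; rewrite qiE -opprB mulrNN !mulf_neq0 ?invr_eq0 ?expf_neq0 // q1 //.
  by rewrite muln_gt0.
have qf0 m : qf m != 0.
  rewrite /qf; elim: m => [|m ih]; first by rewrite big_geq ?oner_eq0.
  by rewrite big_nat_recr //= mulf_neq0 ?qi0.
have qfD m : qf (m + s)%N = qf s * \prod_(j < m) qi (s + j.+1)%N.
  rewrite /qf; elim: m => [|m ih]; first by rewrite big_ord0 mulr1.
  by rewrite addSn big_nat_recr //= ih big_ord_recr /= mulrA addnS addnC.
have qfE m : qf m = \prod_(j < m) qi j.+1 by rewrite /qf big_add1 big_mkord.
rewrite addKn qfD; apply: (mulIf (x := qf p * qf s)); first by rewrite mulf_neq0.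
rewrite divfK ?mulf_neq0 // [RHS]mulrA [RHS]mulrC; congr (_ * _).
rewrite qfE; under [in LHS]eq_bigr do rewrite qiE.
rewrite (eq_bigr (fun j : 'I_p => - q ^- j.+1 * (1 - q ^+ (2 * j.+1)) / (q - q^-1)) (fun j _ => qiE j.+1)).
have split_prod (a : nat -> nat) : \prod_(j < p) (- q ^- a j * (1 - q ^+ (2 * a j)) / (q - q^-1)) =
   (\prod_(j < p) - q ^- a j) * (\prod_(j < p) (1 - q ^+ (2 * a j))) * (q - q^-1) ^- p.
  rewrite 2!big_split /=; congr (_ * _ * _).
  by rewrite prodr_const card_ord exprVn.
rewrite (split_prod (fun j => s + j.+1)%N) (split_prod S) -count.
have -> : \prod_(j < p) - q ^- (s + j.+1) = q ^- (p * s) * \prod_(j < p) - q ^- j.+1.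
  rewrite !prodrN mulrCA; congr (_ * _); rewrite -exprVn mulnC exprM.
  have -> : (q^-1 ^+ s) ^+ p = \prod_(j < p) q^-1 ^+ s by rewrite prodr_const card_ord.
  rewrite -big_split /=.
  by apply: eq_bigr => j _; rewrite exprD invfM exprVn.
have -> : \sum_(e <- bdegs p s) q ^ (- (p * s)%:Z + 2 * e%:Z) =
    q ^- (p * s) * \sum_(e <- bdegs p s) q ^+ (2 * e).
  by rewrite mulr_sumr; apply: eq_bigr => e _; rewrite expfzDr // -exprnN -PoszM -exprnP.
by rewrite -!mulrA; congr (_ * _); rewrite mulrCA.
Qed.

Lemma qq_neq0 : qq != 0.
Proof. by rewrite /qq tofrac_eq0 polyX_eq0. Qed.

Lemma qq_neq1 m : (0 < m)%N -> qq ^+ m - 1 != 0.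
Proof.
move=> m0; rewrite /qq -tofracXn -tofrac1 -tofracB tofrac_eq0.
by rewrite -size_poly_eq0 size_XnsubC.
Qed.

Lemma qbinom_bdegs p s : qbinom (p + s) p =
  \sum_(e <- bdegs p s) qq ^ (- (p * s)%:Z + 2 * e%:Z).
Proof.
apply: (qbinom_in_field qq_neq0 qq_neq1).
have := congr1 (@tofrac {poly rat}) (bdegs_count p s).
rewrite rmorphM rmorph_sum !rmorph_prod /=.
have E m : tofrac (1 - 'X^m : {poly rat}) = 1 - qq ^+ m by rewrite tofracB tofrac1 tofracXn.
under [X in _ * X]eq_bigr do rewrite E.
under [X in X * _]eq_bigr do rewrite tofracXn.
by under [in RHS]eq_bigr do rewrite E.
Qed.

(** Multiplication by [qq ^+ (p * s)] clears the negative exponents, so that the expansion becomes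
    an identity of polynomials. Its coefficients leave [epsilon] no choice for [l <= p * s]. *)
Lemma qmultE p s l : (l <= p * s)%N -> qmult l (p + s) p = count_mem l (bdegs p s).
Proof.
move=> lps.
have szE : ((p + s) * p - p ^ 2 = p * s)%N by rewrite mulnDl addKn mulnC.
have exE (m : nat) : - ((p + s) * p)%:Z + (p ^ 2)%:Z + 2 * m%:Z = - (p * s)%:Z + 2 * m%:Z.
  congr (_ + _); rewrite -szE; lia.
pose P (f : nat -> nat) := qbinom (p + s) p = \sum_(l < ((p + s) * p - p ^ 2).+1)
         (f l)%:R * qq ^ (- ((p + s) * p)%:Z + (p ^ 2)%:Z + 2 * (l : nat)%:Z).
have Pc : P (fun l => count_mem l (bdegs p s)).
  rewrite /P qbinom_bdegs szE.
  transitivity (\sum_(e <- bdegs p s) \sum_(l < (p * s).+1) if e == l then qq ^ (- (p * s)%:Z + 2 * e%:Z) else 0).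
    rewrite big_seq [RHS]big_seq; apply: eq_bigr => e /bdegs_le he.
    rewrite (bigD1 (Ordinal (he : (e < (p * s).+1)%N))) //= eqxx big1 ?addr0 // => i ni.
    by case: eqP => // E; case/negP: ni; apply/eqP/val_inj.
  rewrite exchange_big /=; apply: eq_bigr => i _; rewrite exE -big_mkcond /=.
  rewrite -sum1_count natr_sum mulr_suml; apply: eq_bigr => e /eqP ->.
  by rewrite mul1r.
have Pq : P (fun l => qmult l (p + s) p).
  exact: (ClassicalEpsilon.epsilon_spec (inhabits (fun=> 0%N)) P (ex_intro _ _ Pc)).
have : tofrac (\sum_(l < (p * s).+1) (qmult l (p + s) p)%:R * 'X^(2 * l)) =
       tofrac (\sum_(l < (p * s).+1) (count_mem (l : nat) (bdegs p s))%:R * 'X^(2 * l)) :> {fraction {poly rat}}.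
  have toE (f : nat -> nat) : P f -> tofrac (\sum_(l < (p * s).+1) (f l)%:R * 'X^(2 * l)) = qq ^+ (p * s) * qbinom (p + s) p.
    move=> ->; rewrite szE rmorph_sum mulr_sumr; apply: eq_bigr => i _.
    rewrite rmorphM rmorph_nat /= tofracXn exE mulrCA; congr (_ * _).
    by rewrite !exprnP -expfzDr ?qq_neq0 // addNKr PoszM.
  by rewrite (toE _ Pq) (toE _ Pc).
move/eqP; rewrite tofrac_eq => /eqP /(congr1 (fun r : {poly rat} => r`_(2 * l))).
have cE (f : nat -> nat) : (\sum_(l < (p * s).+1) (f l)%:R * 'X^(2 * l) : {poly rat})`_(2 * l) = (f l)%:R.
  rewrite coef_sum (bigD1 (Ordinal (lps : (l < (p * s).+1)%N))) //= big1 ?addr0 => [|i ni].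
    by rewrite -polyC_natr mul_polyC coefZ coefXn eqxx mulr1.
  rewrite -polyC_natr mul_polyC coefZ coefXn eqn_mul2l /=; case: eqP => [E|_]; last by rewrite mulr0.
  by case/negP: ni; apply/eqP/val_inj.
by rewrite (cE (fun l => qmult l (p + s) p)) (cE (fun l => count_mem l (bdegs p s))) => /eqP; rewrite Num.Theory.eqr_nat => /eqP.
Qed.

Lemma perm_flatten_count (t : seq nat) K : (forall e, e \in t -> (e < K)%N) ->
  perm_eq (flatten [seq nseq (count_mem j t) j | j <- iota 0 K]) t.
Proof.
move=> tK; apply/allP => a _ /=; apply/eqP; rewrite count_flatten -map_comp.
have cE : count_mem a \o (fun j => nseq (count_mem j t) j) =1 (fun j => (j == a) * count_mem a t)%N.
  by move=> j /=; rewrite count_nseq /=; case: (j =P a) => [->|_].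
rewrite (eq_map cE) sumnE big_map.
case: (ltnP a K) => aK.
  rewrite (bigD1_seq a) ?mem_iota ?iota_uniq //= eqxx mul1n big1 ?addn0 // => j /negbTE ->.
  by rewrite mul0n.
have -> : count_mem a t = 0%N.
  by apply/count_memPn/negP => /tK; rewrite ltnNge aK.
by rewrite big1 // => j _; rewrite muln0.
Qed.

End Counting.

Section Misc.

Lemma mtens_shiftl N (X Y : mfact N) m : mrel (mtens (mshift X m) Y) (mshift (mtens X Y) m).
Proof.
exists id, id, (fun=> false), (fun=> false); split.
- by split; exists id.
- by case=> [[x y]|[x y]] /=; rewrite addrAC.
- by case=> [[x y]|[x y]] /=; rewrite addrAC.
- by move=> t s; rewrite !mul1r.
- by move=> t s; rewrite !mul1r.
Qed.

Lemma msubst_munit N N' (f : {mpoly rat[N]} -> {mpoly rat[N']}) : msubst f (munit N) = munit N'.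
Proof.
rewrite /msubst /munit; congr MFact; first by apply: functional_extensionality => -[].
by apply: functional_extensionality => -[]; apply: functional_extensionality => -[].
Qed.

Lemma mrows_mtens_mrows N (s t : seq (krow N)) :
  mrel (mtens (mrows s (munit N)) (mrows t (munit N))) (mrows s (mrows t (munit N))).
Proof.
apply: mrel_trans (mrows_mtens _ _ _) _; apply: mrows_rel; exact: mtens_unit.
Qed.

Lemma mrows_comm N (s t : seq (krow N)) :
  mrel (mrows s (mrows t (munit N))) (mrows t (mrows s (munit N))).
Proof.
apply: mrel_trans (mrel_sym (mrows_mtens_mrows s t)) _.
exact: mrel_trans (mtens_swap _ _) (mrows_mtens_mrows t s).
Qed.

Lemma rows_pot_cat N (s t : seq (krow N)) : rows_pot (s ++ t) = rows_pot s + rows_pot t.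
Proof. by rewrite /rows_pot big_cat. Qed.

Lemma catw_lshift a b (u : 'I_a -> nat) (v : 'I_b -> nat) i : catw u v (lshift b i) = u i.
Proof. by rewrite /catw -[lshift b i]/(unsplit (inl i)) unsplitK. Qed.

Lemma catw_rshift a b (u : 'I_a -> nat) (v : 'I_b -> nat) i : catw u v (rshift a i) = v i.
Proof. by rewrite /catw -[rshift a i]/(unsplit (inr i)) unsplitK. Qed.

Lemma split_lshift a b (i : 'I_a) : split (lshift b i) = inl i.
Proof. by rewrite -[lshift b i]/(unsplit (inl i)) unsplitK. Qed.

Lemma split_rshift a b (i : 'I_b) : split (rshift a i) = inr i.
Proof. by rewrite -[rshift a i]/(unsplit (inr i)) unsplitK. Qed.

Lemma enum_ordD a b : enum 'I_(a + b) = map (@lshift a b) (enum 'I_a) ++ map (@rshift a b) (enum 'I_b).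
Proof.
have vE c : map (@nat_of_ord c) (enum 'I_c) = iota 0 c by exact: val_enum_ord.
apply: (inj_map (@ord_inj _)); rewrite vE.
rewrite map_cat iotaD; congr (_ ++ _).
  by rewrite -vE; apply: etrans (map_comp _ _ _).
rewrite -[in LHS](addn0 (0 + a)%N) iotaDl -vE; apply: etrans (map_comp _ _ _).
by apply: etrans (esym (map_comp _ _ _)) _.
Qed.

End Misc.

Section ElementarySeries.
Variables (N : nat) (w : 'I_N -> nat).

(** Identities for [esum] are checked on series, where they become products, and are carried back to
    the entries by [eser_uniq]. *)
Lemma eser_morph (R : comNzRingType) (f : {rmorphism {mpoly rat[N]} -> R}) p q
    (x : 'I_p -> 'I_N) (y : 'I_q -> 'I_N) :
  (forall j : 'I_p, w (x j) = 2 * j.+1)%N -> (forall j : 'I_q, w (y j) = 2 * j.+1)%N ->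
  eser (fun j => f (esum w x y j)) = eser (fun j => f 'X_(x j)) * eser (fun j => f 'X_(y j)).
Proof.
move=> wx wy; have := congr1 (map_poly f) (eser_esum wx wy).
rewrite rmorphM /= => h.
apply: (etrans _ (etrans h _)); first exact: (esym (map_eser f _)).
exact: (congr2 *%R (map_eser f _) (map_eser f _)).
Qed.

Lemma esum_homog p q (x : 'I_p -> 'I_N) (y : 'I_q -> 'I_N) (j : 'I_(p + q)) :
  zhomog w (2 * j.+1)%N (esum w x y j).
Proof. exact/zhomogP/pihomogP. Qed.

Lemma pvar_homog p (x : 'I_p -> 'I_N) : (forall j : 'I_p, w (x j) = 2 * j.+1)%N ->
  forall j : 'I_p, zhomog w (2 * j.+1)%N (pvar x j).
Proof. by move=> wx j; rewrite -wx; apply: zhomogX. Qed.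

Lemma eser0 (R : comNzRingType) r : eser (fun _ : 'I_r => 0 : R) = 1.
Proof. by rewrite /eser big1 ?addr0 // => j _; rewrite mulr0 scale0r. Qed.

Lemma eser_delta (R : comNzRingType) r : (0 < r)%N ->
  eser (fun j : 'I_r => (j == 0%N :> nat)%:R : R) = 1 - 'X.
Proof.
case: r => // r _; rewrite /eser big_ord_recl /= expr1 mulr1 scaleN1r expr1 big1 ?addr0 // => j _.
by rewrite mulr0 scale0r.
Qed.

(** At the point [a] both sequences are (1, 0, .., 0), so every mixed series is 1 - X. All
    coefficients of its inverse are 1, and by [pquo_diag] the quotient takes the value n + 1 up to
    sign. *)
Lemma cquo_neq0 n r (u v : 'I_r -> {mpoly rat[N]}) (a : 'I_N -> rat) : (0 < r <= n)%N ->
  (forall j, (u j).@[a] = (j == 0%N :> nat)%:R) -> (forall j, (v j).@[a] = (j == 0%N :> nat)%:R) ->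
  forall j, cquo n u v j != 0.
Proof.
case/andP=> r0 rn hu hv j; apply/eqP => /(congr1 (meval a)).
rewrite rmorph0 /= => h.
have mixE l : eser (fun k => (mix u v l k).@[a]) = 1 - 'X.
  rewrite -(eser_delta rat r0); apply: eq_eser => k; rewrite /mix.
  by case: ifP; rewrite ?hu ?hv.
have := etrans (esym (map_pquo (meval a) n j (eser (mix u v j)) (eser (mix u v j.+1)))) h.
move/(etrans (esym (congr2 (pquo n j) (map_eser (meval a) (mix u v j)) (map_eser (meval a) (mix u v j.+1))))).
move/(etrans (esym (congr2 (pquo n j) (mixE j) (mixE j.+1)))).
have jn : (j <= n)%N by apply: ltnW; apply: leq_trans rn.
rewrite pquo_diag //; last by rewrite coefB coef1 coefX subr0.
move/eqP; rewrite mulf_eq0 signr_eq0 mulf_eq0 Num.Theory.pnatr_eq0 /= /sinv.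
have lt : (n - j < n.+2)%N by lia.
rewrite opprB addrCA subrr addr0 coef_sum (bigD1 (Ordinal lt)) //= coefXn eqxx.
rewrite big1 ?addr0 ?oner_eq0 // => i ni; rewrite coefXn; case: eqP => // E.
by case/negP: ni; apply/eqP/val_inj.
Qed.

Lemma psub_esum N' (w' : 'I_N' -> nat) (g : 'I_N -> {mpoly rat[N']}) p q
    (x : 'I_p -> 'I_N) (y : 'I_q -> 'I_N) (x' : 'I_p -> 'I_N') (y' : 'I_q -> 'I_N') :
  (forall j : 'I_p, w (x j) = 2 * j.+1)%N -> (forall j : 'I_q, w (y j) = 2 * j.+1)%N ->
  (forall j : 'I_p, w' (x' j) = 2 * j.+1)%N -> (forall j : 'I_q, w' (y' j) = 2 * j.+1)%N ->
  (forall j, g (x j) = 'X_(x' j)) -> (forall j, g (y j) = 'X_(y' j)) ->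
  forall j, psub g (esum w x y j) = esum w' x' y' j.
Proof.
move=> wx wy wx' wy' gx gy; apply: eser_uniq.
apply: (etrans (eser_morph (psub g) wx wy)); apply: (etrans _ (esym (eser_esum wx' wy'))).
apply: (congr2 *%R); apply: eq_eser => j; apply: (etrans (psubX _ _)); [exact: gx | exact: gy].
Qed.

End ElementarySeries.

Section Vertices.
Variables (n p q N : nat) (w : 'I_N -> nat).
Variables (x : 'I_p -> 'I_N) (y : 'I_q -> 'I_N) (z : 'I_(p + q) -> 'I_N).
Hypothesis p0 : (0 < p)%N.
Hypothesis pqn : (p + q <= n)%N.
Hypothesis wx : forall j : 'I_p, (w (x j) = 2 * j.+1)%N.
Hypothesis wy : forall j : 'I_q, (w (y j) = 2 * j.+1)%N.
Hypothesis wz : forall j : 'I_(p + q), (w (z j) = 2 * j.+1)%N.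
Hypothesis x_inj : injective x.
Hypothesis z_inj : injective z.
Hypothesis xy : forall i j, x i != y j.
Hypothesis xz : forall i j, x i != z j.
Hypothesis yz : forall i j, y i != z j.

(** The first variables of [x] and of [z] are 1 and all others 0. Both [z] and e(x, y) then become
    (1, 0, .., 0), which is the kind of point that [cquo_neq0] asks for. *)
Let ev (i : 'I_N) : rat := ((i == x (Ordinal p0)) || [exists j, (i == z j) && (j == 0%N :> nat)])%:R.

Let ev_x j : ev (x j) = (j == 0%N :> nat)%:R.
Proof.
rewrite /ev (inj_eq x_inj); case: existsP => [[l /andP[/eqP xl _]]|_].
  by have := xz j l; rewrite xl eqxx.
by rewrite orbF.
Qed.

Let ev_y j : ev (y j) = 0.
Proof.
rewrite /ev eq_sym (negbTE (xy _ _)); case: existsP => // -[l /andP[/eqP yl _]].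
by have := yz j l; rewrite yl eqxx.
Qed.

Let ev_z j : ev (z j) = (j == 0%N :> nat)%:R.
Proof.
rewrite /ev eq_sym (negbTE (xz _ _)) /=; case: existsP => [[l /andP[/eqP/z_inj <- ->]] //|h].
by case: eqP => // j0; case: h; exists j; rewrite eqxx; apply/eqP.
Qed.

Let ev_esum (j : 'I_(p + q)) : (esum w x y j).@[ev] = (j == 0%N :> nat)%:R.
Proof.
move: j; apply: eser_uniq; apply: (etrans (eser_morph (meval ev) wx wy)).
rewrite (eq_eser (v := fun j : 'I_p => (j == 0%N :> nat)%:R)) => [|j]; last exact: etrans (mevalXU _ _) (ev_x j).
rewrite [X in _ * X](eq_eser (v := fun j : 'I_q => 0)) => [|j]; last exact: etrans (mevalXU _ _) (ev_y j).
by rewrite eser0 mulr1 !eser_delta // addn_gt0 p0.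
Qed.

Let neq_zs j : pvar z j != esum w x y j.
Proof.
pose a (i : 'I_N) : rat := (i == z j)%:R.
apply/eqP => /(congr1 (meval a)); rewrite mevalXU /a eqxx.
have : forall l, (esum w x y l).@[a] = 0.
  apply: eser_uniq; apply: (etrans (eser_morph (meval a) wx wy)).
  rewrite (eq_eser (v := fun j : 'I_p => 0)) => [|l]; last by apply: etrans (mevalXU _ _) _; rewrite /a (negbTE (xz _ _)).
  rewrite [X in _ * X](eq_eser (v := fun j : 'I_q => 0)) => [|l]; last by apply: etrans (mevalXU _ _) _; rewrite /a (negbTE (yz _ _)).
  by rewrite !eser0 mulr1.
by move=> -> /eqP; rewrite oner_eq0.
Qed.

Lemma merge_vertexE : merge_vertex n w x y z = mrows (crows n (pvar z) (esum w x y)) (munit N).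
Proof.
apply: chainE => //.
- exact: pvar_homog.
- by move=> j; apply: esum_homog.
- apply: (cquo_neq0 (a := ev)) => [|j|j]; last exact: ev_esum.
    by rewrite pqn addn_gt0 p0.
  by rewrite mevalXU.
Qed.

Lemma split_vertexE : split_vertex n w x y z =
  mshift (mrows (crows n (esum w x y) (pvar z)) (munit N)) (- (p * q)%:Z).
Proof.
rewrite /split_vertex chainE //.
- by move=> j; apply: esum_homog.
- exact: pvar_homog.
- by move=> j; rewrite eq_sym.
- apply: (cquo_neq0 (a := ev)) => [|j|j]; first by rewrite pqn addn_gt0 p0.
    exact: ev_esum.
  by rewrite mevalXU.
Qed.

End Vertices.

Lemma line2E n i : (0 < i <= n)%N ->
  line2 i n = mrows (crows n (pvar (@lshift i i)) (pvar (@rshift i i))) (munit _).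
Proof.
case/andP=> i0 iN; apply: chainE => //.
- by move=> j; apply: zhomog_eq (@zhomogX _ (weights2 i) _); rewrite /weights2 catw_lshift.
- by move=> j; apply: zhomog_eq (@zhomogX _ (weights2 i) _); rewrite /weights2 catw_rshift.
- move=> j; apply/eqP => /(congr1 (meval (fun l => (l == lshift i j)%:R))).
  by rewrite !mevalXU eqxx eq_rlshift => /eqP; rewrite oner_eq0.
- apply: (cquo_neq0 (a := fun l => ((l == lshift i (Ordinal i0)) || (l == rshift i (Ordinal i0)))%:R)) => [|j|j].
  + by rewrite i0.
  + by rewrite mevalXU eq_lrshift orbF eq_lshift.
  + by rewrite mevalXU eq_rlshift eq_rshift.
Qed.

(** * The two isomorphisms *)

Section RightSide.
Variable N : nat.

Lemma msumI_msumS (t : seq nat) c (Z : mfact N) :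
  mrel (msumI (fun j : 'I_(size t) => (2 * nth 0%N t j)%:Z) (mshift Z c))
    (msumS [seq c + 2 * e%:Z | e <- t] Z).
Proof.
apply: mrel_trans (msumI_mshift _ _ _) _; rewrite /msumS.
have sE : size [seq c + 2 * e%:Z | e <- t] = size t by rewrite size_map.
have bij : bijective (cast_ord sE) by exists (cast_ord (esym sE)); [exact: cast_ordK | exact: cast_ordKV].
apply: mrel_trans (msumI_reindex _ _ bij) _; apply: eq_msumI => j /=.
by rewrite (nth_map 0%N) -?sE // PoszM addrC.
Qed.

(** The list [bdegs p s], grouped by value, yields the multiplicities [qmult], and p (p + s) - p^2 =
    p s. Both isomorphisms have a right side of this form: with [m] = 0 in the first, and with [p]
    and [m] equal to i_2 in the second. *)
Lemma rhs_rel (X : mfact N) p s m :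
  mrel (mbigsum (p * (p + s) - p ^ 2).+1 (fun j => iter m (@mflip N)
         (mpower (mshift X (- (p * (p + s))%:Z + (p ^ 2)%:Z + 2 * j%:Z)) (qmult j (p + s) p))))
    (msumS [seq - (p * s)%:Z + 2 * e%:Z | e <- bdegs p s] (iter m (@mflip N) X)).
Proof.
have -> : (p * (p + s) - p ^ 2 = p * s)%N by lia.
pose c (j : nat) : int := - (p * s)%:Z + 2 * j%:Z.
have es : perm_eq (flatten [seq nseq (count_mem j (bdegs p s)) (c j) | j <- iota 0 (p * s).+1]) (map c (bdegs p s)).
  have := perm_map c (perm_flatten_count (t := bdegs p s) (K := (p * s).+1) (@bdegs_le p s)).
  rewrite map_flatten -map_comp; congr (perm_eq (flatten _) _).
  by apply: eq_map => j /=; rewrite map_nseq.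
apply: mrel_trans (msumS_perm _ es); apply: mbigsum_msumS => j jps.
rewrite qmultE // (_ : - (p * (p + s))%:Z + (p ^ 2)%:Z + 2 * j%:Z = c j); last by rewrite /c; lia.
apply: mrel_trans (iter_flip_rel m (mpower_msumS _ (mrel_refl _))) _.
exact: msumI_iter_flip.
Qed.

End RightSide.

Section IdealOf.
Variables (N M : nat) (f : 'I_M -> {mpoly rat[N]}).

Definition ideal_of (a : {mpoly rat[N]}) : Prop := exists q : 'I_M -> {mpoly rat[N]}, a = \sum_i q i * f i.

Lemma ideal_ofP : is_ideal ideal_of.
Proof.
split.
- by exists (fun=> 0); rewrite big1 // => i _; rewrite mul0r.
- move=> a b [q ->] [q' ->]; exists (fun i => q i + q' i); rewrite -big_split /=.
  by apply: eq_bigr => i _; rewrite mulrDl.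
- move=> a b [q ->]; exists (fun i => a * q i); rewrite mulr_sumr.
  by apply: eq_bigr => i _; rewrite mulrA.
Qed.

Lemma ideal_of_gen i : ideal_of (f i).
Proof.
exists (fun j => (j == i)%:R); rewrite (bigD1 i) //= eqxx mul1r big1 ?addr0 // => j /negbTE ->.
by rewrite mul0r.
Qed.

Variables (w : 'I_N -> nat) (d : 'I_M -> nat) (x h : nat -> {mpoly rat[N]}) (p s : nat).
Hypothesis w0 : forall i, (0 < w i)%N.
Hypothesis d0 : forall i, (0 < d i)%N.
Hypothesis f_homog : forall i, zhomog w (d i) (f i).
Hypothesis x_homog : forall i, (1 <= i <= p)%N -> zhomog w (2 * i)%N (x i).
Hypothesis h0 : h 0 = 1.
Hypothesis rel : forall m, (0 < m <= s + p)%N -> ideal_of (\sum_(i < p.+1 | (i <= m)%N) x i * h (m - i)).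
Hypothesis hh : forall m, (s < m <= s + p)%N -> ideal_of (h m).
Hypothesis gen : generates x p ideal_of.
Hypothesis count : (\prod_(j < p) (1 - 'X^(2 * (s + j.+1)))) * \prod_i (1 - 'X^(w i)) =
  (\prod_(j < p) (1 - 'X^(2 * j.+1))) * \prod_i (1 - 'X^(d i)) :> {poly rat}.

(** [in_span_spanning], for the ideal generated by the [f i], gives spanning. The hypothesis [count]
    combined with [bdegs_count] gives the equality of Hilbert series. *)
Lemma bmons_basis : homog_basis w d f (fun j : 'I_(size (bdegs p s)) => (2 * nth 0%N (bdegs p s) j)%:Z)
  (fun j => (bmons x p s)`_j).
Proof.
apply: homog_basis_of_span => //.
- by move=> j; apply: bmons_homog => //; rewrite size_bmons.
- move=> a; have [c [sc [q qE]]] := in_span_spanning h0 ideal_ofP rel hh gen a.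
  exists (fun j : 'I_(size (bdegs p s)) => c`_j), q; rewrite -qE.
  rewrite (big_nth (0, 0)) size_zip sc minnn size_bmons big_mkord addrC.
  have -> : \sum_(i < size (bdegs p s)) (nth (0, 0) (zip c (bmons x p s)) i).1%:MP * (nth (0, 0) (zip c (bmons x p s)) i).2
     = \sum_(j < size (bdegs p s)) (c`_j)%:MP * (bmons x p s)`_j.
    by apply: eq_bigr => i _; rewrite nth_zip.
  by rewrite subrK.
have F0 : \prod_(j < p) (1 - 'X^(2 * j.+1)) != 0 :> {poly rat}.
  apply/prodf_neq0 => j _; apply/eqP => /(congr1 (fun r : {poly rat} => r`_0)).
  by rewrite coefB coef1 coefXn coef0 subr0 => /eqP; rewrite oner_eq0.
apply: (mulfI F0); rewrite -count -bdegs_count mulrA; congr (_ * _); rewrite mulrC; congr (_ * _).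
by rewrite [RHS](big_nth 0%N) big_mkord.
Qed.

End IdealOf.

Lemma coefM_trunc (R : comNzRingType) (A B : {poly R}) p m : (size A <= p.+1)%N ->
  (A * B)`_m = \sum_(i < p.+1 | (i <= m)%N) A`_i * B`_(m - i).
Proof.
move=> sA; pose F i := if (i <= m)%N then A`_i * B`_(m - i) else 0.
have tail a b : (forall i, (a <= i)%N -> F i = 0) -> \sum_(i < a + b) F i = \sum_(i < a) F i.
  by move=> h; rewrite big_split_ord /= [X in _ + X]big1 ?addr0 // => i _; apply/h/leq_addr.
rewrite coefM [RHS]big_mkcond /= -(tail p.+1 m.+1) => [|i ip]; last first.
  by rewrite /F nth_default ?mul0r ?if_same //; apply: leq_trans ip.
rewrite addnC tail => [|i im]; last by rewrite /F leqNgt im.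
by apply: eq_bigr => i _; rewrite /F -ltnS ltn_ord.
Qed.

Section Rows.
Variables (n r N : nat).
Implicit Types u v : 'I_r -> {mpoly rat[N]}.

Lemma size_crows u v : size (crows n u v) = r.
Proof. by rewrite size_map size_enum_ord. Qed.

Lemma nth_crows d u v (j : 'I_r) : nth d (crows n u v) j = (cdeg n j, cquo n u v j, u j - v j).
Proof.
have jr : (j < size (enum 'I_r))%N by rewrite size_enum_ord.
by rewrite (nth_map j) // nth_ord_enum.
Qed.

End Rows.

Lemma psub_psum N N' (g : 'I_N -> {mpoly rat[N']}) n r (u : 'I_r -> {mpoly rat[N]}) :
  psub g (psum n (eser u)) = psum n (eser (fun j => psub g (u j))).
Proof. exact: etrans (map_psum _ _ _) (congr1 (psum n) (map_eser _ _)). Qed.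

Lemma potential2E r n : potential2 r n =
  psum n (eser (pvar (@lshift r r))) - psum n (eser (pvar (@rshift r r))).
Proof. by rewrite /potential2 !Fat_psum. Qed.

Lemma pincl_potential2 r n N (x : 'I_(r + r) -> 'I_N) : pincl x (potential2 r n) =
  psum n (eser (pvar (fun j => x (lshift r j)))) - psum n (eser (pvar (fun j => x (rshift r j)))).
Proof.
rewrite pinclE potential2E rmorphB /=.
apply: (congr2 (fun a b => a - b)); apply: (etrans (psub_psum _ _ _)); apply: (congr1 (psum n));
by apply: eq_eser => j; exact: psubX.
Qed.

Lemma weights2_lshift r j : weights2 r (lshift r j) = (2 * j.+1)%N.
Proof. by rewrite /weights2 catw_lshift. Qed.

Lemma weights2_rshift r j : weights2 r (rshift r j) = (2 * j.+1)%N.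
Proof. by rewrite /weights2 catw_rshift. Qed.

Lemma potential2_homog r n : zhomog (weights2 r) (2 * n.+1)%N (potential2 r n).
Proof.
rewrite potential2E; apply: zhomogB; apply: zhomog_psum; apply: gser_eser => j; apply: pvar_homog => l.
  exact: weights2_lshift.
exact: weights2_rshift.
Qed.

Lemma line2_pot r n : (0 < r <= n)%N -> mpot (line2 r n) (potential2 r n).
Proof.
move=> rn; rewrite line2E // -[potential2 r n]add0r potential2E -crows_pot; last by case/andP: rn.
exact: mpot_mrows (mpot_munit _).
Qed.

Lemma mpot_iter_flip N (X : mfact N) om m : mpot X om -> mpot (iter m (@mflip N) X) om.
Proof. by elim: m => // m ih /ih; apply: mpot_flip. Qed.

Lemma HMF_iso_of_hequiv r n N (w : 'I_N -> nat) (x : 'I_(r + r) -> 'I_N) X p s m : (0 < r <= n)%N ->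
  injective x -> (forall i, w (x i) = weights2 r i) ->
  mpot X (pincl x (potential2 r n)) ->
  hequiv (restrict_to x w X) (restrict_to id (weights2 r)
    (msumS [seq - (p * s)%:Z + 2 * e%:Z | e <- bdegs p s] (iter m (@mflip _) (line2 r n)))) ->
  HMF_iso (weights2 r) (potential2 r n) (restrict_to x w X)
    (restrict_to id (weights2 r) (mbigsum (p * (p + s) - p ^ 2).+1 (fun j => iter m (@mflip _)
         (mpower (mshift (line2 r n) (- (p * (p + s))%:Z + (p ^ 2)%:Z + 2 * j%:Z)) (qmult j (p + s) p))))).
Proof.
move=> rn x_inj wx potX heq; have R := rhs_rel (line2 r n) p s m.
split.
- exact: is_factorization_restrict x_inj wx (@potential2_homog r n) potX.
- apply: is_factorization_restrict (@potential2_homog r n) _ => //.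
  apply: mpot_rel (mrel_sym R) _; apply: mpot_msumI; apply: mpot_iter_flip.
  have -> : pincl id (potential2 r n) = potential2 r n by rewrite pinclE; apply: psub_id.
  exact: line2_pot.
- have := hequiv_trans heq (mrel_hequiv id (weights2 r) (mrel_sym R)); exact.
Qed.

Lemma big_ordD (R : comPzSemiRingType) a b (F : nat -> R) :
  \prod_(j < a + b) F j = (\prod_(j < a) F j) * \prod_(j < b) F (a + j)%N.
Proof. exact: big_split_ord. Qed.

Lemma big_catw (R : comPzSemiRingType) a b (u : 'I_a -> nat) (v : 'I_b -> nat) (F : nat -> R) :
  \prod_i F (catw u v i) = (\prod_i F (u i)) * \prod_i F (v i).
Proof.
rewrite big_split_ord; congr (_ * _); apply: eq_bigr => i _; rewrite ?catw_lshift //.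
by rewrite catw_rshift.
Qed.

Lemma catw_gt0 a b (u : 'I_a -> nat) (v : 'I_b -> nat) :
  (forall i, 0 < u i)%N -> (forall i, 0 < v i)%N -> forall i, (0 < catw u v i)%N.
Proof. by move=> u0 v0 i; rewrite /catw; case: split. Qed.

Lemma stdw_gt0 r (i : 'I_r) : (0 < stdw i)%N. Proof. by rewrite /stdw muln_gt0. Qed.

(** * An edge that splits and merges back *)

Section DigonRemoval.
Variables (n p q : nat).
Hypothesis p0 : (0 < p)%N.
Hypothesis pqn : (p + q <= n)%N.
Let r := (p + q)%N.
Let w := weights4 r r p q.
Let X1 := seq1 r r p q.
Let X2 := seq2 r r p q.
Let X3 := seq3 r r p q.
Let X4 := seq4 r r p q.
Let N1 := (r + r + r)%N.
Let w1 : 'I_N1 -> nat := catw (weights2 r) (@stdw r).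

Let w_X1 j : w (X1 j) = (2 * j.+1)%N. Proof. by rewrite /w /weights4 /X1 /seq1 !catw_lshift. Qed.
Let w_X2 j : w (X2 j) = (2 * j.+1)%N. Proof. by rewrite /w /weights4 /X2 /seq2 catw_lshift catw_rshift. Qed.
Let w_X3 j : w (X3 j) = (2 * j.+1)%N. Proof. by rewrite /w /weights4 /X3 /seq3 catw_rshift catw_lshift. Qed.
Let w_X4 j : w (X4 j) = (2 * j.+1)%N. Proof. by rewrite /w /weights4 /X4 /seq4 !catw_rshift. Qed.

Let es := esum w X3 X4.
Let lhs := mtens (merge_vertex n w X3 X4 X1) (split_vertex n w X3 X4 X2).
Let lhs' := mshift (mrows (crows n (pvar X1) es) (mrows (crows n es (pvar X2)) (munit _))) (- (p * q)%:Z).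

Let lhs_rel : mrel lhs lhs'.
Proof.
have X1_inj : injective X1 by move=> i j /lshift_inj/lshift_inj.
have X2_inj : injective X2 by move=> i j /lshift_inj/rshift_inj.
have X3_inj : injective X3 by move=> i j /rshift_inj/lshift_inj.
rewrite /lhs merge_vertexE // ?split_vertexE //.
- apply: mrel_trans (mtens_shift _ _ _) _; apply: mshift_rel; exact: mrows_mtens_mrows.
- by move=> i j; rewrite /X3 /X4 /seq3 /seq4 eq_rshift eq_lrshift.
- by move=> i j; rewrite /X3 /X2 /seq3 /seq2 eq_rlshift.
- by move=> i j; rewrite /X4 /X2 /seq4 /seq2 eq_rlshift.
- by move=> i j; rewrite /X3 /X4 /seq3 /seq4 eq_rshift eq_lrshift.
- by move=> i j; rewrite /X3 /X1 /seq3 /seq1 eq_rlshift.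
- by move=> i j; rewrite /X4 /X1 /seq4 /seq1 eq_rlshift.
Qed.

Let Y1 (j : 'I_r) : {mpoly rat[N1]} := 'X_(lshift r (lshift r j)).
Let Y2 (j : 'I_r) : {mpoly rat[N1]} := 'X_(lshift r (rshift r j)).
Let E (j : 'I_r) : {mpoly rat[N1]} := 'X_(rshift (r + r) j).

(** The ring with variables X_1, X_2, E maps to the full ring by sending E_j to e_j(X_3, X_4). All
    entries of [lhs'] lie in the image, so it is [Z] extended along [g]. *)
Let g (i : 'I_N1) : {mpoly rat[r + r + (p + q)]} :=
  match split i with inl t => 'X_(lshift _ t) | inr j => es j end.

Let g_l t : g (lshift _ t) = 'X_(lshift _ t). Proof. by rewrite /g split_lshift. Qed.
Let g_r j : g (rshift _ j) = es j. Proof. by rewrite /g split_rshift. Qed.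

Let Z := mrows (crows n Y1 E) (mrows (crows n E Y2) (munit _)).

Let lhs'E : lhs' = msubst (psub g) (mshift Z (- (p * q)%:Z)).
Proof.
rewrite -[msubst _ _]/(mshift (msubst (psub g) Z) _) /Z !msubst_mrows msubst_munit !psub_crows.
congr (mshift (mrows _ (mrows _ _)) _); apply: eq_crows => j; rewrite psubX ?g_l ?g_r //.
Qed.

Let xs i := (eser (pvar X3))`_i.
Let h i := (eser (pvar X4))`_i.
Let I := ideal_of g.

Let es_coef m : (0 < m)%N -> I (\sum_(i < p.+1 | (i <= m)%N) xs i * h (m - i)).
Proof.
move=> m0; rewrite /xs /h -coefM_trunc; last exact: size_eser.
rewrite -(eser_esum w_X3 w_X4); have [I0 ID IM] := ideal_ofP g.
case: m m0 => // m _; case: (ltnP m (p + q)) => mr; last by rewrite eser_coef_ge.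
rewrite (eser_coefS _ (Ordinal mr)); apply: IM; rewrite -/es -g_r; exact: ideal_of_gen.
Qed.

(** Modulo the e_j the series of X_4 is inverse to that of X_3, so its coefficients are obtained
    recursively from those of X_3. *)
Let gens : generates xs p I.
Proof.
move=> P PD PM PC PI Px.
have Pxs i : P (xs i).
  case: (posnP i) => [->|i0]; first by rewrite /xs eserM_coef0 -mpolyC1.
  case: (leqP i p) => ip; first by apply: Px; rewrite i0.
  by rewrite /xs eser_coef_ge // -mpolyC0.
have PN a : P a -> P (- a) by rewrite -mulN1r -mpolyC1 -mpolyCN; apply: PM.
have Psgn m a : P a -> P ((-1) ^+ m * a) by rewrite -signr_odd; case: odd; rewrite ?mul1r ?mulN1r //; apply: PN.
have Pinv m a : P ((-1) ^+ m * a) -> P a by move/(Psgn m); rewrite signrMK.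
have Ph m : P (h m).
  elim/ltn_ind: m => m ih; case: (posnP m) => [->|m0]; first by rewrite /h eserM_coef0 -mpolyC1.
  have /PI := es_coef m0; rewrite big_mkcond big_ord_recl /= subn0 {1}/xs eserM_coef0 mul1r.
  set S := \sum_(i < p) _ => PS.
  rewrite -[h m](addrK S); apply: (PD _ _ PS); apply: PN.
  apply: (big_ind P) => [|a b|i _]; first by rewrite -mpolyC0.
    exact: PD.
  by case: ifP => // im; [apply: PM => //; apply: ih; rewrite ltn_subrL m0 | rewrite -mpolyC0].
apply: mpoly_ring_ind => // i; rewrite -(splitK i); case: (split i) => j /=.
  by rewrite -g_l; apply/PI/ideal_of_gen.
rewrite -(splitK j); case: (split j) => l /=; apply: (Pinv l.+1).
  have := Pxs l.+1; rewrite /xs (eser_coefS _ l); exact.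
have := Ph l.+1; rewrite /h (eser_coefS _ l); exact.
Qed.

Let basis : homog_basis w w1 g (fun j : 'I_(size (bdegs p q)) => (2 * nth 0%N (bdegs p q) j)%:Z)
  (fun j => (bmons xs p q)`_j).
Proof.
have sw := stdw_gt0; apply: (bmons_basis (h := h)).
- by apply: catw_gt0; apply: catw_gt0.
- by apply: catw_gt0 => //; apply: catw_gt0.
- move=> i; rewrite /w1 /catw /g; case: (split i) => j; last exact: esum_homog.
  apply: zhomog_eq (@zhomogX _ w _); rewrite /w /weights4 catw_lshift //.
- case=> // i /andP[_ ip]; rewrite /xs (eser_coefS _ (Ordinal ip)) -signr_odd.
  apply/zhomog_sign/pvar_homog; exact: w_X3.
- exact: eserM_coef0.
- by move=> m /andP[m0 _]; apply: es_coef.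
- move=> m /andP[qm _]; rewrite /h eser_coef_ge //; by case: (ideal_ofP g).
- exact: gens.
rewrite /w /w1 /weights4 /weights2 !(big_catw _ _ (fun j => 1 - 'X^j)).
(* The weights 2, .., 2 (p + q) of E are separated into the first [q], which match those of X_4, and
   the last [p], which match the numerator of the Gaussian binomial. *)
rewrite [X in _ = _ * (_ * X)](_ : _ = (\prod_(j < q) (1 - 'X^(2 * j.+1))) * (\prod_(j < p) (1 - 'X^(2 * (q + j.+1)%N)))); last first.
  rewrite /r /stdw [in LHS]addnC (big_ordD q p (fun j => 1 - 'X^(2 * j.+1))); congr (_ * _).
  by apply: eq_bigr => j _; rewrite addnS.
rewrite /stdw; ring.
Qed.

Let base_g t : psub g (pincl (@lshift (r + r) r) t) = pincl (seq12 r r p q) t.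
Proof. by rewrite psub_pincl pinclE; apply: eq_psub => i; rewrite g_l. Qed.

Let elim : hequiv (restrict_to (@lshift (r + r) r) w1 Z) (restrict_to id (weights2 r) (line2 r n)).
Proof.
have rn : (r <= n)%N by [].
have hY1 (j : 'I_r) : zhomog w1 (2 * j.+1)%N (Y1 j).
  by apply: zhomog_eq (@zhomogX _ w1 _); rewrite /w1 catw_lshift weights2_lshift.
have hY2 (j : 'I_r) : zhomog w1 (2 * j.+1)%N (Y2 j).
  by apply: zhomog_eq (@zhomogX _ w1 _); rewrite /w1 catw_lshift weights2_rshift.
have hE (j : 'I_r) : zhomog w1 (2 * j.+1)%N (E j).
  by apply: zhomog_eq (@zhomogX _ w1 _); rewrite /w1 catw_rshift.
pose v (j : 'I_r) : {mpoly rat[r + r]} := 'X_(lshift r j).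
have -> : line2 r n = msubst (psub (retraction (@split (r + r) r) v)) (mrows (crows n E Y2) (munit _)).
  rewrite line2E ?addn_gt0 ?p0 // msubst_mrows psub_crows msubst_munit.
  congr mrows; apply: eq_crows => j; rewrite psubX /retraction ?split_rshift ?split_lshift //.
(* The differentials have degree [n.+1], half that of the potential. The second entries are Y1 - E,
   hence the scalar -1; E is replaced by Y1 and the rows between E and Y2 become the line. *)
apply: (@elim_hequiv _ _ _ _ id _ w1 (weights2 r) n.+1 (@lshift (r + r) r) (@rshift (r + r) r) _ _ _ _ v
  _ _ _ _ _ (rows_pot (crows n E Y2)) (potential2 r n) (-1)).
- by move=> t; rewrite split_lshift.
- by move=> t; rewrite split_rshift.
- by move=> i; have := splitK i; case: split.
- by [].
- by move=> t; rewrite /w1 catw_lshift.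
- move=> l; apply: zhomog_eq (@zhomogX _ (weights2 r) _); rewrite weights2_lshift /w1 catw_rshift //.
- by [].
- exact: size_crows.
- move=> j; rewrite nth_crows /= rmorphB /= psubX split_lshift psubX split_rshift ltnn psubX.
  by rewrite scaleN1r opprB.
- exact: crows_good.
- by apply: mgood_mrows; [apply: crows_good | apply: mgood_munit].
- by rewrite -[X in mpot _ X]add0r; apply/mpot_mrows/mpot_munit.
- by rewrite !crows_pot // pincl_potential2 addrC addrA subrK.
Qed.

Lemma digon_removal : HMF_iso (weights2 r) (potential2 r n)
     (restrict_to (seq12 r r p q) w lhs)
     (restrict_to id (weights2 r)
        (mbigsum (p * r - p ^ 2).+1 (fun j =>
           mpower (mshift (line2 r n) (- (p * r)%:Z + (p ^ 2)%:Z + 2 * j%:Z)) (qmult j r p)))).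
Proof.
have rn : (0 < r <= n)%N by rewrite addn_gt0 p0.
apply: (@HMF_iso_of_hequiv r n _ w _ lhs p q 0 rn).
- exact: lshift_inj.
- by move=> i; rewrite /w /weights4 /seq12 catw_lshift.
- apply: mpot_rel (mrel_sym lhs_rel) _; apply: mpot_shift.
  have := mpot_mrows (crows n (pvar X1) es) (mpot_mrows (crows n es (pvar X2)) (mpot_munit _)).
  by congr mpot; rewrite add0r !crows_pot // pincl_potential2 addrC addrA subrK.
apply: hequiv_trans (mrel_hequiv _ _ lhs_rel) _; rewrite lhs'E.
apply: hequiv_trans (free_extension basis base_g _) _.
apply: hequiv_trans (hequiv_msumI _ (hequiv_shift _ elim)) _.
exact: mrel_hequiv (msumI_msumS _ _ _).
Qed.

End DigonRemoval.

Lemma iter_flip_mshift N (X : mfact N) d m :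
  iter m (@mflip N) (mshift X d) = mshift (iter m (@mflip N) X) d.
Proof. by elim: m => // m ih; rewrite !iterS ih. Qed.

Lemma addB_cancel (V : zmodType) (a b c d : V) : b - (c + d) + (a + d - b) = a - c.
Proof. by rewrite addrC addrA subrK opprD addrA [a + d - c]addrAC addrK. Qed.

Lemma addB_cancel' (V : zmodType) (a b c d : V) : (b + d - (c + d)) + (a - b) = a - c.
Proof. by rewrite opprD [b + d + _]addrACA subrr addr0 [LHS]addrC addrA subrK. Qed.

(** If two series agree below some order, multiplication by a series with constant term 1 leaves the
    first coefficient of their difference unchanged. *)
Lemma eser_mul_triangular (R : comNzRingType) r r' (a b : 'I_r' -> R) (u v : 'I_r -> R) (F : {poly R})
    (i : 'I_r') (j : 'I_r) :
  eser a = eser u * F -> eser b = eser v * F -> F`_0 = 1 -> i = j :> nat ->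
  (forall k : 'I_r, (k < j)%N -> u k = v k) -> a i - b i = u j - v j.
Proof.
move=> ha hb F0 ij uv.
have : (eser a - eser b)`_i.+1 = ((eser u - eser v) * F)`_i.+1 by rewrite mulrBl ha hb.
rewrite coefB !eser_coefS -mulrBr coefM big_ord_recr /= big1 => [|k _]; last first.
  rewrite coefB; case: k => [[|k] /= kj]; first by rewrite !eserM_coef0 subrr mul0r.
  have kr : (k < r)%N by apply: ltn_trans (ltn_ord j); rewrite -ij.
  rewrite (eser_coefS u (Ordinal kr)) (eser_coefS v (Ordinal kr)) uv ?subrr ?mul0r //.
  by rewrite /= -ij.
rewrite add0r subnn F0 mulr1 ij coefB !eser_coefS -mulrBr => /(congr1 (fun t => (-1) ^+ j.+1 * t)).
by rewrite !signrMK.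
Qed.

(** * Merging with a closed edge *)

Section ClosedEdgeRemoval.
Variables (n p q : nat).
Hypothesis p0 : (0 < p)%N.
Hypothesis pqn : (p + q <= n)%N.
Let r := (p + q)%N.
Let s := (n - p - q)%N.
Let pn : (p <= n)%N. Proof. exact: leq_trans (leq_addr q p) pqn. Qed.

Let w := weights4 p p r q.
Let X1 := seq1 p p r q.
Let X2 := seq2 p p r q.
Let X3 := seq3 p p r q.
Let X4 := seq4 p p r q.

Let w_X1 j : w (X1 j) = (2 * j.+1)%N. Proof. by rewrite /w /weights4 /X1 /seq1 !catw_lshift. Qed.
Let w_X2 j : w (X2 j) = (2 * j.+1)%N. Proof. by rewrite /w /weights4 /X2 /seq2 catw_lshift catw_rshift. Qed.
Let w_X3 j : w (X3 j) = (2 * j.+1)%N. Proof. by rewrite /w /weights4 /X3 /seq3 catw_rshift catw_lshift. Qed.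
Let w_X4 j : w (X4 j) = (2 * j.+1)%N. Proof. by rewrite /w /weights4 /X4 /seq4 !catw_rshift. Qed.

Let e1 := esum w X1 X4.
Let e2 := esum w X2 X4.
Let lhs := mtens (split_vertex n w X1 X4 X3) (merge_vertex n w X2 X4 X3).
Let M1 := mrows (crows n e1 (pvar X3)) (mrows (crows n (pvar X3) e2) (munit _)).

Let lhs_rel : mrel lhs (mshift M1 (- (p * q)%:Z)).
Proof.
have X1_inj : injective X1 by move=> i j /lshift_inj/lshift_inj.
have X2_inj : injective X2 by move=> i j /lshift_inj/rshift_inj.
have X3_inj : injective X3 by move=> i j /rshift_inj/lshift_inj.
rewrite /lhs split_vertexE // ?merge_vertexE //.
- apply: mrel_trans (mtens_shiftl _ _ _) _; apply: mshift_rel; exact: mrows_mtens_mrows.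
- by move=> i j; rewrite /X2 /X4 /seq2 /seq4 eq_lrshift.
- by move=> i j; rewrite /X2 /X3 /seq2 /seq3 eq_lrshift.
- by move=> i j; rewrite /X4 /X3 /seq4 /seq3 eq_rshift eq_rlshift.
- by move=> i j; rewrite /X1 /X4 /seq1 /seq4 eq_lrshift.
- by move=> i j; rewrite /X1 /X3 /seq1 /seq3 eq_lrshift.
- by move=> i j; rewrite /X4 /X3 /seq4 /seq3 eq_rshift eq_rlshift.
Qed.

Let N2 := (p + p + q)%N.
Let w2 : 'I_N2 -> nat := catw (weights2 p) (@stdw q).
Let y1 (j : 'I_p) : 'I_N2 := lshift q (lshift p j).
Let y2 (j : 'I_p) : 'I_N2 := lshift q (rshift p j).
Let y4 (j : 'I_q) : 'I_N2 := rshift (p + p) j.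
Let w_y1 j : w2 (y1 j) = (2 * j.+1)%N. Proof. by rewrite /w2 catw_lshift weights2_lshift. Qed.
Let w_y2 j : w2 (y2 j) = (2 * j.+1)%N. Proof. by rewrite /w2 catw_lshift weights2_rshift. Qed.
Let w_y4 j : w2 (y4 j) = (2 * j.+1)%N. Proof. by rewrite /w2 catw_rshift. Qed.
Let f1 := esum w2 y1 y4.
Let f2 := esum w2 y2 y4.
Let M2 := mrows (crows n f1 f2) (munit _).

Let base2 : 'I_(p + p) -> 'I_N2 := @lshift (p + p) q.

Let psum_e1 : psum n (eser e1) = psum n (eser (pvar X1)) + psum n (eser (pvar X4)).
Proof. exact: (etrans (congr1 (psum n) (eser_esum w_X1 w_X4)) (psumM n (eserM_coef0 _) (eserM_coef0 _))). Qed.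
Let psum_e2 : psum n (eser e2) = psum n (eser (pvar X2)) + psum n (eser (pvar X4)).
Proof. exact: (etrans (congr1 (psum n) (eser_esum w_X2 w_X4)) (psumM n (eserM_coef0 _) (eserM_coef0 _))). Qed.

Let pot1 : rows_pot (crows n (pvar X3) e2) + rows_pot (crows n e1 (pvar X3)) =
  pincl (seq12 p p r q) (potential2 p n).
Proof.
apply: (etrans (congr2 +%R (etrans (crows_pot pqn _ _) (congr1 (fun t => _ - t) psum_e2))
  (etrans (crows_pot pqn _ _) (congr1 (fun t => t - _) psum_e1)))).
exact: etrans (addB_cancel _ _ _ _) (esym (pincl_potential2 _ _)).
Qed.

Let step2 : hequiv (restrict_to (seq12 p p r q) w M1) (restrict_to base2 w2 M2).
Proof.
pose io (t : 'I_N2) : 'I_(p + p + (r + q)) :=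
  match split t with inl a => lshift _ a | inr b => rshift _ (rshift r b) end.
pose cs (i : 'I_(p + p + (r + q))) : 'I_N2 + 'I_r :=
  match split i with inl a => inl (lshift _ a) | inr b =>
    match split b with inl l => inr l | inr m => inl (rshift _ m) end end.
have cs_X2 j : cs (X2 j) = inl (y2 j) by rewrite /cs /X2 /seq2 split_lshift.
have cs_X3 j : cs (X3 j) = inr j by rewrite /cs /X3 /seq3 split_rshift split_lshift.
have cs_X4 j : cs (X4 j) = inl (y4 j) by rewrite /cs /X4 /seq4 !split_rshift.
have cs_X1 j : cs (X1 j) = inl (y1 j) by rewrite /cs /X1 /seq1 split_lshift.
have -> : M2 = msubst (psub (retraction cs f1)) (mrows (crows n (pvar X3) e2) (munit _)).
  rewrite msubst_mrows psub_crows msubst_munit; apply: (congr1 (fun t => mrows t _)).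
  apply: eq_crows => j; first by rewrite psubX /retraction cs_X3.
  by symmetry; apply: (psub_esum w_X2 w_X4 w_y2 w_y4) => l; rewrite /retraction ?cs_X2 ?cs_X4.
apply: (@elim_hequiv _ _ _ _ base2 _ w w2 n.+1 io X3 cs _ _ _ f1
  _ _ _ _ _ (rows_pot (crows n (pvar X3) e2)) (potential2 p n) (-1)).
- move=> t; rewrite /io -{2}(splitK t); case: (split t) => a /=; rewrite /cs ?split_lshift //.
  by rewrite !split_rshift.
- exact: cs_X3.
- move=> i; rewrite -(splitK i); case: (split i) => a /=; first by rewrite /cs split_lshift /io split_lshift.
  rewrite -(splitK a); case: (split a) => b /=; rewrite /cs split_rshift ?split_lshift //.
  by rewrite split_rshift /io split_rshift.
- by move=> i; rewrite /io split_lshift.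
- move=> t; rewrite -(splitK t); case: (split t) => a /=; rewrite /io /w /w2 /weights4.
    by rewrite split_lshift !catw_lshift.
  by rewrite split_rshift !catw_rshift.
- by move=> l; rewrite w_X3; apply: esum_homog.
- by [].
- exact: size_crows.
- move=> j; rewrite nth_crows /= rmorphB /= scaleN1r opprB; congr (_ - _).
    rewrite (psub_esum w_X1 w_X4 w_X1 w_X4) => [|l|l]; last 2 first.
    + by rewrite cs_X1.
    + by rewrite cs_X4.
    symmetry; apply: (psub_esum w_y1 w_y4 w_X1 w_X4) => l; first by rewrite /io split_lshift.
    by rewrite /io split_rshift.
  by rewrite psubX cs_X3 ltnn.
- apply: crows_good => //; [exact: esum_homog | exact: pvar_homog].
- apply: mgood_mrows; last exact: mgood_munit.
  apply: crows_good => //; [exact: pvar_homog | exact: esum_homog].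
- by rewrite -[X in mpot _ X]add0r; apply/mpot_mrows/mpot_munit.
- exact: pot1.
Qed.

Let N3 := (N2 + p)%N.
Let w3 : 'I_N3 -> nat := catw w2 (@stdw p).
Let z1 (j : 'I_p) : 'I_N3 := lshift p (y1 j).
Let z2 (j : 'I_p) : 'I_N3 := lshift p (y2 j).
Let z4 (j : 'I_q) : 'I_N3 := lshift p (y4 j).
Let z (j : 'I_p) : 'I_N3 := rshift N2 j.
Let w_z1 j : w3 (z1 j) = (2 * j.+1)%N. Proof. by rewrite /w3 catw_lshift w_y1. Qed.
Let w_z2 j : w3 (z2 j) = (2 * j.+1)%N. Proof. by rewrite /w3 catw_lshift w_y2. Qed.
Let w_z4 j : w3 (z4 j) = (2 * j.+1)%N. Proof. by rewrite /w3 catw_lshift w_y4. Qed.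
Let w_z j : w3 (z j) = (2 * j.+1)%N. Proof. by rewrite /w3 catw_rshift. Qed.
Let g2 := esum w3 z2 z4.
Let gz := esum w3 z z4.
Let base3 (i : 'I_(p + p)) : 'I_N3 := lshift p (base2 i).
Let M3 := mrows (crows n (pvar z1) (pvar z)) (mrows (crows n gz g2) (munit _)).

Let psum_g2 : psum n (eser g2) = psum n (eser (pvar z2)) + psum n (eser (pvar z4)).
Proof. exact: (etrans (congr1 (psum n) (eser_esum w_z2 w_z4)) (psumM n (eserM_coef0 _) (eserM_coef0 _))). Qed.
Let psum_gz : psum n (eser gz) = psum n (eser (pvar z)) + psum n (eser (pvar z4)).
Proof. exact: (etrans (congr1 (psum n) (eser_esum w_z w_z4)) (psumM n (eserM_coef0 _) (eserM_coef0 _))). Qed.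

Let pot3 : rows_pot (crows n gz g2) + rows_pot (crows n (pvar z1) (pvar z)) = pincl base3 (potential2 p n).
Proof.
apply: (etrans (congr2 +%R (etrans (crows_pot pqn _ _) (congr2 (fun t t' => t - t') psum_gz psum_g2)) (crows_pot pn _ _))).
exact: etrans (addB_cancel' _ _ _ _) (esym (pincl_potential2 _ _)).
Qed.

(* Read backwards, this replaces y1 in one of its two occurrences by a new variable. *)
Let step3 : hequiv (restrict_to base3 w3 M3) (restrict_to base2 w2 M2).
Proof.
have -> : M2 = msubst (psub (retraction (@split N2 p) (pvar y1))) (mrows (crows n gz g2) (munit _)).
  rewrite msubst_mrows psub_crows msubst_munit; apply: (congr1 (fun t => mrows t _)).
  by apply: eq_crows => j; symmetry; [apply: (psub_esum w_z w_z4 w_y1 w_y4) | apply: (psub_esum w_z2 w_z4 w_y2 w_y4)]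
    => l; rewrite /retraction ?split_lshift ?split_rshift.
apply: (@elim_hequiv _ _ _ _ base2 _ w3 w2 n.+1 (@lshift N2 p) z _ _ _ _ (pvar y1)
  _ _ _ _ _ (rows_pot (crows n gz g2)) (potential2 p n) (-1)).
- by move=> t; rewrite split_lshift.
- by move=> t; rewrite split_rshift.
- by move=> i; have := splitK i; case: split.
- by [].
- by move=> t; rewrite /w3 catw_lshift.
- by move=> l; rewrite w_z; apply: pvar_homog.
- by [].
- exact: size_crows.
- move=> j; rewrite nth_crows /= rmorphB /= !psubX split_lshift split_rshift ltnn.
  by rewrite scaleN1r opprB.
- apply: crows_good => //; exact: pvar_homog.
- apply: mgood_mrows; last exact: mgood_munit.
  apply: crows_good => //; exact: esum_homog.
- by rewrite -[X in mpot _ X]add0r; apply/mpot_mrows/mpot_munit.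
- exact: pot3.
Qed.

Let row (j : 'I_r) : krow N3 := (cdeg n j, cquo n gz g2 j, gz j - g2 j).
Let rows1 := [seq row (lshift q j) | j : 'I_p <- enum 'I_p].
Let rows2 := [seq row (rshift p l) | l : 'I_q <- enum 'I_q].
Let M4 := mrows rows1 (mrows rows2 (mrows (crows n (pvar z1) (pvar z)) (munit _))).

Let rowsE : crows n gz g2 = rows1 ++ rows2.
Proof. by rewrite /crows enum_ordD map_cat; congr (_ ++ _); exact: (esym (map_comp _ _ _)). Qed.

Let step4 : mrel M3 M4.
Proof.
by rewrite /M4 -(mrows_cat rows1) -rowsE; exact: (mrows_comm (crows n (pvar z1) (pvar z)) (crows n gz g2)).
Qed.

Let dl (l : 'I_q) := cdeg n (p + l)%N.
Let L2 := mrows (crows n (pvar y1) (pvar y2)) (munit _).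
Let M5 := mrows [seq (dl l, cquo n f2 f2 (rshift p l), 0) | l : 'I_q <- enum 'I_q] L2.

(** The rows [rows1] now eliminate the duplicate [z] in favour of [y2]. This makes [gz] equal to
    [g2]: the second entries of [rows2] become 0, their quotients are taken at equal arguments, and
    the rows between [z1] and [z] turn into a line. *)
Let step5 : hequiv (restrict_to base3 w3 M4) (restrict_to base2 w2 M5).
Proof.
pose G (j : 'I_p) (i : 'I_N3) : {mpoly rat[N3]} := match split i with
  | inl _ => 'X_i | inr l => if (l < j)%N then psub (fun t => 'X_(lshift p t)) (pvar y2 l) else 'X_i end.
have good t : t \in rows1 ++ rows2 -> row_good w3 n.+1 t.
  rewrite -rowsE; apply: crows_good => //; exact: esum_homog.
have -> : M5 = msubst (psub (retraction (@split N2 p) (pvar y2))) (mrows rows2 (mrows (crows n (pvar z1) (pvar z)) (munit _))).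
  have F2 j : psub (retraction (@split N2 p) (pvar y2)) (g2 j) = f2 j.
    by apply: (psub_esum w_z2 w_z4 w_y2 w_y4) => l; rewrite /retraction split_lshift.
  have Fz j : psub (retraction (@split N2 p) (pvar y2)) (gz j) = f2 j.
    by apply: (psub_esum w_z w_z4 w_y2 w_y4) => l; rewrite /retraction ?split_lshift ?split_rshift.
  rewrite !msubst_mrows psub_crows msubst_munit /M5 /L2; apply: (congr2 (fun a b => mrows a (mrows b _))).
    apply: (etrans _ (map_comp _ _ _)); apply: eq_map => l; rewrite /= /rsubst /=; apply: (congr2 pair); last by rewrite rmorphB /= F2 Fz subrr.
    apply: (congr1 (pair _)); apply: (etrans _ (esym (psub_cquo _ _ _ _ _))).
    by apply: eq_cquo.
  by apply: eq_crows => j; rewrite psubX /retraction ?split_lshift ?split_rshift.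
apply: (@elim_hequiv _ _ _ _ base2 _ w3 w2 n.+1 (@lshift N2 p) z _ _ _ _ (pvar y2)
  _ _ _ _ _ (rows_pot (crows n (pvar z1) (pvar z)) + rows_pot rows2) (potential2 p n) 1).
- by move=> t; rewrite split_lshift.
- by move=> t; rewrite split_rshift.
- by move=> i; have := splitK i; case: split.
- by [].
- by move=> t; rewrite /w3 catw_lshift.
- by move=> l; rewrite w_z; apply: pvar_homog.
- by [].
- by rewrite size_map size_enum_ord.
- move=> j; rewrite -[X in psub X]/(G j).
  have jr : (j < size (enum 'I_p))%N by rewrite size_enum_ord.
  rewrite (nth_map j) // nth_ord_enum [X in psub _ X]/= rmorphB /= scale1r.
  pose u (l : 'I_p) := G j (z l).
  have G1 l : G j (z1 l) = 'X_(z1 l) by rewrite /G split_lshift.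
  have G2 l : G j (z2 l) = 'X_(z2 l) by rewrite /G split_lshift.
  have G4 l : G j (z4 l) = 'X_(z4 l) by rewrite /G split_lshift.
  have GzE l : u l = if (l < j)%N then 'X_(z2 l) else 'X_(z l) by rewrite /u /G split_rshift psubX.
  transitivity (u j - pvar z2 j); last by rewrite GzE ltnn psubX.
  (* Both series contain the factor of X_4. With the earlier duplicates already set to [y2], the
     coefficient at [j] of the difference is just [z_j - y2_j]. *)
  apply: (@eser_mul_triangular _ _ _ (fun l => psub (G j) (gz l)) (fun l => psub (G j) (g2 l)) u (pvar z2)
    (eser (pvar z4)) (lshift q j)).
  + apply: (etrans (eser_morph (psub (G j)) w_z w_z4)); apply: (congr2 *%R); apply: eq_eser => l.
      exact: psubX.
    exact: etrans (psubX _ _) (G4 l).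
  + apply: (etrans (eser_morph (psub (G j)) w_z2 w_z4)); apply: (congr2 *%R); apply: eq_eser => l.
      exact: etrans (psubX _ _) (G2 l).
    exact: etrans (psubX _ _) (G4 l).
  + exact: eserM_coef0.
  + by [].
  + by move=> k kj; rewrite GzE kj.
- by move=> t t1; apply: good; rewrite mem_cat t1.
- apply: mgood_mrows => [t t2|]; first by apply: good; rewrite mem_cat t2 orbT.
  apply: mgood_mrows; last exact: mgood_munit.
  apply: crows_good => //; exact: pvar_homog.
- apply: mpot_mrows; rewrite -[X in mpot _ X]add0r; exact: mpot_mrows (mpot_munit _).
- rewrite -pot3 rowsE rows_pot_cat; ring.
Qed.

(** The last [q] variables of this second copy of the ring stand for the G_l, with the degrees of
    the polynomials that [g] assigns to them. *)
Let w5 : 'I_N2 -> nat := catw (weights2 p) (fun l : 'I_q => 2 * (n - (p + l)))%N.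
Let g (i : 'I_N2) : {mpoly rat[N2]} :=
  match split i with inl t => 'X_(lshift q t) | inr l => cquo n f2 f2 (rshift p l) end.
Let g_l t : g (lshift _ t) = 'X_(lshift _ t). Proof. by rewrite /g split_lshift. Qed.
Let g_r l : g (rshift _ l) = cquo n f2 f2 (rshift p l). Proof. by rewrite /g split_rshift. Qed.
Let Z := mrows [seq (dl l, 'X_(rshift (p + p) l), 0) | l : 'I_q <- enum 'I_q] L2.

Let M5E : M5 = msubst (psub g) Z.
Proof.
rewrite !msubst_mrows psub_crows msubst_munit /M5 /L2; apply: (congr2 (fun a b => mrows a (mrows b _))).
  by apply: (etrans _ (map_comp _ _ _)); apply: eq_map => l; rewrite /= /rsubst /= rmorph0 psubX g_r.
by apply: eq_crows => j; rewrite psubX g_l.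
Qed.

Let xs i := (eser (pvar y4))`_i.
Let h i := (sinv n.+2 (eser f2))`_i.
Let I := ideal_of g.

Let g_rE (l : 'I_q) : g (rshift _ l) = (-1) ^+ (p + l) * (n.+1%:R * h (n - (p + l))).
Proof.
rewrite g_r /cquo; have ln : (p + l <= n)%N by have := ltn_ord l; lia.
have mixE j : mix f2 f2 j =1 f2 by move=> k; rewrite /mix if_same.
apply: (etrans (congr2 (pquo n _) (eq_eser (mixE _)) (eq_eser (mixE _)))).
apply: pquo_diag => //; exact: eserM_coef0.
Qed.

(** The index n - (p + l), for l < q, runs exactly through s + 1, .., s + q, so these coefficients
    are the G_l up to sign and the factor n + 1, which is invertible in the rationals. *)
Let h_ideal m : (s < m <= s + q)%N -> I (h m).
Proof.
move=> hm; have lq : (n - p - m < q)%N by move: hm pqn; rewrite /s; lia.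
have := g_rE (Ordinal lq); rewrite /= (_ : (n - (p + (n - p - m)))%N = m); last by move: hm pqn; rewrite /s; lia.
move=> gE; have [_ _ IM] := ideal_ofP g.
have -> : h m = (((n.+1%:R)^-1)%:MP * (-1) ^+ (p + (n - p - m))) * g (rshift _ (Ordinal lq)).
  have inv : ((n.+1%:R : rat)^-1)%:MP * n.+1%:R = 1 :> {mpoly rat[N2]}.
    by rewrite -(mpolyC_nat N2 rat n.+1) -mpolyCM mulVf ?mpolyC1 // Num.Theory.pnatr_eq0.
  by rewrite gE -mulrA signrMK mulrA inv mul1r.
exact/IM/ideal_of_gen.
Qed.

(** The sum is a coefficient of E(X_4) / E(X_2, X_4) = 1 / E(X_2), valid up to order n + 1. In
    positive degree it lies in the ideal generated by the variables [y2], hence in [I]. *)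
Let rel m : (0 < m <= s + q)%N -> I (\sum_(i < q.+1 | (i <= m)%N) xs i * h (m - i)).
Proof.
case/andP=> m0 ms; rewrite /xs /h -coefM_trunc; last exact: size_eser.
have [I0 ID IM] := ideal_ofP g.
set T := _ * _.
have TE : eqX n.+2 (eser (pvar y2) * T) 1.
  by rewrite /T mulrA -(eser_esum w_y2 w_y4); apply: sinvP; apply: eserM_coef0.
have mn : (m < n.+2)%N by move: ms pqn; rewrite /s; lia.
have := eqX_coef TE mn; rewrite coef1 (negbTE (lt0n_neq0 m0)) coefM big_ord_recl subn0 eserM_coef0 mul1r.
move/eqP; rewrite addr_eq0 => /eqP ->.
apply: is_idealN (ideal_ofP g) _; apply: (big_ind I) => [//|a b|i _]; first exact: ID.
rewrite mulrC; apply: (IM); rewrite lift0; case: (ltnP i p) => ip; last by rewrite eser_coef_ge.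
rewrite (eser_coefS _ (Ordinal ip)); apply: IM; rewrite /pvar /y2 -g_l; exact: ideal_of_gen.
Qed.

Let gens : generates xs q I.
Proof.
move=> P PD PM PC PI Px.
have Pinv m a : P ((-1) ^+ m * a) -> P a.
  rewrite -signr_odd; case: odd; rewrite ?mul1r // mulN1r => /(PM _ _ (PC (-1))).
  by rewrite mpolyCN mpolyC1 mulN1r opprK.
apply: mpoly_ring_ind => // i; rewrite -(splitK i); case: (split i) => j /=.
  by rewrite -g_l; apply/PI/ideal_of_gen.
apply: (Pinv j.+1); have jq : (0 < j.+1 <= q)%N by rewrite /= ltn_ord.
have := Px _ jq; rewrite /xs (eser_coefS _ j); exact.
Qed.

Let basis : homog_basis w2 w5 g (fun j : 'I_(size (bdegs q s)) => (2 * nth 0%N (bdegs q s) j)%:Z)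
  (fun j => (bmons xs q s)`_j).
Proof.
have sw := stdw_gt0; apply: (bmons_basis (h := h)).
- by apply: catw_gt0 => //; apply: catw_gt0.
- apply: catw_gt0 => [|i]; first by apply: catw_gt0.
  by have := ltn_ord i; move: pqn; lia.
- move=> i; rewrite /w5 /catw /g; case: (split i) => j.
    by apply: zhomog_eq (@zhomogX _ w2 _); rewrite /w2 catw_lshift.
  have gf : gser w2 (eser f2) by apply: gser_eser => k; apply: esum_homog.
  have mixE k : mix f2 f2 k =1 f2 by move=> l; rewrite /mix if_same.
  rewrite /cquo (congr2 (pquo n _) (eq_eser (mixE _)) (eq_eser (mixE _))).
  exact: zhomog_pquo.
- case=> // i /andP[_ ip]; rewrite /xs (eser_coefS _ (Ordinal ip)) -signr_odd.
  apply/zhomog_sign/pvar_homog; exact: w_y4.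
- by rewrite /h sinv_coef0 // eserM_coef0.
- exact: rel.
- exact: h_ideal.
- exact: gens.
rewrite /w2 /w5 !(big_catw _ _ (fun j => 1 - 'X^j)).
(* Read in reverse order, the weights 2 (n - (p + l)) of the G_l are 2 (s + 1), .., 2 (s + q), the
   exponents in the numerator of the Gaussian binomial. *)
rewrite [X in _ = _ * (_ * X)](_ : _ = \prod_(j < q) (1 - 'X^(2 * (s + j.+1)%N))); last first.
  rewrite (reindex_inj rev_ord_inj) /=; apply: eq_bigr => j _; congr (1 - 'X^(2 * _)%N).
  by have := ltn_ord j; move: pqn; rewrite /s; lia.
rewrite /stdw; ring.
Qed.

Let base_g t : psub g (pincl base2 t) = pincl base2 t.
Proof. by rewrite psub_pincl pinclE; apply: eq_psub => i; rewrite g_l. Qed.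

Let D := \sum_(l < q) dl l.

Let L2_pot : mpot L2 (pincl base2 (potential2 p n)).
Proof.
have := mpot_mrows (crows n (pvar y1) (pvar y2)) (mpot_munit _).
by rewrite add0r crows_pot // pincl_potential2.
Qed.

Let step7 : hequiv (restrict_to base2 w5 Z)
  (restrict_to id (weights2 p) (mshift (iter q (@mflip _) (line2 p n)) D)).
Proof.
rewrite -iter_flip_mshift.
(* Elimination acts through the second entry of a row. After the exchange of entries, the variable
   standing for G_l is there and can be set to 0, at the cost of [q] flips and the shift [D]. *)
apply: hequiv_trans (mrel_hequiv _ _ (mrows_swap _ _)) _.
rewrite size_map size_enum_ord big_map big_enum_cond /= -map_comp.
apply: hequiv_iter_flip; apply: hequiv_shift.
have -> : line2 p n = msubst (psub (retraction (@split (p + p) q) (fun=> 0))) L2.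
  rewrite line2E ?p0 // msubst_mrows psub_crows msubst_munit; congr mrows.
  by apply: eq_crows => j; rewrite psubX /retraction split_lshift.
apply: (@elim_hequiv _ _ _ _ id _ w5 (weights2 p) n.+1 (@lshift (p + p) q) (@rshift (p + p) q) _ _ _ _ (fun=> 0)
  _ _ _ _ _ (pincl base2 (potential2 p n)) (potential2 p n) 1).
- by move=> t; rewrite split_lshift.
- by move=> t; rewrite split_rshift.
- by move=> i; have := splitK i; case: split.
- by [].
- by move=> t; rewrite /w5 catw_lshift.
- by move=> l; apply: zhomog0.
- by [].
- by rewrite size_map size_enum_ord.
- move=> j; have jr : (j < size (enum 'I_q))%N by rewrite size_enum_ord.
  by rewrite (nth_map j) // nth_ord_enum /= psubX split_rshift ltnn rmorph0 subr0 scale1r.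
- move=> t /mapP [l _ ->]; split; first exact: zhomog0.
  apply: zhomog_eq (@zhomogX _ w5 _); rewrite /w5 catw_rshift [(_, _, _).1.1]/= /dl /cdeg.
  by have := ltn_ord l; move: pqn; lia.
- apply: mgood_mrows; last exact: mgood_munit.
  have wy1 (j : 'I_p) : w5 (y1 j) = (2 * j.+1)%N by rewrite /w5 catw_lshift weights2_lshift.
  have wy2 (j : 'I_p) : w5 (y2 j) = (2 * j.+1)%N by rewrite /w5 catw_lshift weights2_rshift.
  apply: crows_good => //; exact: pvar_homog.
- exact: L2_pot.
- rewrite /rows_pot big_map big1 ?addr0 // => l _; by rewrite /= mul0r.
Qed.

(** [D] sums to q (2 p + q - n). Together with the shift by - p q in the splitting vertex this gives
    - q s, the lowest exponent of the quantum binomial. *)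
Let DE : D - (p * q)%:Z = - (q * s)%:Z.
Proof.
have sum_dl m : \sum_(l < m) cdeg n (p + l)%N = m%:Z * (2 * p%:Z + m%:Z - n%:Z).
  elim: m => [|m ih]; first by rewrite big_ord0 mul0r.
  have cE : cdeg n (p + m) = 2 * (p%:Z + m%:Z + 1) - (n%:Z + 1) by rewrite /cdeg; lia.
  rewrite big_ord_recr [LHS]/= ih cE (_ : m.+1%:Z = m%:Z + 1); last by lia.
  ring.
have -> : D = q%:Z * (2 * p%:Z + q%:Z - n%:Z) by exact: sum_dl.
have sE : s%:Z = n%:Z - p%:Z - q%:Z by clear - pqn; rewrite /s; lia.
rewrite !PoszM sE; ring.
Qed.

Lemma closed_edge_removal : HMF_iso (weights2 p) (potential2 p n)
     (restrict_to (seq12 p p r q) w lhs)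
     (restrict_to id (weights2 p)
        (mbigsum (q * (n - p) - q ^ 2).+1 (fun j =>
           iter q (@mflip (p + p))
             (mpower (mshift (line2 p n) (- (q * (n - p))%:Z + (q ^ 2)%:Z + 2 * j%:Z)) (qmult j (n - p) q))))).
Proof.
have -> : (n - p = q + s)%N by move: pqn; rewrite /s; lia.
have rn : (0 < p <= n)%N by rewrite p0.
apply: (@HMF_iso_of_hequiv p n _ w _ lhs q s q rn).
- exact: lshift_inj.
- by move=> i; rewrite /w /weights4 /seq12 catw_lshift.
- apply: mpot_rel (mrel_sym lhs_rel) _; apply: mpot_shift; rewrite -pot1.
  by have := mpot_mrows (crows n e1 (pvar X3)) (mpot_mrows (crows n (pvar X3) e2) (mpot_munit _)); rewrite add0r.
apply: hequiv_trans (mrel_hequiv _ _ lhs_rel) _.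
have chain : hequiv (restrict_to (seq12 p p r q) w M1) (restrict_to base2 w2 (msubst (psub g) Z)).
  rewrite -M5E; apply: hequiv_trans step2 _; apply: hequiv_trans (hequiv_sym step3) _.
  exact: hequiv_trans (mrel_hequiv _ _ step4) step5.
apply: hequiv_trans (hequiv_shift _ chain) _.
apply: hequiv_trans (free_extension basis base_g (mshift Z (- (p * q)%:Z))) _.
apply: hequiv_trans (hequiv_msumI _ (hequiv_shift _ step7)) _.
apply: hequiv_trans (mrel_hequiv _ _ (msumI_rel _ (mshift_shift _ _ _))) _.
rewrite DE; exact: mrel_hequiv (msumI_msumS _ _ _).
Qed.

End ClosedEdgeRemoval.

Unset Implicit Arguments.

Theorem proposition3p8 (n i1 i2 : nat)
    (hi1 : (1 <= i1 <= n - 1)%N) (hi2 : (1 <= i2 <= n - 1)%N)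
    (hi3 : (i1 + i2 <= n)%N) :
  let i3 := (i1 + i2)%N in
  (let w := weights4 i3 i3 i1 i2 in
   let X1 := seq1 i3 i3 i1 i2 in
   let X2 := seq2 i3 i3 i1 i2 in
   let X3 := seq3 i3 i3 i1 i2 in
   let X4 := seq4 i3 i3 i1 i2 in
   HMF_iso (weights2 i3) (potential2 i3 n)
     (restrict_to (seq12 i3 i3 i1 i2) w
        (mtens (merge_vertex n w X3 X4 X1) (split_vertex n w X3 X4 X2)))
     (restrict_to id (weights2 i3)
        (mbigsum (i1 * i3 - i1 ^ 2).+1 (fun j =>
           mpower (mshift (line2 i3 n)
                     (- (i1 * i3)%:Z + (i1 ^ 2)%:Z + 2 * j%:Z))
                  (qmult j i3 i1)))))
  /\
  (let w := weights4 i1 i1 i3 i2 in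
   let X1 := seq1 i1 i1 i3 i2 in
   let X2 := seq2 i1 i1 i3 i2 in
   let X3 := seq3 i1 i1 i3 i2 in
   let X4 := seq4 i1 i1 i3 i2 in
   HMF_iso (weights2 i1) (potential2 i1 n)
     (restrict_to (seq12 i1 i1 i3 i2) w
        (mtens (split_vertex n w X1 X4 X3) (merge_vertex n w X2 X4 X3)))
     (restrict_to id (weights2 i1)
        (mbigsum (i2 * (n - i1) - i2 ^ 2).+1 (fun j =>
           iter i2 (@mflip (i1 + i1))
             (mpower (mshift (line2 i1 n)
                        (- (i2 * (n - i1))%:Z + (i2 ^ 2)%:Z + 2 * j%:Z))
                     (qmult j (n - i1) i2)))))).
Proof.
have p0 : (0 < i1)%N by case/andP: hi1.
by split; [exact: digon_removal | exact: closed_edge_removal].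
Qed.
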